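(* With the notation of the context, let $L>0$, $S_{-L},S_{+L}\in L^2(\Omega)$, $\phi_{\pm L}=(S_{\pm L},0)$, and for $\psi\in\mathcal R(\mathcal A)\cap\mathcal D(\mathcal A)$ and $c_1,c_2\in\mathbb R$ let, for $z\in[-L,L]$, $$T(z)=\sum_{i<0}(\psi|\phi_i)_{\mathcal H}e^{\lambda_i(z+L)}U_i+\sum_{i>0}(\psi|\phi_i)_{\mathcal H}e^{\lambda_i(z-L)}U_i+c_1+c_2(z+\Delta_\sigma^{-1}h),$$ where $c_1=c_2=0$ if the constants are controlled, and $c_2=0$ (the $c_2$ term being absent) if the constants are not controlled and $\int_\Omega h\ne0$. Then the Neumann inlet/outlet conditions $\partial_zT|_{z=-L}=S_{-L}$ and $\partial_zT|_{z=L}=S_{+L}$ are equivalent to the linear system $ZX=b$ (that is, with $c_1$ arbitrary when the constants are not controlled, the map $(\psi,c_2)\mapsto X$ is a bijection from the data satisfying these conditions onto the solutions $X$ of $ZX=b$ with first two entries in $\mathcal R(P)$ and the third entry, if any, real), where: - if the constants are controlled, $$Z=\begin{pmatrix} Id & M_+ \\ M_- & Id \end{pmatrix},\quad X=\begin{pmatrix} P\mathcal A\pi_-\psi \\ P\mathcal A\pi_+\psi \end{pmatrix},\quad b=\begin{pmatrix} \phi_{-L} \\ \phi_{+L} \end{pmatrix};$$ - if the constants are not controlled and $\int_\Omega h>0$, $$Z=\begin{pmatrix} Id & M_+ \\ M_- & Id \\ 0 & (M_+\,\cdot\,|u_-)_{\mathcal H} \end{pmatrix},\quad X=\begin{pmatrix}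 P\mathcal A\pi_-\psi \\ P\mathcal A\pi_+\psi \end{pmatrix},\quad b=\begin{pmatrix} \phi_{-L} \\ \phi_{+L} \\ (\phi_{-L}|u_-)_{\mathcal H} \end{pmatrix};$$ - in the balanced case, $$Z=\begin{pmatrix} Id & M_+ & \Phi \\ M_- & Id & \Phi \\ 0 & (M_+\,\cdot\,|u_-)_{\mathcal H} & (\Phi|u_-)_{\mathcal H} \\ (M_-\,\cdot\,|u_+)_{\mathcal H} & 0 & (\Phi|u_+)_{\mathcal H} \end{pmatrix},\quad X=\begin{pmatrix} P\mathcal A\pi_-\psi \\ P\mathcal A\pi_+\psi \\ c_2 \end{pmatrix},\quad b=\begin{pmatrix} \phi_{-L} \\ \phi_{+L} \\ (\phi_{-L}|u_-)_{\mathcal H} \\ (\phi_{+L}|u_+)_{\mathcal H} \end{pmatrix}.$$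
   Context: Let $\Omega\subset\mathbb R^2$ be a bounded connected Lipschitz domain whose boundary is partitioned (up to null sets) into $\Gamma_N,\Gamma_D,\Gamma_R,\Gamma_\sharp$ (Neumann, Dirichlet, Robin, periodic parts), each possibly empty, the nonempty ones having positive measure; $\Gamma_\sharp$ consists of pairs of opposite pieces identified by translations, and ''periodic on $\Gamma_\sharp$'' means that traces agree under this identification. Let $h\in L^\infty(\Omega)$, let $c,\sigma>0$ be scalar functions in $L^\infty(\Omega)$ with bounded inverses, and let $a>0$ be a constant. (The functions $T$ considered are solutions of $c\,\partial_{zz}T+\operatorname{div}(\sigma\nabla T)-h\,\partial_zT=0$ on $\Omega\times[-L,L]$ with homogeneous lateral boundary conditions.) The constants are *controlled* if $\Gamma_D\cup\Gamma_R\neq\emptyset$, and *not controlled* otherwise. The *balanced case* is: constants not controlled and $\int_\Omega h=0$. Let $V=\{s\in H^1(\Omega): s=0\text{ on }\Gamma_D,\ s\text{ periodic on }\Gamma_\sharp\}$; let $H=V$ if the constants are controlled and $H=V/\mathbb R$ (quotient by constants) if not. Let $\mathcal H=L^2(\Omega)\times H$ with scalar product $$((u,s)|(u',s'))_{\mathcal H}=\int_\Omega (cuu'+\sigma\nabla s\cdot\nabla s')+\int_{\Gamma_R}a\,ss'.$$ Let $\mathcal A(u,s)=(c^{-1}hu-c^{-1}\operatorname{div}(\sigma\nabla s),\,u)$ (second component taken in $H$) with domain $\mathcal D(\mathcal A)$ the set of $(u,s)\in\mathcal H$ with $u\in V$, $\operatorname{div}(\sigma\nabla s)\in L^2(\Omega)$,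 $\sigma\nabla s\cdot n=0$ on $\Gamma_N$, $\sigma\nabla s\cdot n=-as$ on $\Gamma_R$, and $\sigma\nabla s$ having periodic flux on $\Gamma_\sharp$. $\mathcal A$ is self-adjoint and has an orthogonal Hilbert basis of eigenvectors of $\mathcal H$. Its nonzero eigenvalues, counted with multiplicity, are $\cdots\le\lambda_{-2}\le\lambda_{-1}<0<\lambda_1\le\lambda_2\le\cdots$, with $\lambda_{\pm n}\to\pm\infty$, and pairwise orthogonal eigenvectors $\phi_i=(U_i,\lambda_i^{-1}U_i)$, $i\in\mathbb Z\setminus\{0\}$, normalized by $\|\phi_i\|_{\mathcal H}=1$. In the balanced case $\mathcal A$ has kernel $\mathbb R\phi_0$, $\phi_0=(1,\Delta_\sigma^{-1}h)$; otherwise its kernel is $\{0\}$. $\mathcal R(\mathcal A)$ is the orthogonal complement of the kernel in $\mathcal H$. In the balanced case, $\Delta_\sigma^{-1}h$ denotes the solution $s$ (unique up to constants) of $\operatorname{div}(\sigma\nabla s)=h$ with $\sigma\nabla s\cdot n=0$ on $\Gamma_N$, $s$ and its flux periodic on $\Gamma_\sharp$; when it is used as a function, a representative modulo constants (e.g. the one with zero average) is fixed once and for all. $P$ is the orthogonal projection $P(u,s)=(u,0)$ of $\mathcal H$, with range $\mathcal R(P)$. $\pi_\pm$ is the orthogonal projection of $\mathcal H$ onto the closed span $\mathcal R(\pi_\pm)$ of $\{\phi_i:\pm i>0\}$. It is known that $\pi_\pm P\pi_\pm$ is invertible with bounded inverse on $\mathcal R(\pi_\pm)$, and $B_\pm=\pi_\pm(\pi_\pm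 P\pi_\pm)^{-1}\pi_\pm$. $M_\pm=Pe^{\mp2L\mathcal A}B_\pm:\mathcal R(P)\to\mathcal R(P)$, where $e^{\mp2L\mathcal A}$ acts on $\mathcal R(\pi_\pm)$ by $\phi_i\mapsto e^{\mp2L\lambda_i}\phi_i$. Further notation: $\Phi=(1,0)$, $u_-=\Phi-PB_-\Phi$, $u_+=\Phi-PB_+\Phi$. In the block matrices, an entry which is an element of $\mathcal R(P)$ acts on a real number by multiplication, and $(M_\pm\,\cdot\,|u_\mp)_{\mathcal H}$ denotes the linear form $v\mapsto(M_\pm v|u_\mp)_{\mathcal H}$ on $\mathcal R(P)$. *)

(* Defs.v *)
From HB Require Import structures.
From mathcomp Require Import all_boot all_order all_algebra.
From mathcomp Require Import all_classical all_reals all_analysis.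

Set Implicit Arguments.
Unset Strict Implicit.
Unset Printing Implicit Defensive.

Import Order.TTheory GRing.Theory Num.Theory.
Import numFieldNormedType.Exports.

Local Open Scope classical_set_scope.
Local Open Scope ring_scope.

(* R * R with its usual topology; spelling out measurableTypeR makes the
   product sigma-algebra the one that carries the Lebesgue measure. *)
Notation plane R := (measurableTypeR R * measurableTypeR R)%type.

Section plane.
Context {R : realType}.
Implicit Types (W A D : set (plane R)) (f g s : plane R -> R).
Implicit Types (x y n : plane R).

Definition leb2 : {measure set (plane R) -> \bar R} :=
  (lebesgue_measure \x lebesgue_measure)%E.

(* The library norm on R * R is the max norm; lengths need the Euclidean
   distance. *)
Definition dist2 x y : R := Num.sqrt ((x.1 - y.1) ^+ 2 + (x.2 - y.2) ^+ 2).

Definition diam2 A : \bar R :=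
  ereal_sup (0%E |` [set (dist2 x y)%:E | x in A & y in A]).

(* One-dimensional Hausdorff measure, used as the arc length on boundaries.
   As an outer measure it is defined on all sets; only its values on Borel
   sets matter below. *)
Definition hausdorff1_delta (d : R) A : \bar R :=
  ereal_inf [set (\sum_(0 <= k <oo) diam2 (F k))%E | F in
    [set F : (set (plane R))^nat | A `<=` \bigcup_k F k /\
                               forall k, (diam2 (F k) <= d%:E)%E]].

Definition hausdorff1 A : \bar R :=
  ereal_sup [set hausdorff1_delta d A | d in [set d : R | 0 < d]].

Definition L2 (mu : set (plane R) -> \bar R) D f : Prop :=
  measurable_fun D f /\ (\int[mu]_(x in D) ((f x) ^+ 2)%:E < +oo)%E.

Definition Linfty W f : Prop :=
  measurable_fun W f /\
  exists M : R, {ae leb2, forall x, W x -> `|f x| <= M}.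

Definition axis (i : 'I_2) : plane R :=
  if i == 0 :> nat then (1, 0) else (0, 1).

Fixpoint of_class_C (k : nat) f : Prop :=
  continuous f /\
  if k is k'.+1 then
    forall i, (forall x, derivable f x (axis i)) /\
              of_class_C k' (fun x => 'D_(axis i) f x)
  else True.

Definition test_function W f : Prop :=
  (forall k, of_class_C k f) /\
  exists K : set (plane R),
    [/\ compact K, K `<=` W & forall x, ~ K x -> f x = 0].

Definition is_weak_partial W (i : 'I_2) s g : Prop :=
  L2 leb2 W g /\
  forall phi, test_function W phi ->
    \int[leb2]_(x in W) (s x * 'D_(axis i) phi x) =
    - \int[leb2]_(x in W) (g x * phi x).

Definition H1 W s : Prop :=
  L2 leb2 W s /\ forall i, exists g, is_weak_partial W i s g.

Definition weak_partial W i s : plane R -> R :=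
  xget (fun=> 0) [set g | is_weak_partial W i s g].

(* "div q belongs to L2", with value g. *)
Definition is_weak_div W (q : 'I_2 -> plane R -> R) g : Prop :=
  L2 leb2 W g /\
  forall phi, test_function W phi ->
    \int[leb2]_(x in W) (\sum_(i < 2) q i x * 'D_(axis i) phi x) =
    - \int[leb2]_(x in W) (g x * phi x).

Definition weak_div W q : plane R -> R :=
  xget (fun=> 0) [set g | is_weak_div W q g].

Definition frontier W : set (plane R) := closure W `\` W°.

(* Local condition at x0: in the orthonormal frame ((al, be), (- be, al))
   centred at x0, W is the region above the graph of a Lipschitz function. *)
Definition lipschitz_domain W : Prop :=
  [/\ open W, bounded_set W, connected W, W !=set0 &
    forall x0, frontier W x0 ->
      exists (al be r eta M : R) (gam : R -> R),
        [/\ al ^+ 2 + be ^+ 2 = 1, 0 < r, 0 < eta,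
            forall t t', `|gam t - gam t'| <= M * `|t - t'| &
            forall t y : R, `|t| < r -> `|y| < eta ->
              (W (x0.1 + t * al - y * be, x0.2 + t * be + y * al) <->
               gam t < y)]].

Definition is_outer_normal W x n : Prop :=
  n.1 ^+ 2 + n.2 ^+ 2 = 1 /\
  forall e : R, 0 < e -> exists2 r : R, 0 < r & forall y, dist2 y x < r ->
    let t := n.1 * (y.1 - x.1) + n.2 * (y.2 - x.2) in
    (t < - e * dist2 y x -> W y) /\ (e * dist2 y x < t -> ~ W y).

(* Trace of s on the boundary: the L2 boundary function g whose value at
   almost every boundary point x is approached by s, in mean, on the sets
   W `&` ball x r (max-norm balls, which give the same notion as Euclidean
   ones).  For s in H1 of a bounded Lipschitz domain this is the usual trace. *)
Definition is_trace W s g : Prop :=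
  L2 hausdorff1 (frontier W) g /\
  {ae hausdorff1, forall x, frontier W x ->
    (\int[leb2]_(y in W `&` ball x r) `|s y - g x|)
      / fine (leb2 (W `&` ball x r)) @[r --> 0^'+] --> (0 : R)}.

Definition trace W s : plane R -> R := xget (fun=> 0) [set g | is_trace W s g].

(* Square of the L2 distance, +oo if f - g is not square integrable. *)
Definition L2dist2 W f g : \bar R :=
  (\int[leb2]_(x in W) ((f x - g x) ^+ 2)%:E)%E.

Definition L2sum W (u : nat -> plane R -> R) : plane R -> R :=
  xget (fun=> 0) [set f | L2 leb2 W f /\
    L2dist2 W (fun x => \sum_(k < m) u k x) f @[m --> \oo] --> 0%E].

End plane.

(* The periodic part of the boundary consists of the pieces Gper j and their
   translates by tau j, for j < npairs. *)
Record problem (R : realType) := Problem {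
  Omega : set (plane R);
  GN : set (plane R);
  GD : set (plane R);
  GR : set (plane R);
  npairs : nat;
  Gper : 'I_npairs -> set (plane R);
  tau : 'I_npairs -> plane R;
  coef_h : plane R -> R;
  coef_c : plane R -> R;
  coef_sigma : plane R -> R;
  coef_a : R }.

Section problem.
Context {R : realType} (p : problem R).
(* Pairs of functions on the plane represent elements of the energy space; only
   their restriction to Omega matters, up to the equality heq below. *)
Local Notation E := ((plane R -> R) * (plane R -> R))%type.
Local Notation W := (Omega p).
Implicit Types (s v u : plane R -> R) (x y : E).

Definition Gper' (j : 'I_(npairs p)) : set (plane R) :=
  [set z + tau j | z in Gper j].

Definition Gsharp : set (plane R) := \bigcup_j (Gper j `|` Gper' j).

Definition boundary_part (i : 'I_4) : set (plane R) :=
  nth set0 [:: GN p; GD p; GR p; Gsharp] i.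

Definition valid_boundary : Prop :=
  [/\ forall i, measurable (boundary_part i)
                /\ boundary_part i `<=` frontier W,
      forall i, boundary_part i !=set0 -> (0 < hausdorff1 (boundary_part i))%E,
      forall i j, i != j ->
        hausdorff1 (boundary_part i `&` boundary_part j) = 0%E &
      hausdorff1 (frontier W `\` \bigcup_i boundary_part i) = 0%E].

(* "Opposite": the outer normals at two identified points are opposite. *)
Definition valid_pairs : Prop :=
  [/\ forall j : 'I_(npairs p), measurable (Gper j) /\ measurable (Gper' j),
      forall j : 'I_(npairs p), hausdorff1 (Gper j `&` Gper' j) = 0%E,
      forall i j : 'I_(npairs p), i != j ->
        hausdorff1 ((Gper i `|` Gper' i) `&` (Gper j `|` Gper' j)) = 0%E &
      forall j : 'I_(npairs p), {ae hausdorff1, forall z : plane R,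
        Gper j z -> forall n : plane R, is_outer_normal W z n ->
          is_outer_normal W (z + tau j) (- n)}].

Definition valid_coefficients : Prop :=
  [/\ Linfty W (coef_h p),
      [/\ Linfty W (coef_c p), Linfty W (fun z => (coef_c p z)^-1) &
          {ae leb2, forall z, W z -> 0 < coef_c p z}],
      [/\ Linfty W (coef_sigma p), Linfty W (fun z => (coef_sigma p z)^-1) &
          {ae leb2, forall z, W z -> 0 < coef_sigma p z}] &
      0 < coef_a p].

Definition valid_problem : Prop :=
  [/\ lipschitz_domain W, valid_boundary, valid_pairs & valid_coefficients].

Definition controlled : Prop := GD p `|` GR p !=set0.

Definition total_h : R := \int[leb2]_(z in W) coef_h p z.

Definition balanced : Prop := ~ controlled /\ total_h = 0.

Definition Vspace : set (plane R -> R) :=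
  [set s | H1 W s /\ exists g, [/\ is_trace W s g,
     {ae hausdorff1, forall z, GD p z -> g z = 0} &
     forall j : 'I_(npairs p),
       {ae hausdorff1, forall z, Gper j z -> g (z + tau j) = g z}]].

Definition flux s (i : 'I_2) : plane R -> R :=
  fun z => coef_sigma p z * weak_partial W i s z.

Definition robin_form s v : R :=
  coef_a p * fine (\int[hausdorff1]_(z in GR p) (trace W s z * trace W v z)%:E).

Definition Hspace : set E := [set x | L2 leb2 W x.1 /\ Vspace x.2].

(* Equality in L2 x H, where H is Vspace, or Vspace modulo constants. *)
Definition heq x y : Prop :=
  {ae leb2, forall z, W z -> x.1 z = y.1 z} /\
  if `[< controlled >] then {ae leb2, forall z, W z -> x.2 z = y.2 z}
  else exists k : R, {ae leb2, forall z, W z -> x.2 z = y.2 z + k}.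

Definition hdot x y : R :=
  \int[leb2]_(z in W) (coef_c p z * x.1 z * y.1 z +
     \sum_(i < 2) coef_sigma p z * weak_partial W i x.2 z
                                  * weak_partial W i y.2 z)
  + robin_form x.2 y.2.

Definition hnorm x : R := Num.sqrt (hdot x x).

(* Duality pairing of the normal trace of sigma grad s with the trace of v, by
   Green's formula. *)
Definition normal_flux s v : R :=
  \int[leb2]_(z in W) ((\sum_(i < 2) flux s i z * weak_partial W i v z) +
                       weak_div W (flux s) z * v z).

(* The three conditions on the normal flux of s (zero on GN, - a s on GR,
   periodic on Gsharp), in the weak sense: tested against the traces of Vspace,
   which vanish on GD and are periodic, the outward fluxes through two
   identified pieces cancelling out. *)
Definition flux_conditions s : Prop :=
  forall v, Vspace v -> normal_flux s v = - robin_form s v.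

Definition domA : set E :=
  [set x | [/\ Hspace x, Vspace x.1, exists g, is_weak_div W (flux x.2) g &
               flux_conditions x.2]].

Definition opA x : E :=
  (fun z => (coef_c p z)^-1 * coef_h p z * x.1 z
            - (coef_c p z)^-1 * weak_div W (flux x.2) z, x.1).

Definition kerA : set E := [set x | domA x /\ heq (opA x) 0].

(* Orthogonal complement of the kernel. *)
Definition RA : set E := [set x | Hspace x /\ forall y, kerA y -> hdot x y = 0].

Definition complete_Hspace : Prop :=
  forall u : nat -> E, (forall k, Hspace (u k)) ->
    (forall e : R, 0 < e -> exists N, forall k l, (N <= k)%N -> (N <= l)%N ->
       hnorm (u k - u l) < e) ->
    exists2 x, Hspace x & hnorm (u k - x) @[k --> \oo] --> (0 : R).

Definition self_adjointA : Prop :=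
  (forall x, Hspace x -> forall e : R, 0 < e ->
     exists2 y, domA y & hnorm (x - y) < e) /\
  (forall x y, Hspace x -> Hspace y ->
     ((domA x /\ heq (opA x) y) <->
      (forall v : E, domA v -> hdot (opA v) x = hdot v y))).

Definition closed_span (F : set E) : set E :=
  [set x | Hspace x /\ forall e : R, 0 < e ->
     exists (m : nat) (r : 'I_m -> R) (v : 'I_m -> E),
       (forall k, F (v k)) /\ hnorm (x - \sum_(k < m) r k *: v k) < e].

Definition orth_proj (F : set E) x : E :=
  xget 0 [set y | closed_span F y /\
                  forall v : E, closed_span F v -> hdot (x - y) v = 0].

Definition hlim (u : nat -> E) : E :=
  xget 0 [set x | Hspace x /\ hnorm (u k - x) @[k --> \oo] --> (0 : R)].

Definition opP x : E := (x.1, fun=> 0).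

Definition RP : set E := opP @` Hspace.

Definition Phi : E := (fun=> 1, fun=> 0).

(* s is (a representative of) the solution of div (sigma grad s) = h with zero
   normal flux on GN, s and its flux being periodic. *)
Definition is_inv_div_h s : Prop :=
  Vspace s /\ is_weak_div W (flux s) (coef_h p) /\ flux_conditions s.

(* The sign is encoded as a boolean (true for +): eidx true k = k + 1 and
   eidx false k = - (k + 1). *)
Definition eidx (b : bool) (k : nat) : int := if b then Posz k.+1 else Negz k.

Section spectrum.
Context (lam : int -> R) (U : int -> plane R -> R).

Definition phi (i : int) : E := (U i, (lam i)^-1 *: U i).

Definition phis (b : bool) : set E := [set phi (eidx b k) | k in [set: nat]].

Definition Rpi b : set E := closed_span (phis b).

Definition pi_ b : E -> E := orth_proj (phis b).

Definition compressed b x : E := pi_ b (opP (pi_ b x)).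

Definition compressed_inv b y : E :=
  xget 0 [set x | Rpi b x /\ heq (compressed b x) y].

Definition compressed_invertible b : Prop :=
  exists C : R, forall y, Rpi b y -> exists2 x,
    Rpi b x /\ heq (compressed b x) y &
    hnorm x <= C * hnorm y /\
    forall x', Rpi b x' -> heq (compressed b x') y -> heq x' x.

Definition opB b x : E := pi_ b (compressed_inv b (pi_ b x)).

(* Established properties of the operator A and of its spectral decomposition;
   phi0 is (1, s0), with s0 the chosen solution of div (sigma grad s) = h. *)
Record spectral_facts (s0 : plane R -> R) : Prop := SpectralFacts {
  sf_complete : complete_Hspace;
  sf_self_adjoint : self_adjointA;
  sf_sign : forall k, lam (eidx false k) < 0 < lam (eidx true k);
  sf_monotone : forall k, lam (eidx true k) <= lam (eidx true k.+1) /\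
                          lam (eidx false k.+1) <= lam (eidx false k);
  sf_infinity : (lam (eidx true k) @[k --> \oo] --> +oo) /\
                (lam (eidx false k) @[k --> \oo] --> -oo);
  sf_eigen : forall i, i != 0 ->
    domA (phi i) /\ heq (opA (phi i)) (lam i *: phi i);
  sf_orthonormal : forall i j, i != 0 -> j != 0 ->
    hdot (phi i) (phi j) = (i == j)%:R;
  sf_kernel_balanced : balanced -> forall x, kerA x <->
    Hspace x /\ exists t : R, heq x (t *: ((fun=> 1, s0) : E));
  sf_kernel_unbalanced : ~ balanced -> forall x, kerA x -> heq x 0;
  sf_total : forall x, Hspace x ->
    closed_span ([set phi i | i in [set i | i != 0]] `|` kerA) x;
  sf_invertible : forall b, compressed_invertible b }.

Context (L : R).

(* exp (-2 L A) on Rpi true and exp (2 L A) on Rpi false. *)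
Definition expA b x : E :=
  hlim (fun m => \sum_(k < m)
    (expR ((if b then - 2 else 2) * L * lam (eidx b k)) *
     hdot x (phi (eidx b k))) *: phi (eidx b k)).

Definition opM b x : E := opP (expA b (opB b x)).

Definition u_ b : E := Phi - opP (opB b Phi).

Definition Tsol (s0 : plane R -> R) (psi : E) (c1 c2 z : R) : plane R -> R :=
  fun w =>
    L2sum W (fun k w' => hdot psi (phi (eidx false k)) *
      expR (lam (eidx false k) * (z + L)) * U (eidx false k) w') w +
    L2sum W (fun k w' => hdot psi (phi (eidx true k)) *
      expR (lam (eidx true k) * (z - L)) * U (eidx true k) w') w +
    c1 + c2 * (z + s0 w).

(* One-sided derivatives, at the end points of [- L, L], of Tsol seen as a
   function of z with values in L2. *)
Definition neumann_conditions s0 (Sm Sp : plane R -> R) psi c1 c2 : Prop :=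
  let Tz := Tsol s0 psi c1 c2 in
  (L2dist2 W (fun w => (Tz z w - Tz (- L) w) / (z + L)) Sm
     @[z --> (- L)^'+] --> 0%E) /\
  (L2dist2 W (fun w => (Tz z w - Tz L w) / (z - L)) Sp
     @[z --> L^'-] --> 0%E).

(* The unknowns P A pi_- psi and P A pi_+ psi. *)
Definition unknowns psi : E * E :=
  (opP (opA (pi_ false psi)), opP (opA (pi_ true psi))).

Definition inlet (S : plane R -> R) : E := (S, fun=> 0).

(* X |-> Z X and b for the three systems. *)
Definition Z_controlled (X : E * E) : E * E :=
  (X.1 + opM true X.2, opM false X.1 + X.2).

Definition b_controlled (Sm Sp : plane R -> R) : E * E := (inlet Sm, inlet Sp).

Definition Z_unbalanced (X : E * E) : E * E * R :=
  (X.1 + opM true X.2, opM false X.1 + X.2, hdot (opM true X.2) (u_ false)).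

Definition b_unbalanced (Sm Sp : plane R -> R) : E * E * R :=
  (inlet Sm, inlet Sp, hdot (inlet Sm) (u_ false)).

Definition Z_balanced (X : E * E * R) : E * E * R * R :=
  (X.1.1 + opM true X.1.2 + X.2 *: Phi,
   opM false X.1.1 + X.1.2 + X.2 *: Phi,
   hdot (opM true X.1.2) (u_ false) + X.2 * hdot Phi (u_ false),
   hdot (opM false X.1.1) (u_ true) + X.2 * hdot Phi (u_ true)).

Definition b_balanced (Sm Sp : plane R -> R) : E * E * R * R :=
  (inlet Sm, inlet Sp, hdot (inlet Sm) (u_ false), hdot (inlet Sp) (u_ true)).

End spectrum.

Definition heq2 (X Y : E * E) : Prop := heq X.1 Y.1 /\ heq X.2 Y.2.

End problem.

(* Componentwise equality, the first component being compared by eqA. *)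
Definition eq_and (A B : Type) (eqA : A -> A -> Prop) (X Y : A * B) : Prop :=
  eqA X.1 Y.1 /\ X.2 = Y.2.

(* f induces a bijection from D modulo eqA onto S modulo eqB. *)
Definition bijective_mod (A B : Type) (eqA : A -> A -> Prop)
    (eqB : B -> B -> Prop) (D : set A) (S : set B) (f : A -> B) : Prop :=
  [/\ forall x, D x -> S (f x),
      forall x y, D x -> D y -> (eqA x y <-> eqB (f x) (f y)) &
      forall X, S X -> exists2 x, D x & eqB (f x) X].

(* Main.v *)
(* For z in the range of pi_b one has B_b P z = z, and P z is orthogonal to
   u_b = Phi - P B_b Phi.  Differentiating the expansion of T term by term, the
   trace of dT/dz at the end point of sign b is
   P A pi_b psi + M_(-b) P A pi_(-b) psi + c2 Phi, so the Neumann conditions are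
   the first two equations; pairing these with u_- and u_+ gives the others.
   Conversely X in R(P) has to be written P z with z in the range of pi_b, that
   is Y = X - P B_b X has to vanish.  Y is orthogonal to the range of pi_b and
   (Y | Phi) = (X | u_b), which is 0 by the extra equations.  Solve A w = Y in
   the range of pi_(-b): since Y lies in R(P), the first component of w is a
   constant k, equal to 0 if the constants are controlled, hence
   (A w | w) = k (Y | Phi) = 0 and w = 0 because A is definite on that range.  If
   the constants are not controlled, Green's formula gives
   (A w | w) = k^2 int h, which has the wrong sign for b = + when int h > 0; that
   is why this case needs only one extra equation.
   The bilinearity of the scalar product rests on the uniqueness of weak
   derivatives and traces, and on the fact that the Hausdorff measure is a
   measure on Borel sets. *)
Require Import Defs.
From HB Require Import structures.
From mathcomp Require Import all_boot all_order all_algebra.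
From mathcomp Require Import all_classical all_reals all_analysis.
From mathcomp Require Import measurable_realfun.
From mathcomp Require Import ring lra.
Set Implicit Arguments.
Unset Strict Implicit.
Unset Printing Implicit Defensive.
Import Order.TTheory GRing.Theory Num.Theory.
Import numFieldNormedType.Exports.
Local Open Scope classical_set_scope.
Local Open Scope ring_scope.

(** * Hausdorff measure *)

(** Vectors are pairs of functions, not classes, and derivatives, traces, projections, sums and
    limits are picked by [xget]: nothing about them holds by computation, and [hdot] is only a
    semi-inner product. The Hilbert space argument is therefore carried out for an abstract seminorm
    and an abstract relation [heq], tied together without Poincaré's inequality. If x is [heq] to 0,
    self-adjointness makes x orthogonal to the dense domain, so its norm vanishes; conversely a
    vector of norm 0 is orthogonal to everything, hence lies in the kernel, and the known kernel
    contains no null vector other than 0 up to [heq]. The operator B_b is used only through its weak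
    form: B_b x is the z in the range of pi_b such that P z and x have the same pairings with that
    range. Taking x = P z gives B_b P z = z, and the symmetry of this condition gives (P B_b X |
    Phi) = (X | P B_b Phi), hence (Y | Phi) = (X | u_b). Solving A w = Y in the opposite range also
    needs Y orthogonal to the kernel. In the balanced case the kernel is spanned by phi_0, whose
    first component is 1, so this is again (Y | Phi) = 0. *)

Section ereal_sup.
Local Open Scope ereal_scope.

(** For finite c the elements of [T] are finite and can be moved to the right, so the suprema are
    taken one variable at a time. It serves to add two Hausdorff measures, each a supremum over
    scales. *)
Lemma ereal_supD_le {R : realType} (S T : set (\bar R)) (c : \bar R) :
  S !=set0 -> T !=set0 ->
  (forall x, S x -> 0 <= x) -> (forall y, T y -> 0 <= y) ->
  (forall x y, S x -> T y -> x + y <= c) -> ereal_sup S + ereal_sup T <= c.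
Proof.
move=> [x0 Sx0] [y0 Ty0] S0 T0 STc.
have c0 : 0 <= c.
  by apply: (le_trans _ (STc _ _ Sx0 Ty0)); apply: adde_ge0; [exact: S0|exact: T0].
case: c => [c| |] in STc c0 *; last by [].
- have Tfin y : T y -> y \is a fin_num.
    move=> Ty; rewrite ge0_fin_numE ?T0//.
    by rewrite (@le_lt_trans _ _ c%:E) ?ltry// (le_trans _ (STc _ _ Sx0 Ty))// leeDr// S0.
  have Sy y : T y -> ereal_sup S <= c%:E - y.
    by move=> Ty; apply: ge_ereal_sup => x Sx; rewrite leeBrDr ?Tfin// STc.
  have Sfin : ereal_sup S \is a fin_num.
    rewrite ge0_fin_numE; last first.
      by rewrite (le_trans (S0 _ Sx0))// ereal_sup_ubound.
    apply: le_lt_trans (Sy _ Ty0) _.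
    by rewrite -(fineK (Tfin _ Ty0)) -EFinB ltry.
  rewrite addeC -leeBrDr//; apply: ge_ereal_sup => y Ty.
  by rewrite leeBrDr// addeC -leeBrDr ?Tfin// Sy.
- by rewrite leey.
Qed.

End ereal_sup.

Lemma measurable_raysE (R : realType) : @measurable _ (measurableTypeR R) =
  <<s [set A | exists x, A = `]x, +oo[%classic] >>.
Proof. exact: measurable_realfun.RGenOInfty.measurableE. Qed.

Section hausdorff.
Context {R : realType}.
Implicit Types (A B X : set (plane R)) (x y : plane R).
Local Open Scope ereal_scope.

Lemma diam2_ge0 A : 0 <= diam2 A.
Proof. by apply: ereal_sup_ubound; left. Qed.

Lemma diam2_set0 : diam2 (set0 : set (plane R)) = 0.
Proof.
apply/eqP; rewrite eq_le diam2_ge0 andbT.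
by apply: ge_ereal_sup => _ [->//|[x []]].
Qed.

Lemma dist2_le_diam2 A x y : A x -> A y -> (dist2 x y)%:E <= diam2 A.
Proof. by move=> Ax Ay; apply: ereal_sup_ubound; right; exists x => //; exists y. Qed.

(** The bound on diameters is moved into the set function: a cover with a large piece costs +oo and
    does not affect the infimum. The theory of [mu_ext] then applies at each scale d. *)
Definition small_diam2 (d : R) A : \bar R :=
  if diam2 A <= d%:E then diam2 A else +oo.

Lemma small_diam2_ge0 d A : 0 <= small_diam2 d A.
Proof. by rewrite /small_diam2; case: ifP => // _; exact: diam2_ge0. Qed.

Lemma small_diam2_set0 d : (0 <= d)%R -> small_diam2 d set0 = 0.
Proof. by move=> d0; rewrite /small_diam2 diam2_set0 lee_fin d0. Qed.

(* The sigma-algebra of all subsets makes the construction of an outer measure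
   from measurable covers one from arbitrary covers. *)
Lemma hausdorff1_deltaE d A : hausdorff1_delta d A =
  @mu_ext _ (g_sigma_algebraType [set: set (plane R)]) R (small_diam2 d) A.
Proof.
apply/eqP; rewrite eq_le; apply/andP; split.
  apply: le_ereal_inf_tmp => _ [F [mF AF] <-].
  have [[k kd]|Fd] := pselect (exists k, d%:E < diam2 (F k)).
    rewrite (@eseries_pinfty _ _ xpredT k) ?leey//.
      by move=> n _; rewrite -ltNye (lt_le_trans _ (small_diam2_ge0 d (F n))).
    by rewrite /small_diam2 leNgt kd.
  apply: ereal_inf_lbound; exists F.
    split=> // k; rewrite leNgt; apply/negP => kd; apply: Fd; exists k; exact: kd.
  apply: eq_eseriesr => k _; rewrite /small_diam2 ifT// leNgt.
  by apply/negP => kd; apply: Fd; exists k.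
apply: le_ereal_inf_tmp => _ [F [AF Fd] <-].
apply: ereal_inf_lbound; exists F.
  by split=> // k; apply: sub_sigma_algebra.
by apply: eq_eseriesr => k _; rewrite /small_diam2 Fd.
Qed.

Lemma le_hausdorff1_delta d1 d2 A : (d1 <= d2)%R ->
  hausdorff1_delta d2 A <= hausdorff1_delta d1 A.
Proof.
move=> d12; apply: ereal_inf_le_tmp => _ [F [AF Fd] <-]; exists F => //.
by split=> // k; rewrite (le_trans (Fd k))// lee_fin.
Qed.

Lemma hausdorff1_delta_le d A : (0 < d)%R -> hausdorff1_delta d A <= hausdorff1 A.
Proof. by move=> d0; apply: ereal_sup_ubound; exists d. Qed.

Lemma hausdorff1_delta_ge0 d A : 0 <= hausdorff1_delta d A.
Proof.
by rewrite hausdorff1_deltaE; apply: mu_ext_ge0 => X; exact: small_diam2_ge0.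
Qed.

Lemma hausdorff1_ge0 A : 0 <= hausdorff1 A.
Proof.
by apply: (le_trans (hausdorff1_delta_ge0 1 A)); exact: hausdorff1_delta_le.
Qed.

Lemma hausdorff1_set0 : hausdorff1 (set0 : set (plane R)) = 0.
Proof.
apply/eqP; rewrite eq_le hausdorff1_ge0 andbT.
apply: ge_ereal_sup => _ [d d0 <-].
rewrite hausdorff1_deltaE mu_ext0//; first exact/small_diam2_set0/ltW.
by move=> X; exact: small_diam2_ge0.
Qed.

Lemma hausdorff1_sigma_subadditive : sigma_subadditive (@hausdorff1 R).
Proof.
move=> F; apply: ge_ereal_sup => _ [d d0 <-].
rewrite hausdorff1_deltaE.
have d00 : small_diam2 d set0 = 0 by exact/small_diam2_set0/ltW.
have /le_trans := @mu_ext_sigma_subadditive _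
  (g_sigma_algebraType [set: set (plane R)]) R _ (@small_diam2_ge0 d) F.
apply.
apply: lee_nneseries => k; rewrite -hausdorff1_deltaE.
  by move=> *; exact: hausdorff1_delta_ge0.
by move=> _; exact: hausdorff1_delta_le.
Qed.

Lemma le_hausdorff1 : {homo @hausdorff1 R : A B / A `<=` B >-> A <= B}.
Proof.
move=> A B AB; apply: ge_ereal_sup => _ [d d0 <-].
apply: le_trans (hausdorff1_delta_le B d0).
by rewrite !hausdorff1_deltaE; exact: le_mu_ext.
Qed.

HB.instance Definition _ := isOuterMeasure.Build R (plane R) (@hausdorff1 R)
  hausdorff1_set0 hausdorff1_ge0 le_hausdorff1 hausdorff1_sigma_subadditive.

(** At scales at most e / 2 no set of a cover meets both A and B. The pieces meeting A and those
    meeting B therefore form disjoint subfamilies, covering A and B at no more than the cost of the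
    whole cover. *)
Lemma hausdorff1_separated (e : R) A B : (0 < e)%R ->
  (forall x y, A x -> B y -> (e <= dist2 x y)%R) ->
  hausdorff1 A + hausdorff1 B <= hausdorff1 (A `|` B).
Proof.
move=> e0 ABe; apply: ereal_supD_le.
- by exists (hausdorff1_delta 1 A), 1%R => //=; exact: ltr01.
- by exists (hausdorff1_delta 1 B), 1%R => //=; exact: ltr01.
- by move=> _ [d _ <-]; exact: hausdorff1_delta_ge0.
- by move=> _ [d _ <-]; exact: hausdorff1_delta_ge0.
move=> _ _ [d1 /= d10 <-] [d2 /= d20 <-].
pose d := Num.min (Num.min d1 d2) (e / 2)%R.
have d0 : (0 < d)%R by rewrite !lt_min d10 d20 divr_gt0.
apply: le_trans (hausdorff1_delta_le _ d0).
have dd1 : (d <= d1)%R by rewrite /d !ge_min lexx.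
have dd2 : (d <= d2)%R by rewrite /d !ge_min lexx orbT.
apply: le_trans (leeD (le_hausdorff1_delta A dd1) (le_hausdorff1_delta B dd2)) _.
apply: le_ereal_inf_tmp => _ [F [ABF Fd] <-].
pose FA k := if `[< F k `&` A !=set0 >] then F k else set0.
pose FB k := if `[< F k `&` B !=set0 >] then F k else set0.
have dFA k : diam2 (FA k) <= d%:E.
  by rewrite /FA; case: ifP => _; [exact: Fd|rewrite diam2_set0 lee_fin ltW].
have dFB k : diam2 (FB k) <= d%:E.
  by rewrite /FB; case: ifP => _; [exact: Fd|rewrite diam2_set0 lee_fin ltW].
apply: (@le_trans _ _ (\sum_(0 <= k <oo) diam2 (FA k) +
                       \sum_(0 <= k <oo) diam2 (FB k))).
  apply: leeD; apply: ereal_inf_lbound.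
    exists FA => //; split=> // x Ax; have [k _ Fkx] := ABF x (or_introl Ax).
    by exists k => //; rewrite /FA ifT//; apply/asboolP; exists x.
  exists FB => //; split=> // x Bx; have [k _ Fkx] := ABF x (or_intror Bx).
  by exists k => //; rewrite /FB ifT//; apply/asboolP; exists x.
rewrite -nneseriesD; last 2 first.
- by move=> *; exact: diam2_ge0.
- by move=> *; exact: diam2_ge0.
apply: lee_nneseries => [k _ _|k _]; first by rewrite adde_ge0// diam2_ge0.
rewrite /FA /FB; case: asboolP => [[x [Fx Ax]]|_]; last first.
  by rewrite diam2_set0 add0e; case: ifP => _; rewrite ?diam2_set0// diam2_ge0.
case: asboolP => [[y [Fy By]]|_]; last by rewrite diam2_set0 adde0.
exfalso; have := le_trans (dist2_le_diam2 Fx Fy) (Fd k).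
rewrite lee_fin => /(le_trans (ABe _ _ Ax By)).
rewrite /d !le_min => /andP[_]; rewrite leNgt => /negP; apply.
by rewrite ltr_pdivrMr// mulr_natr mulr2n ltrDl.
Qed.

(* Carathéodory's criterion for a half space {a < f}: the strips between
   consecutive levels a + 1/n at distance two are separated, so their measures
   are summable and the part of X close to the boundary is negligible. *)
Lemma caratheodory_halfspace (f : plane R -> R) (a : R) :
  (forall x y, (f x - f y <= dist2 x y)%R) ->
  (@hausdorff1 R).-caratheodory [set x | (a < f x)%R].
Proof.
move=> fd; apply: le_caratheodory_measurable => X.
have [Xoo|] := eqVneq (hausdorff1 X) +oo.
  by rewrite -[leRHS]/(hausdorff1 X) Xoo leey.
rewrite -ltey => Xoo.
set S := [set x | _].
pose l (n : nat) : R := (a + n.+1%:R^-1)%R.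
have lS m n : (m < n)%N -> (l n < l m)%R.
  by move=> mn; rewrite ltrD2l ltf_pV2 ?posrE// ltr_nat.
pose A n := X `&` [set x | (l n <= f x)%R].
pose Q n := X `&` [set x | (l n.+1 <= f x < l n)%R].
have sepS n B : B `<=` X `&` [set x | (f x <= a)%R] ->
    hausdorff1 (A n) + hausdorff1 B <= hausdorff1 (A n `|` B).
  move=> BX; apply: (@hausdorff1_separated n.+1%:R^-1).
    by rewrite invr_gt0.
  move=> x y [_ /= xl] /BX [_ /= ya]; apply: le_trans (fd _ _).
  by rewrite lerBrDr (le_trans _ xl)// /l addrC lerD2r.
(* The gap in g leaves a whole strip between consecutive chosen ones, so they are separated and
   finite additivity holds. It is applied below to the even and to the odd indices. *)
have sumQ (g : nat -> nat) : (forall n, (g n).+1 < g n.+1)%N ->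
    \sum_(k <oo) hausdorff1 (Q (g k)) <= hausdorff1 X.
  move=> gS; apply: lime_le.
    by apply: is_cvg_nneseries => k _ _; exact: hausdorff1_ge0.
  have gm m n : (m < n)%N -> ((g m).+1 < g n)%N.
    elim: n => // n IH; rewrite ltnS leq_eqVlt => /predU1P[->//|/IH mn].
    by rewrite (ltn_trans mn)// (ltn_trans _ (gS n)).
  apply: nearW => n; rewrite big_mkord.
  apply: (@le_trans _ _ (hausdorff1 (\big[setU/set0]_(i < n) Q (g i)))).
    elim: n => [|n IH]; first by rewrite !big_ord0 hausdorff1_ge0.
    rewrite !big_ord_recr/=; apply: le_trans (leeD2r _ IH) _.
    case: n => [|n] in IH *.
      by rewrite !big_ord0 hausdorff1_set0 add0e set0U.
    apply: (@hausdorff1_separated (l (g n).+1 - l (g n.+1))%R).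
      by rewrite subr_gt0 lS// gS.
    move=> x y; rewrite -(bigcup_mkord _ (fun i => Q (g i))) => -[k /= kn [_ /= /andP[xl _]]].
    move=> [_ /= /andP[_ yl]]; apply: le_trans (fd _ _); apply: lerB; last exact: ltW.
    apply: le_trans xl; move: kn; rewrite ltnS leq_eqVlt => /predU1P[->//|kn].
    by rewrite ltW// lS// ltnS (ltn_trans _ (gm _ _ kn)).
  apply: le_outer_measure => x; rewrite -(bigcup_mkord _ (fun i => Q (g i))) => -[k _ [Xx _]]; exact: Xx.
have sumoo : \sum_(k <oo) hausdorff1 (Q k) < +oo.
  have Q0 n : 0 <= hausdorff1 (Q n) by exact: hausdorff1_ge0.
  apply: (@le_lt_trans _ _ (hausdorff1 X + hausdorff1 X)); last first.
    by rewrite lte_add_pinfty.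
  apply: (@le_trans _ _ (\sum_(k <oo) hausdorff1 (Q k.*2) +
                         \sum_(k <oo) hausdorff1 (Q k.*2.+1))).
    rewrite -nneseriesD//; apply: lime_le.
      by apply: is_cvg_nneseries.
    apply: nearW => n; apply: (@le_trans _ _ (\sum_(0 <= k < n.*2) hausdorff1 (Q k))).
      rewrite (@big_cat_nat _ _ _ n 0%N n.*2)//=; last by rewrite -addnn leq_addr.
      by rewrite leeDl// sume_ge0.
    apply: (@le_trans _ _ (\sum_(0 <= k < n) (hausdorff1 (Q k.*2) + hausdorff1 (Q k.*2.+1)))).
      elim: n => [|n IH]; first by rewrite !big_nil.
      by rewrite doubleS !big_nat_recr//= -addeA leeD2r.
    by apply: nneseries_lim_ge => k _ _; rewrite adde_ge0.
  by apply: leeD; apply: sumQ => n; rewrite doubleS.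
have tail : \sum_(N <= k <oo) hausdorff1 (Q k) @[N --> \oo] --> 0.
  by apply: nneseries_tail_cvg => // k _; exact: hausdorff1_ge0.
have XA N : hausdorff1 (X `&` S) + hausdorff1 (X `&` ~` S) <=
    hausdorff1 X + \sum_(N <= k <oo) hausdorff1 (Q k).
  have XS : X `&` S `<=` A N `|` \bigcup_(k in ~` `I_N) Q k.
    move=> x [Xx /= ax]; have [xN|xN] := leP (l N) (f x); first by left.
    right; have [n /= Hn] : exists n, (l n <= f x)%R.
      have fxa : (0 < f x - a)%R by rewrite subr_gt0.
      have [n _ /(_ n (leqnn n)) /= nfx] := near_infty_natSinv_lt (PosNum fxa).
      by exists n; rewrite /l -lerBrDl ltW.
    have exl : exists n, (l n <= f x)%R by exists n.
    (* The least m with l m <= f x puts x in the strip [Q m.-1]; m is positive, in fact N < m,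
       because f x < l N. *)
    have := ex_minnP exl => -[m ml mmin].
    have Nm : (N < m)%N.
      rewrite ltnNge; apply/negP => mN; move: xN; rewrite ltNge => /negP; apply.
      apply: le_trans ml; move: mN; rewrite leq_eqVlt => /predU1P[->//|/lS]; exact: ltW.
    have mS : m.-1.+1 = m by rewrite prednK// (leq_trans _ Nm).
    exists m.-1; first by apply/negP; rewrite -leqNgt -ltnS mS.
    split => //=; rewrite mS ml/= ltNge; apply/negP => /mmin.
    by rewrite leqNgt ltn_predL (leq_trans _ Nm).
  have := le_outer_measure (@hausdorff1 R) _ _ XS.
  move=> /le_trans /(_ (outer_measureU2 _ _ _)) H.
  apply: le_trans (leeD2r _ H) _.
  rewrite addeAC; apply: leeD; last exact: outer_measure_sigma_subadditive_tail.
  apply: le_trans (sepS N _ _) _.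
    by move=> x [Xx /= /negP]; rewrite -leNgt.
  by apply: le_outer_measure => x [[]|[]].
have cX : (hausdorff1 X + \sum_(N <= k <oo) hausdorff1 (Q k))
    @[N --> \oo] --> hausdorff1 X + 0.
  apply: cvgeD tail; last exact: cvg_cst.
  by apply: ge0_adde_def; rewrite inE//; exact: hausdorff1_ge0.
rewrite adde0 in cX.
by apply: (cvge_ge _ cX); exact: nearW.
Qed.

(** Both coordinates are 1-Lipschitz for [dist2], so the half spaces they define satisfy the
    criterion, and these half spaces generate the product sigma-algebra. *)
Lemma hausdorff1_caratheodory A : measurable A -> (@hausdorff1 R).-caratheodory A.
Proof.
have half (f : plane R -> measurableTypeR R) : (forall x y, (f x - f y <= dist2 x y)%R) ->
    forall C, measurable C -> (@hausdorff1 R).-caratheodory (f @^-1` C).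
  move=> fd C; rewrite measurable_raysE.
  apply: (@smallest_sub _ _ _ [set C | (@hausdorff1 R).-caratheodory (f @^-1` C)]).
    split => /=.
    - by rewrite preimage_set0; exact: caratheodory_measurable_set0.
    - move=> D mD; rewrite setTD preimage_setC.
      exact: caratheodory_measurable_setC.
    - move=> D mD; rewrite preimage_bigcup.
      exact: caratheodory_measurable_bigcup.
  move=> _ [x ->] /=.
  rewrite [X in caratheodory_measurable _ X](_ : _ = [set z | (x < f z)%R]); last first.
    by apply/seteqP; split => z /=; rewrite in_itv/= andbT.
  exact: caratheodory_halfspace.
apply: (@smallest_sub _ _ _ (@hausdorff1 R).-caratheodory).
  split; first exact: caratheodory_measurable_set0.
  - by move=> C mC; rewrite setTD; exact: caratheodory_measurable_setC.
  - by move=> C mC; exact: caratheodory_measurable_bigcup.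
have le_sqrt (u v : R) : (u <= Num.sqrt (u ^+ 2 + v ^+ 2))%R.
  apply: (le_trans (ler_norm _)); rewrite -sqrtr_sqr ler_wsqrtr// lerDl sqr_ge0//.
move=> C [|] [D mD <-]; rewrite setTI; apply: half => // x y.
- exact: le_sqrt.
- by rewrite /dist2 [X in Num.sqrt X]addrC; exact: le_sqrt.
Qed.

Lemma hausdorff1_semi_sigma_additive : semi_sigma_additive (@hausdorff1 R).
Proof.
move=> F mF tF mUF.
exact: (@caratheodory_measure_sigma_additive _ _ (@hausdorff1 R) F
  (fun i => hausdorff1_caratheodory (mF i)) tF (hausdorff1_caratheodory mUF)).
Qed.

HB.instance Definition _ := isMeasure.Build _ (plane R) R (@hausdorff1 R)
  hausdorff1_set0 hausdorff1_ge0 hausdorff1_semi_sigma_additive.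

End hausdorff.

(** * Square integrable functions *)

Section square_integrable.
Context {R : realType}.
Variable mu : {measure set (plane R) -> \bar R}.
Variable D : set (plane R).
Hypothesis mD : measurable D.
Implicit Types f g k : plane R -> R.

Lemma L2_measurable f : L2 mu D f -> measurable_fun D f.
Proof. by case. Qed.

Lemma L2_sqr_integrable f : L2 mu D f -> mu.-integrable D (EFin \o (fun x => f x ^+ 2)).
Proof.
move=> [mf foo]; apply/integrableP; split.
  exact/measurable_EFinP/measurable_funX.
rewrite (le_lt_trans _ foo)// le_eqVlt; apply/orP; left; apply/eqP.
by apply: eq_integral => x _ /=; rewrite ger0_norm ?sqr_ge0.
Qed.

Lemma integrable_dominated f g : measurable_fun D f ->
  mu.-integrable D (EFin \o g) -> {ae mu, forall x, D x -> `|f x| <= g x} ->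
  mu.-integrable D (EFin \o f).
Proof.
move=> mf /integrableP[mg goo] fg; apply/integrableP; split.
  exact/measurable_EFinP.
apply: le_lt_trans goo; apply: ae_ge0_le_integral => //=.
- exact/measurable_EFinP/measurableT_comp.
- by apply/measurable_EFinP/measurableT_comp => //; exact/measurable_EFinP.
by apply: filterS fg => x /= fg Dx; rewrite lee_fin; exact: le_trans (fg Dx) (ler_norm _).
Qed.

Lemma L2_dominated f g (M : R) : measurable_fun D f -> L2 mu D g ->
  {ae mu, forall x, D x -> `|f x| <= M * `|g x|} -> L2 mu D f.
Proof.
move=> mf gL2 fg; split => //.
have gi := L2_sqr_integrable gL2.
have Mgi : mu.-integrable D (EFin \o (fun x => M ^+ 2 * g x ^+ 2)).
  by have := integrableZl mD (M ^+ 2) gi; apply: eq_integrable.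
have : mu.-integrable D (EFin \o (fun x => f x ^+ 2)).
  apply: (@integrable_dominated _ _ _ Mgi).
    exact: measurable_funX.
  apply: filterS fg => x fg Dx; rewrite ger0_norm ?sqr_ge0//.
  rewrite -[f x ^+ 2]real_normK ?num_real// -[g x ^+ 2]real_normK ?num_real//.
  by rewrite -exprMn lerXn2r ?nnegrE ?normr_ge0// (le_trans _ (fg Dx)).
move=> /integrableP[_]; apply: le_lt_trans.
rewrite le_eqVlt; apply/orP; left; apply/eqP.
by apply: eq_integral => x _ /=; rewrite ger0_norm ?sqr_ge0.
Qed.

Lemma L2M_integrable f g : L2 mu D f -> L2 mu D g ->
  mu.-integrable D (EFin \o (fun x => f x * g x)).
Proof.
move=> fL2 gL2.
have fgi : mu.-integrable D (EFin \o (fun x => f x ^+ 2 + g x ^+ 2)).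
  have := integrableD mD (L2_sqr_integrable fL2) (L2_sqr_integrable gL2).
  by apply: eq_integrable.
apply: (@integrable_dominated _ _ _ fgi).
  by apply: measurable_funM; exact: L2_measurable.
apply: aeW => x _; rewrite normrM.
rewrite -[f x ^+ 2]real_normK ?num_real// -[g x ^+ 2]real_normK ?num_real//.
have := sqr_ge0 (`|f x| - `|g x|); have := normr_ge0 (f x); have := normr_ge0 (g x).
nra.
Qed.

Lemma L2D f g : L2 mu D f -> L2 mu D g -> L2 mu D (fun x => f x + g x).
Proof.
move=> fL2 gL2; split.
  by apply: measurable_funD; exact: L2_measurable.
have : mu.-integrable D (EFin \o (fun x => f x ^+ 2 + f x * g x + (f x * g x + g x ^+ 2))).
  have i1 := integrableD mD (L2_sqr_integrable fL2) (L2M_integrable fL2 gL2).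
  have i2 := integrableD mD (L2M_integrable fL2 gL2) (L2_sqr_integrable gL2).
  by apply: eq_integrable (integrableD mD i1 i2).
move=> /integrableP[_]; apply: le_lt_trans.
rewrite le_eqVlt; apply/orP; left; apply/eqP.
apply: eq_integral => x _ /=.
rewrite [in RHS](_ : _ + _ = (f x + g x) ^+ 2); last by ring.
by rewrite ger0_norm ?sqr_ge0.
Qed.

Lemma L2Z (r : R) f : L2 mu D f -> L2 mu D (fun x => r * f x).
Proof.
move=> fL2; apply: (@L2_dominated _ f `|r|) => //.
  by apply: measurable_funM => //; exact: L2_measurable.
by apply: aeW => x _; rewrite normrM.
Qed.

Lemma L2B f g : L2 mu D f -> L2 mu D g -> L2 mu D (fun x => f x - g x).
Proof.
move=> fL2 gL2; rewrite (_ : (fun x => _) = (fun x => f x + (-1) * g x)).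
  by apply: L2D => //; exact: L2Z.
by apply/funext => x; rewrite mulN1r.
Qed.

Lemma L2_cst0 : L2 mu D (fun=> 0).
Proof.
split; first exact: measurable_cst.
by rewrite integral0_eq// => x _; rewrite expr0n.
Qed.

Lemma L2_bounded_mul k f (M : R) : measurable_fun D k ->
  {ae mu, forall x, D x -> `|k x| <= M} ->
  L2 mu D f -> L2 mu D (fun x => k x * f x).
Proof.
move=> mk kM fL2; apply: (@L2_dominated _ f M) => //.
  by apply: measurable_funM => //; exact: L2_measurable.
by apply: filterS kM => x kM Dx; rewrite normrM ler_wpM2r// kM.
Qed.

Lemma Rintegral_ae_eq f g : measurable_fun D f -> measurable_fun D g ->
  {ae mu, forall x, D x -> f x = g x} ->
  \int[mu]_(x in D) f x = \int[mu]_(x in D) g x.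
Proof.
move=> mf mg fg; rewrite /Rintegral; congr fine; apply: ae_eq_integral => //.
- exact/measurable_EFinP.
- exact/measurable_EFinP.
- by apply: filterS fg => x fg Dx; rewrite fg.
Qed.

Lemma Rintegral_ge0_ae f : measurable_fun D f ->
  {ae mu, forall x, D x -> 0 <= f x} -> 0 <= \int[mu]_(x in D) f x.
Proof.
move=> mf f0; rewrite (@Rintegral_ae_eq _ (fun x => `|f x|)).
- by apply: Rintegral_ge0 => x _; exact: normr_ge0.
- by [].
- exact: measurableT_comp.
- by apply: filterS f0 => x f0 Dx; rewrite ger0_norm// f0.
Qed.

Lemma le_Rintegral_ae f g : mu.-integrable D (EFin \o f) ->
  mu.-integrable D (EFin \o g) ->
  {ae mu, forall x, D x -> f x <= g x} ->
  \int[mu]_(x in D) f x <= \int[mu]_(x in D) g x.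
Proof.
move=> fi gi fg; rewrite -subr_ge0 -RintegralB//; apply: Rintegral_ge0_ae.
  apply: measurable_funB; apply/measurable_EFinP.
    exact: (measurable_int mu gi).
  exact: (measurable_int mu fi).
by apply: filterS fg => x fg Dx; rewrite subr_ge0 fg.
Qed.

Lemma Rintegral_sqr_eq0 f : L2 mu D f -> \int[mu]_(x in D) (f x ^+ 2) = 0 ->
  {ae mu, forall x, D x -> f x = 0}.
Proof.
move=> fL2 f0; have fi := L2_sqr_integrable fL2.
have : (\int[mu]_(x in D) `|(f x ^+ 2)%:E| = 0)%E.
  rewrite -[RHS](_ : (\int[mu]_(x in D) (f x ^+ 2)%:E = 0)%E); last first.
    by rewrite -(fineK (integrable_fin_num mD fi)); congr EFin; exact: f0.
  by apply: eq_integral => x _ /=; rewrite ger0_norm ?sqr_ge0.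
move/(ae_eq_integral_abs mu mD (measurable_int mu fi)).
apply: filterS => x /= fx Dx; have /(_ Dx) [] := fx => /eqP.
by rewrite sqrf_eq0 => /eqP.
Qed.

Lemma L2_cst (r : R) : (mu D < +oo)%E -> L2 mu D (fun=> r).
Proof.
move=> Doo; split; first exact: measurable_cst.
by rewrite integral_cst// lte_mul_pinfty// lee_fin sqr_ge0.
Qed.

Lemma L2_integrable f : (mu D < +oo)%E -> L2 mu D f -> mu.-integrable D (EFin \o f).
Proof.
move=> Doo fL2; have := L2M_integrable fL2 (L2_cst 1 Doo).
by apply: eq_integrable => // x _ /=; rewrite mulr1.
Qed.

Lemma RintegralM_C f g :
  \int[mu]_(x in D) (f x * g x) = \int[mu]_(x in D) (g x * f x).
Proof. by apply: eq_Rintegral => x _; rewrite mulrC. Qed.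

Lemma RintegralM_sqr_ge0 f : 0 <= \int[mu]_(x in D) (f x * f x).
Proof. by apply: Rintegral_ge0 => x _; rewrite -expr2 sqr_ge0. Qed.

(** The relation between h, f and f' is only required almost everywhere, since traces, to which this
    is applied, are linear only up to null sets. *)
Lemma RintegralM_lin f f' g h (a : R) : L2 mu D f -> L2 mu D f' -> L2 mu D g ->
  L2 mu D h -> {ae mu, forall x, D x -> h x = f x + a * f' x} ->
  \int[mu]_(x in D) (h x * g x) =
  \int[mu]_(x in D) (f x * g x) + a * \int[mu]_(x in D) (f' x * g x).
Proof.
move=> fL2 fL2' gL2 hL2 hE.
have i1 := L2M_integrable fL2 gL2; have i2 := L2M_integrable fL2' gL2.
have i2' := L2M_integrable (L2Z a fL2') gL2.
rewrite -(RintegralZl a mD i2).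
under [X in _ = _ + X]eq_Rintegral do rewrite mulrA.
rewrite -(RintegralD mD i1 i2'); apply: Rintegral_ae_eq.
- by apply: measurable_funM; exact: L2_measurable.
- by apply: measurable_funD; apply: measurable_funM;
    (apply: L2_measurable || idtac); first [exact: fL2|exact: gL2|exact: (L2Z a fL2')].
by apply: filterS hE => x hE Dx; rewrite hE// mulrDl.
Qed.

End square_integrable.

Lemma L2_sub {R : realType} (mu : {measure set (plane R) -> \bar R}) D E f :
  measurable D -> measurable E -> E `<=` D -> L2 mu D f -> L2 mu E f.
Proof.
move=> mD mE ED [mf foo]; split; first exact: measurable_funS mf.
apply: le_lt_trans foo; apply: ge0_subset_integral => //.
- exact/measurable_EFinP/measurable_funX.
- by move=> x _; rewrite lee_fin sqr_ge0.
Qed.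

(** * Rectangles, open sets and bounded sets of the plane *)

Section plane_topology.
Context {R : realType}.
Implicit Types (W : set (plane R)) (f : plane R -> R).

Definition orect (a b c d : R) : set (plane R) := `]a, b[ `*` `]c, d[.
Definition crect (a b c d : R) : set (plane R) := `[a, b] `*` `[c, d].

Lemma measurable_orect a b c d : measurable (orect a b c d).
Proof. by apply: measurableX; exact: measurable_itv. Qed.

Lemma measurable_crect a b c d : measurable (crect a b c d).
Proof. by apply: measurableX; exact: measurable_itv. Qed.

Lemma orect_sub_crect a b c d : orect a b c d `<=` crect a b c d.
Proof. by move=> x [/= h1 h2]; split => /=; exact: subset_itv_oo_cc. Qed.

Lemma leb2_setX (A B : set (measurableTypeR R)) : measurable A -> measurable B ->
  leb2 (A `*` B) = (lebesgue_measure A * lebesgue_measure B)%E.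
Proof. exact: product_measure1E. Qed.

Lemma leb2_crect a b c d : (leb2 (crect a b c d) < +oo)%E.
Proof.
rewrite leb2_setX//; try exact: measurable_itv.
by rewrite !lebesgue_measure_itv/=; do 2 case: ifP => _;
  rewrite ?mule0 ?mul0e// -!EFinB -EFinM ltry.
Qed.

Lemma leb2_orect_gt0 a b c d : a < b -> c < d -> (0 < leb2 (orect a b c d))%E.
Proof.
move=> ab cd; rewrite leb2_setX//; try exact: measurable_itv.
rewrite !lebesgue_measure_itv/= !lte_fin ab cd -!EFinB -EFinM lte_fin.
by rewrite mulr_gt0// subr_gt0.
Qed.

(** Balls of the max norm are squares, so rectangles with rational sides suffice. The closed
    rectangles are kept inside W because they will be the supports of test functions. *)
Lemma open_rect_cover W : open W -> exists q : nat -> R * R * R * R,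
  (forall n, crect (q n).1.1.1 (q n).1.1.2 (q n).1.2 (q n).2 `<=` W) /\
  W = \bigcup_n orect (q n).1.1.1 (q n).1.1.2 (q n).1.2 (q n).2.
Proof.
move=> oW.
pose Q (q : rat * rat * rat * rat) : R * R * R * R :=
  (ratr q.1.1.1, ratr q.1.1.2, ratr q.1.2, ratr q.2).
pose good (q : R * R * R * R) := crect q.1.1.1 q.1.1.2 q.1.2 q.2 `<=` W.
(* Indices that code no rectangle inside W get (1, 0, 1, 0), for which both the open and the closed
   rectangle are empty. *)
pose q n := if unpickle n is Some q then
  (if `[< good (Q q) >] then Q q else (1, 0, 1, 0)) else (1, 0, 1, 0).
have empty : crect 1 0 1 0 = set0 :> set (plane R).
  rewrite -subset0 => x [/=]; rewrite in_itv/= => /andP[h1 h2] _.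
  by have := le_trans h1 h2; rewrite ler10.
have qW n : crect (q n).1.1.1 (q n).1.1.2 (q n).1.2 (q n).2 `<=` W.
  rewrite /q; case: unpickle => [r|/=]; last by rewrite empty.
  by case: asboolP => //= _; rewrite empty.
exists q; split => //; apply/seteqP; split; last first.
  by move=> x [n _] /orect_sub_crect; exact: qW.
move=> x Wx; have /nbhs_ballP[e /= e0 xeW] : nbhs x W by exact: open_nbhs_nbhs.
have [|a] := @rat_in_itvoo R (x.1 - e) x.1; first by rewrite ltrBlDr ltrDl.
have [|b] := @rat_in_itvoo R x.1 (x.1 + e); first by rewrite ltrDl.
have [|c] := @rat_in_itvoo R (x.2 - e) x.2; first by rewrite ltrBlDr ltrDl.
have [|d] := @rat_in_itvoo R x.2 (x.2 + e); first by rewrite ltrDl.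
rewrite !in_itv/= => /andP[d1 d2] /andP[c1 c2] /andP[b1 b2] /andP[a1 a2].
exists (pickle (a, b, c, d)) => //; rewrite /q pickleK ifT.
  by split => /=; rewrite in_itv/= ?a2 ?c2.
apply/asboolP => y [/=]; rewrite !in_itv/= => /andP[y1 y2] /andP[y3 y4].
apply: xeW; split; rewrite /ball/= ltr_norml; apply/andP; split; lra.
Qed.

Lemma open_measurable_plane W : open W -> measurable W.
Proof.
move=> /open_rect_cover[q [_ ->]].
by apply: bigcup_measurable => n _; exact: measurable_orect.
Qed.

Lemma closed_measurable_plane W : closed W -> measurable W.
Proof.
by move=> cW; rewrite -(setCK W); apply: measurableC; apply: open_measurable_plane; exact: closed_openC.
Qed.

Lemma continuous_measurable_plane f (D : set (plane R)) : measurable D -> continuous f -> measurable_fun D f.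
Proof.
move=> mD cf; apply: (measurable_funS measurableT) => //.
apply: (measurability _ (measurable_raysE R)) => _ [_ [x ->] <-].
rewrite setTI; apply: open_measurable_plane; apply: open_comp.
  by move=> ? _; exact: cf.
exact: interval_open.
Qed.

Lemma bounded_sub_crect W : bounded_set W -> exists M, W `<=` crect (- M) M (- M) M.
Proof.
move=> [M [_ WM]]; exists (M + 1) => x Wx.
have := WM (M + 1); rewrite ltrDl ltr01 => /(_ isT _ Wx).
rewrite /= prod_normE/= ge_max => /andP[]; rewrite !ler_norml => /andP[h1 h2] /andP[h3 h4].
by split => /=; rewrite in_itv/=; apply/andP; split.
Qed.

Lemma compact_crect (a b c d : R) : compact (crect a b c d).
Proof. by apply: compact_setX; exact: segment_compact. Qed.

Lemma continuous_bounded_crect f (a b c d : R) : continuous f ->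
  exists M, forall x, crect a b c d x -> `|f x| <= M.
Proof.
move=> cf; have := @continuous_compact _ _ f (crect a b c d).
move=> /(_ (continuous_subspaceT cf) (@compact_crect a b c d)).
move=> /compact_bounded[M [_ fM]]; exists (M + 1) => x xr.
by apply: (fM (M + 1)); [rewrite ltrDl|exists x].
Qed.

Lemma bounded_measure W : measurable W -> bounded_set W -> (leb2 W < +oo)%E.
Proof.
move=> mW /bounded_sub_crect[M WM].
apply: le_lt_trans (leb2_crect (- M) M (- M) M).
by apply: le_measure => //; rewrite inE//; exact: measurable_crect.
Qed.

End plane_topology.

(** * Test functions *)

Section bump.
Context {R : realType}.
Implicit Types (c t x : R) (j : nat).

(* The family t^-j exp (- c / t), extended by 0 to t <= 0, is closed under
   derivation up to linear combinations. *)
Definition flat c j t : R := if 0 < t then t^-1 ^+ j * expR (- (c / t)) else 0.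

Lemma flat_le0 c j t : t <= 0 -> flat c j t = 0.
Proof. by rewrite /flat ltNge => ->. Qed.

(** Since exp (c / t) is at least the term of degree j + 2 of its series, t^-j exp (- c / t) is at
    most a multiple of t^2. The square makes the difference quotient at 0 tend to 0. *)
Lemma flat_bound c j : 0 < c -> exists K, forall t, `|flat c j t| <= K * t ^+ 2.
Proof.
move=> c0; exists ((j.+2)`!%:R / c ^+ j.+2) => t.
have K0 : 0 < (j.+2)`!%:R / c ^+ j.+2.
  by rewrite divr_gt0// ?ltr0n ?fact_gt0// exprn_gt0.
rewrite /flat; case: ifPn => [t0|_]; last by rewrite normr0 mulr_ge0 ?sqr_ge0// ltW.
have ti0 : 0 < t^-1 by rewrite invr_gt0.
rewrite ger0_norm ?mulr_ge0 ?expR_ge0 ?exprn_ge0 ?(ltW ti0)//.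
have ct0 : 0 < c / t by rewrite divr_gt0.
have /(le_trans (ler_wpDl ler01 (lexx _))) H := expR_ge1Dxn j.+1 (ltW ct0).
rewrite expRN ler_pdivrMr ?expR_gt0//.
apply: le_trans (ler_wpM2l _ H); last by rewrite mulr_ge0 ?sqr_ge0// ltW.
rewrite exprMn (_ : t^-1 ^+ j.+2 = t^-1 ^+ j * t^-1 ^+ 2); last by rewrite -exprD addn2.
rewrite le_eqVlt; apply/orP; left; apply/eqP.
rewrite !exprVn; field.
by rewrite !expf_neq0 ?gt_eqF// ?pnatr_eq0 -?lt0n ?fact_gt0.
Qed.

Lemma is_derive_flat c j t : 0 < c ->
  is_derive t 1 (flat c j) (c * flat c j.+2 t - j%:R * flat c j.+1 t).
Proof.
move=> c0; have [t0|t0|->] := ltgtP t 0.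
- rewrite !flat_le0 ?ltW// !mulr0 subr0.
  apply: (@near_eq_is_derive _ _ _ (cst 0)) => //.
  near=> u; rewrite flat_le0//; apply/ltW; near: u; exact: lt_nbhsl.
- pose f (u : R) : R := u^-1 ^+ j * expR (- (c / u)).
  apply: (@near_eq_is_derive _ _ _ f).
    near=> u; rewrite /flat ifT//; near: u; exact: lt_nbhsr.
  have tn0 : t != 0 by rewrite gt_eqF.
  have dV : is_derive t (1 : R) (fun u : R => u^-1) (- t^-1 ^+ 2).
    have := @is_deriveV R id t 1 1 tn0 (is_derive_id _ _).
    by move/is_derive_eq; apply; rewrite /= [LHS]mulr1 exprVn.
  have dX : is_derive t (1 : R) (fun u : R => u^-1 ^+ j) ((j%:R * t^-1 ^+ j.-1) *: - t^-1 ^+ 2).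
    rewrite (_ : (fun u : R => _) = (fun u : R => u^-1) ^+ j); last first.
      by apply/funext => u; rewrite exprfctE.
    exact: is_deriveX.
  have dE : is_derive t (1 : R) (expR \o (fun u : R => - (c / u)))
      (expR (- (c / t)) * (c * t^-1 ^+ 2)).
    apply: is_derive1_comp.
    have := is_deriveN (is_deriveZ c dV).
    by move/is_derive_eq; apply; rewrite scalerN opprK.
  have := is_deriveM dX dE; move/is_derive_eq; apply.
  rewrite /flat t0 /GRing.scale/=.
  case: j {dX f} => [|j]; rewrite ?expr0 ?mul0r/=; last rewrite !exprS; ring.
- rewrite !flat_le0// !mulr0 subr0.
  have [K fK] := flat_bound j c0.
  have Kf : (fun h : R => h^-1 *: ((flat c j \o shift 0) (h *: (1 : R)) - flat c j 0)) @ 0^' --> (0 : R).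
    apply/cvgrPdist_le => e e0; near=> h.
    rewrite /= (@flat_le0 c j 0)// subr0 addr0 /GRing.scale/= mulr1 sub0r normrN normrM.
    have h0 : h != 0 by near: h; exact: nbhs_dnbhs_neq.
    apply: le_trans (ler_wpM2l _ (fK h)) _; first exact: normr_ge0.
    rewrite normfV -[h ^+ 2]real_normK ?num_real// mulrCA expr2 mulKf ?normr_eq0//.
    apply: (@le_trans _ _ ((`|K| + 1) * `|h|)).
      by rewrite ler_wpM2r// (le_trans (ler_norm _))// lerDl.
    rewrite -ler_pdivlMl ?ltr_wpDl// mulrC; near: h; apply: dnbhs0_le.
    by rewrite divr_gt0// ltr_wpDl.
  apply: DeriveDef; last exact: cvg_lim Kf.
  by apply/cvg_ex; exists 0.
Unshelve. all: by end_near. Qed.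

Lemma continuous_flat c j : 0 < c -> continuous (flat c j).
Proof.
move=> c0 t; apply/differentiable_continuous/derivable1_diffP.
by have [] := is_derive_flat j t c0.
Qed.

Lemma flat_ge0 c t : 0 <= flat c 0 t.
Proof. by rewrite /flat expr0 mul1r; case: ifP => // _; exact: expR_ge0. Qed.

Lemma flat_le1 c t : 0 < c -> flat c 0 t <= 1.
Proof.
move=> c0; rewrite /flat expr0 mul1r; case: ifP => // t0.
by rewrite -expR0 ler_expR oppr_le0 divr_ge0// ltW.
Qed.

(** Letting the rate c tend to 0 turns these smooth functions into the indicator of the open half
    line; products of four of them then approximate the indicator of an open rectangle. *)
Lemma cvg_flat t : flat n.+1%:R^-1 0 t @[n --> \oo] --> ((0 < t)%R%:R : R).
Proof.
rewrite /flat; have [t0|t0] := ltP 0 t; last exact: cvg_cst.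
under eq_fun do rewrite expr0 mul1r.
suff : expR (- (n.+1%:R^-1 / t)) @[n --> \oo] --> expR (- (0 / t)).
  by rewrite mul0r oppr0 expR0.
apply: continuous_cvg; first exact: continuous_expR.
by apply: cvgN; apply: cvgMl; exact: cvg_harmonic.
Qed.

End bump.

Section smooth.
Context {R : realType}.
Implicit Types (f g : plane R -> R) (k : nat) (i : 'I_2).

Lemma of_class_CW k f : of_class_C k.+1 f -> of_class_C k f.
Proof.
elim: k f => [f [cf _]|k IH f [cf df]]; first by split.
by split => // i; have [d1 d2] := df i; split => //; exact: IH.
Qed.

Lemma of_class_C_cst k (a : R) : of_class_C k (fun=> a : R).
Proof.
elim: k a => [|k IH] a; split; try exact: cst_continuous; first by [].
move=> i; split; first by move=> x; exact: derivable_cst.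
suff -> : (fun x : plane R => 'D_(axis i) (fun=> a) x) = (fun=> 0 : R) by exact: IH.
by apply/funext => x; exact: derive_cst.
Qed.

Lemma of_class_CD k f g : of_class_C k f -> of_class_C k g ->
  of_class_C k (fun x => f x + g x).
Proof.
elim: k f g => [|k IH] f g [cf df] [cg dg]; split.
- by move=> x; apply: cvgD; [exact: cf|exact: cg].
- by [].
- by move=> x; apply: cvgD; [exact: cf|exact: cg].
move=> i; have [df1 df2] := df i; have [dg1 dg2] := dg i; split.
  by move=> x; exact: derivableD.
rewrite (_ : (fun x => _) = (fun x => 'D_(axis i) f x + 'D_(axis i) g x)).
  exact: IH.
by apply/funext => x; exact: deriveD.
Qed.

Lemma of_class_CM k f g : of_class_C k f -> of_class_C k g ->
  of_class_C k (fun x => f x * g x).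
Proof.
elim: k f g => [|k IH] f g Cf Cg; have [cf df] := Cf; have [cg dg] := Cg; split.
- by move=> x; apply: cvgM; [exact: cf|exact: cg].
- by [].
- by move=> x; apply: cvgM; [exact: cf|exact: cg].
move=> i; have [df1 df2] := df i; have [dg1 dg2] := dg i; split.
  by move=> x; exact: derivableM.
rewrite (_ : (fun x => _) = (fun x => f x * 'D_(axis i) g x + g x * 'D_(axis i) f x)).
  by apply: of_class_CD; apply: IH => //; exact: of_class_CW.
by apply/funext => x; exact: deriveM.
Qed.

(** A directional derivative only sees the line through x, which gives access to the chain rule in
    one variable. *)
Lemma is_derive_line f (x v : plane R) (d : R) :
  is_derive (0 : R) (1 : R) (fun h : R => f (h *: v + x)) d -> is_derive x v f d.
Proof.
move=> [dg <-]; pose q (h : R) := h^-1 *: ((f \o shift x) (h *: v) - f x).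
have qE : q = (fun h => h^-1 *: (((fun h : R => f (h *: v + x)) \o shift 0) (h *: (1 : R)) -
    (fun h : R => f (h *: v + x)) 0)).
  apply/funext => h; rewrite /q /= addr0 scale0r add0r.
  by rewrite [h *: 1]mulr1.
apply: DeriveDef; first by rewrite /derivable -[X in X @ _]/q qE.
by rewrite /derive -[X in X @ _]/q qE.
Qed.

Definition coord i (x : plane R) : R := if i == 0 :> nat then x.1 else x.2.

Lemma coordD i (x y : plane R) : coord i (x + y) = coord i x + coord i y.
Proof. by rewrite /coord; case: ifP. Qed.

Lemma coordZ i (a : R) (x : plane R) : coord i (a *: x) = a * coord i x.
Proof. by rewrite /coord; case: ifP. Qed.

Lemma continuous_coord i : continuous (coord i).
Proof. by rewrite /coord; case: (i == 0 :> nat) => x; [exact: cvg_fst|exact: cvg_snd]. Qed.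

(** The induction on k has to hold for all j at once, since differentiating replaces j by j + 1 and
    j + 2. *)
Lemma of_class_C_flat k (c s t : R) j i : 0 < c ->
  of_class_C k (fun x : plane R => flat c j (s * coord i x + t)).
Proof.
move=> c0; have cf j' : continuous (fun x : plane R => flat c j' (s * coord i x + t)).
  move=> x; apply: (@continuous_comp _ _ _ (fun x : plane R => s * coord i x + t) (flat c j')).
    apply: cvgD; last exact: cvg_cst.
    by apply: cvgMr; exact: continuous_coord.
  exact: continuous_flat.
elim: k j => [|k IH] j; split; try exact: (cf j); first by [].
move=> i'; pose m := s * coord i (axis i').
have D (x : plane R) : is_derive x (axis i') (fun x : plane R => flat c j (s * coord i x + t))
    ((c * flat c j.+2 (s * coord i x + t) - j%:R * flat c j.+1 (s * coord i x + t)) * m).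
  apply: is_derive_line.
  rewrite (_ : (fun h => _) = flat c j \o (fun h : R => (s * coord i x + t) + h *: m)); last first.
    by apply/funext => h /=; rewrite coordD coordZ /GRing.scale/= /m; congr flat; ring.
  apply: is_derive1_comp => /=.
    rewrite scale0r addr0; exact: is_derive_flat.
  have := is_deriveD (is_derive_cst (s * coord i x + t) (0 : R) (1 : R))
    (is_deriveZ m (is_derive_id (0 : R) (1 : R))).
  move/is_derive_eq => /(_ m) H.
  rewrite (_ : (fun h : R => _) = (cst (s * coord i x + t) + (m \*: id))).
    by apply: H; rewrite add0r /GRing.scale/= mulr1.
  by apply/funext => h; rewrite addrfctE; congr (_ + _); exact: mulrC.
split; first by move=> x; have [] := D x.
have -> : (fun x : plane R => 'D_(axis i') (fun y : plane R => flat c j (s * coord i y + t)) x) =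
    (fun x => (c * flat c j.+2 (s * coord i x + t) +
    - j%:R * flat c j.+1 (s * coord i x + t)) * m).
  by apply/funext => x; have [_ ->] := D x; rewrite mulNr.
by apply: of_class_CM; [apply: of_class_CD; apply: of_class_CM|];
  try exact: of_class_C_cst; exact: IH.
Qed.

(** The arguments are kept in the affine form s * coord + t of [of_class_C_flat]; [bumpE] gives the
    readable form. *)
Definition bump (c a b a' b' : R) (x : plane R) : R :=
  flat c 0 (1 * coord 0 x + - a) * flat c 0 (-1 * coord 0 x + b) *
  (flat c 0 (1 * coord 1 x + - a') * flat c 0 (-1 * coord 1 x + b')).

Lemma bumpE c a b a' b' x : bump c a b a' b' x =
  flat c 0 (x.1 - a) * flat c 0 (b - x.1) * (flat c 0 (x.2 - a') * flat c 0 (b' - x.2)).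
Proof. by rewrite /bump /coord/= !mul1r !mulN1r ![- _ + _]addrC. Qed.

Lemma bump_test_function (W : set (plane R)) c a b a' b' : 0 < c ->
  crect a b a' b' `<=` W -> test_function W (bump c a b a' b').
Proof.
move=> c0 rW; split.
  by move=> k; apply: of_class_CM; apply: of_class_CM; exact: of_class_C_flat.
exists (crect a b a' b'); split => //; first exact: compact_crect.
move=> x xr; rewrite bumpE.
have [x1|x1] := ltP x.1 a; first by rewrite (@flat_le0 _ _ _ (x.1 - a)) ?mul0r// subr_le0 ltW.
have [x2|x2] := ltP b x.1; first by rewrite (@flat_le0 _ _ _ (b - x.1)) ?mulr0 ?mul0r// subr_le0 ltW.
have [x3|x3] := ltP x.2 a'; first by rewrite (@flat_le0 _ _ _ (x.2 - a')) ?mul0r ?mulr0// subr_le0 ltW.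
have [x4|x4] := ltP b' x.2; first by rewrite (@flat_le0 _ _ _ (b' - x.2)) ?mulr0// subr_le0 ltW.
by exfalso; apply: xr; split => /=; rewrite in_itv/= ?x1 ?x2 ?x3 ?x4.
Qed.

Lemma bump_ge0 c a b a' b' x : 0 <= bump c a b a' b' x.
Proof. by rewrite bumpE !mulr_ge0 ?flat_ge0. Qed.

Lemma bump_le1 c a b a' b' x : 0 < c -> bump c a b a' b' x <= 1.
Proof.
by move=> c0; rewrite bumpE !mulr_ile1 ?mulr_ge0 ?flat_ge0 ?flat_le1.
Qed.

Lemma cvg_bump a b a' b' x : bump n.+1%:R^-1 a b a' b' x @[n --> \oo] -->
  (\1_(orect a b a' b') x : R).
Proof.
under eq_fun do rewrite bumpE.
have -> : \1_(orect a b a' b') x = (0 < x.1 - a)%R%:R * (0 < b - x.1)%R%:R *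
    ((0 < x.2 - a')%R%:R * (0 < b' - x.2)%R%:R) :> R.
  rewrite indicE -!natrM !mulnb !subr_gt0; congr ((nat_of_bool _)%:R).
  apply/idP/idP => [/set_mem[/=]|/andP[/andP[h1 h2] /andP[h3 h4]]].
    by rewrite !in_itv/= => /andP[-> ->] /andP[-> ->].
  by apply/mem_set; split; rewrite /= in_itv/= ?h1 ?h2 ?h3 ?h4.
by apply: cvgM; apply: cvgM; exact: cvg_flat.
Qed.

Lemma test_function_continuous W f : test_function W f -> continuous f.
Proof. by move=> [/(_ 0) []]. Qed.

Lemma test_function_partial W f i : test_function W f ->
  continuous (fun x => 'D_(axis i) f x).
Proof. by move=> [/(_ 1) [_ /(_ i) [_ []]]]. Qed.

End smooth.

(** * The fundamental lemma of the calculus of variations *)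

Section fundamental_lemma.
Context {R : realType}.
Variable W : set (plane R).
Hypotheses (oW : open W) (bW : bounded_set W).
Implicit Types (f g phi : plane R -> R).

Let mW : measurable W. Proof. exact: open_measurable_plane. Qed.
Let Woo : (leb2 W < +oo)%E. Proof. exact: bounded_measure. Qed.

Lemma continuous_bounded_on phi : continuous phi ->
  exists M, {ae leb2, forall x, W x -> `|phi x| <= M}.
Proof.
move=> cphi; have [N WN] := bounded_sub_crect bW.
have [M phiM] := @continuous_bounded_crect R phi (- N) N (- N) N cphi.
by exists M; apply: aeW => x /WN /phiM.
Qed.

Lemma L2_continuous phi : continuous phi -> L2 leb2 W phi.
Proof.
move=> cphi; have [M phiM] := continuous_bounded_on cphi.
have mphi := continuous_measurable_plane mW cphi.
have := L2_bounded_mul mW mphi phiM (L2_cst mW 1 Woo).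
by under eq_fun do rewrite mulr1.
Qed.

Lemma integrable_test f phi : continuous phi -> L2 leb2 W f ->
  leb2.-integrable W (EFin \o (fun x => f x * phi x)).
Proof. by move=> cphi fL2; apply: L2M_integrable => //; exact: L2_continuous. Qed.

(** The bumps are bounded by 1 and converge to the indicator of the open rectangle, so dominated
    convergence, with bound |g|, passes to the limit in the identities for test functions. *)
Lemma bump_integral0 g a b a' b' : L2 leb2 W g ->
  (forall phi, test_function W phi -> \int[leb2]_(x in W) (g x * phi x) = 0) ->
  crect a b a' b' `<=` W ->
  (\int[leb2]_(x in orect a b a' b') (g x)%:E = 0)%E.
Proof.
move=> gL2 g0 rW.
have c0 n : 0 < n.+1%:R^-1 :> R by [].
have phiT n := bump_test_function (c0 n) rW.
have mg := L2_measurable gL2.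
have gi := L2_integrable mW Woo gL2.
pose f_ n (x : plane R) := (g x * bump n.+1%:R^-1 a b a' b' x)%:E.
pose f (x : plane R) := (g x * \1_(orect a b a' b') x)%:E.
have H : (\int[leb2]_(x in W) f_ n x)%E @[n --> \oo] --> (\int[leb2]_(x in W) f x)%E.
  apply: (@dominated_cvg _ _ _ leb2 W mW f_ f (fun x => `|g x|%:E)).
  - move=> n; apply/measurable_EFinP; apply: measurable_funM => //.
    apply: continuous_measurable_plane => //; exact: test_function_continuous (phiT n).
  - move=> x _; apply: cvg_EFin; first exact: nearW.
    by apply: cvgMr; exact: cvg_bump.
  - by [].
  - exact: (integrable_abse gi).
  - move=> n x _; rewrite /f_ abse_EFin lee_fin normrM ler_piMr//.
    by rewrite ger0_norm ?bump_ge0 ?bump_le1.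
rewrite (_ : (fun n => _) = cst 0%E) in H; last first.
  apply/funext => n; rewrite /f_.
  have fi := integrable_test (test_function_continuous (phiT n)) gL2.
  by rewrite -(fineK (integrable_fin_num mW fi)); congr EFin; exact: (g0 _ (phiT n)).
have := cvg_unique _ H (@cvg_cst _ _ _ _ _); move=> /(_ (@ereal_hausdorff R)) <-.
have rI : orect a b a' b' = W `&` orect a b a' b'.
  by rewrite setIC setIidl//; apply: subset_trans rW; exact: orect_sub_crect.
rewrite [in LHS]rI integral_mkcondr; apply: eq_integral => x _.
rewrite /f restrict_EFin /= /patch indicE.
by case: (x \in _); rewrite ?mulr1 ?mulr0.
Qed.

Lemma orectI (a b a' b' c d : R) : orect a b a' b' `&` (`]c, +oo[ `*` `]d, +oo[) =
  orect (Num.max a c) b (Num.max a' d) b'.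
Proof.
apply/seteqP; split => x; rewrite /orect /= !in_itv/= !andbT !gt_max.
  by move=> [[/andP[-> ->] /andP[-> ->]] [-> ->]].
by move=> [/andP[/andP[-> ->] ->] /andP[/andP[-> ->] ->]].
Qed.

(** The integral of g vanishes on all subrectangles, and the sets on which it vanishes form a Dynkin
    system relative to Q. Hence it vanishes on every Borel subset of Q, which forces g = 0 almost
    everywhere there. *)
Lemma orect_null g a b a' b' : L2 leb2 W g ->
  (forall phi, test_function W phi -> \int[leb2]_(x in W) (g x * phi x) = 0) ->
  crect a b a' b' `<=` W ->
  {ae leb2, forall x, orect a b a' b' x -> g x = 0}.
Proof.
move=> gL2 g0 rW.
set Q := orect a b a' b'.
have mQ : measurable Q by exact: measurable_orect.
have QW : Q `<=` W by apply: subset_trans rW; exact: orect_sub_crect.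
have gi : leb2.-integrable Q (EFin \o g).
  by apply: integrableS (L2_integrable mW Woo gL2).
pose null (A : set (plane R)) := (\int[leb2]_(x in Q `&` A) (g x)%:E = 0)%E.
have nullD (X A : set (plane R)) : measurable X -> measurable A ->
    null X -> null (X `&` A) -> null (X `&` ~` A).
  move=> mX mA nX nA.
  have [mQA mQA'] : measurable (Q `&` (X `&` A)) /\ measurable (Q `&` (X `&` ~` A)).
    by split; apply: measurableI => //; apply: measurableI => //; exact: measurableC.
  have QU : Q `&` X = (Q `&` (X `&` A)) `|` (Q `&` (X `&` ~` A)).
    by rewrite -setIUr -setIUr setUCr setIT.
  move: nX; rewrite /null {1}QU integral_setU_EFin//.
  - by rewrite nA add0e.
  - rewrite -QU; apply: (measurable_funS mW _ (L2_measurable gL2)) => //.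
    by apply: subset_trans QW; exact: subIsetl.
  - by apply/disj_setPS => x [[_ [_ Ax]] [_ []]].
have nullU (F : (set (plane R))^nat) : (forall n, measurable (F n)) ->
    trivIset setT F -> (forall n, null (F n)) -> null (\bigcup_k F k).
  move=> mF tF nF; rewrite /null setI_bigcupr integral_bigcup//.
  - by apply: eseries0 => k _ _; exact: nF.
  - by move=> i j _ _ [x [[_ Fx] [_ Fjx]]]; apply: tF => //; exists x.
  - by move=> n; apply: measurableI.
  - by apply: integrableS gi => //; [apply: bigcup_measurable => k _; apply: measurableI|move=> x [k _ []]].
have null_rays c d : null (`]c, +oo[ `*` `]d, +oo[).
  rewrite /null orectI; apply: bump_integral0 => //.
  apply: subset_trans rW => x; rewrite /crect /= !in_itv/= !ge_max.
  by move=> [/andP[/andP[-> _] ->] /andP[/andP[-> _] ->]].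
have nullT : null setT by rewrite /null setIT; exact: bump_integral0.
(* Inside Q a ray starting at the side of Q is no restriction, so the whole line, which Dynkin
   induction requires, is obtained from rays. *)
have nullTr (A : set (measurableTypeR R)) : null (A `*` `]a', +oo[) -> null (A `*` setT).
  rewrite /null (_ : Q `&` _ = Q `&` (A `*` setT))//.
  apply/seteqP; split => x [Qx [Ax _]]; split => //; split => //=.
  by case: Qx => _ /=; rewrite !in_itv/= => /andP[->].
have nullTl (A : set (measurableTypeR R)) : null (`]a, +oo[ `*` A) -> null (setT `*` A).
  rewrite /null (_ : Q `&` _ = Q `&` (setT `*` A))//.
  apply/seteqP; split => x [Qx [_ Ax]]; split => //; split => //=.
  by case: Qx => /=; rewrite !in_itv/= => /andP[->].
pose rays := [set A : set (measurableTypeR R) | exists x, A = `]x, +oo[%classic].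
have raysI : setI_closed rays.
  move=> _ _ [x ->] [y ->]; exists (Num.max x y).
  by apply/seteqP; split => z /=; rewrite !in_itv/= !andbT gt_max => /andP.
have mray (c : R) : measurable (`]c, +oo[ : set (measurableTypeR R)).
  exact: measurable_itv.
(* Dynkin induction is run on one factor at a time: on the second one while the first is a ray, then
   on the first one, and at last on the plane from products of Borel sets. *)
have null_ray c (C : set (measurableTypeR R)) : measurable C -> null (`]c, +oo[ `*` C).
  rewrite measurable_raysE.
  apply: (@dynkin_induction _ (measurableTypeR R) rays (fun C => null (`]c, +oo[ `*` C))).
  - exact: measurable_raysE.
  - exact: raysI.
  - exact: nullTr.
  - by move=> _ [d ->]; exact: null_rays.
  - move=> S mS nS.
    have -> : `]c, +oo[%classic `*` ~` S =
        (`]c, +oo[ `*` setT) `&` ~` (`]c, +oo[ `*` S) :> set (plane R).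
      by apply/seteqP; split => x; [move=> [h1 h2]; split => // -[]|move=> [[h1 _] h2]; split => // h3; exact: h2].
    apply: nullD; [exact: measurableX|exact: measurableX|exact: nullTr|].
    by rewrite -setXI setTI setIid.
  - move=> F mF tF nF.
    have -> : `]c, +oo[%classic `*` \bigcup_k F k = \bigcup_k (`]c, +oo[ `*` F k) :> set (plane R).
      by apply/seteqP; split => x; [move=> [h1 [k _ h2]]; exists k|move=> [k _ [h1 h2]]; split => //; exists k].
    apply: nullU => // [n|i j _ _ [x [[_ h1] [_ h2]]]]; first exact: measurableX.
    by apply: tF => //; exists x.2.
have null_prod (B : set (measurableTypeR R)) (C : set (measurableTypeR R)) :
    measurable B -> measurable C -> null (B `*` C).
  move=> + mC; rewrite {1}measurable_raysE.
  apply: (@dynkin_induction _ (measurableTypeR R) rays (fun B => null (B `*` C))).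
  - exact: measurable_raysE.
  - exact: raysI.
  - by apply: nullTl; exact: null_ray.
  - by move=> _ [d ->]; exact: null_ray.
  - move=> S mS nS.
    have -> : ~` S `*` C = (setT `*` C) `&` ~` (S `*` C) :> set (plane R).
      by apply/seteqP; split => x; [move=> [h1 h2]; split => // -[]|move=> [[_ h1] h2]; split => // h3; exact: h2].
    apply: nullD; [exact: measurableX|exact: measurableX|apply: nullTl; exact: null_ray|].
    by rewrite -setXI setTI setIid.
  - move=> F mF tF nF.
    have -> : (\bigcup_k F k) `*` C = \bigcup_k (F k `*` C) :> set (plane R).
      by apply/seteqP; split => x; [move=> [[k _ h2] h1]; exists k|move=> [k _ [h1 h2]]; split => //; exists k].
    apply: nullU => // [n|i j _ _ [x [[h1 _] [h2 _]]]]; first exact: measurableX.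
    by apply: tF => //; exists x.1.
have all_null (A : set (plane R)) : measurable A -> null A.
  rewrite measurable_prod_measurableType; apply: dynkin_induction.
  - by rewrite measurable_prod_measurableType.
  - move=> _ _ [A1 mA1 [A2 mA2 <-]] [B1 mB1 [B2 mB2 <-]].
    exists (A1 `&` B1); first exact: measurableI.
    exists (A2 `&` B2); first exact: measurableI.
    by rewrite setXI.
  - exact: nullT.
  - by move=> _ [B mB [C mC <-]]; exact: null_prod.
  - by move=> S mS nS; rewrite -[~` S]setTI; apply: nullD => //; rewrite setTI.
  - by move=> F; exact: nullU.
have : ae_eq leb2 Q (EFin \o g) (cst 0%E).
  apply: integral_ae_eq => // E EQ mE; rewrite integral0 -[RHS](all_null E mE).
  by rewrite setIC setIidl.
by apply: filterS => x /= gx Qx; have [] := gx Qx.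
Qed.

Lemma L2_test_eq0 g : L2 leb2 W g ->
  (forall phi, test_function W phi -> \int[leb2]_(x in W) (g x * phi x) = 0) ->
  {ae leb2, forall x, W x -> g x = 0}.
Proof.
move=> gL2 g0; have [q [qW Wq]] := open_rect_cover oW.
have : {ae leb2, forall x n, orect (q n).1.1.1 (q n).1.1.2 (q n).1.2 (q n).2 x -> g x = 0}.
  by apply: ae_foralln => n; exact: orect_null.
by apply: filterS => x H; rewrite {1}Wq => -[n _]; exact: H.
Qed.

Lemma L2_test_unique f g : L2 leb2 W f -> L2 leb2 W g ->
  (forall phi, test_function W phi ->
    \int[leb2]_(x in W) (f x * phi x) = \int[leb2]_(x in W) (g x * phi x)) ->
  {ae leb2, forall x, W x -> f x = g x}.
Proof.
move=> fL2 gL2 fg.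
have : {ae leb2, forall x, W x -> f x - g x = 0}.
  apply: L2_test_eq0; first exact: L2B.
  move=> phi phiT; have cphi := test_function_continuous phiT.
  under eq_Rintegral do rewrite mulrBl.
  by rewrite RintegralB ?fg ?subrr//; exact: integrable_test.
by apply: filterS => x fgx Wx; apply/subr0_eq/fgx.
Qed.

End fundamental_lemma.

(** * Weak derivatives and traces *)

Section weak_derivatives.
Context {R : realType}.
Variable W : set (plane R).
Hypotheses (oW : open W) (bW : bounded_set W).
Implicit Types (s g : plane R -> R) (i : 'I_2) (a : R).

Let mW : measurable W. Proof. exact: open_measurable_plane. Qed.
Let Woo : (leb2 W < +oo)%E. Proof. exact: bounded_measure. Qed.

Lemma is_weak_partial_lin i s g s' g' a : L2 leb2 W s -> L2 leb2 W s' ->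
  is_weak_partial W i s g -> is_weak_partial W i s' g' ->
  is_weak_partial W i (fun x => s x + a * s' x) (fun x => g x + a * g' x).
Proof.
move=> sL2 sL2' [gL2 sg] [gL2' sg']; split.
  by apply: L2D => //; exact: L2Z.
move=> phi phiT; have cphi := test_function_continuous phiT.
have cdphi : continuous (fun x => 'D_(axis i) phi x) := test_function_partial phiT.
under eq_Rintegral do rewrite mulrDl -mulrA.
under [in RHS]eq_Rintegral do rewrite mulrDl -mulrA.
have int f (h : plane R -> R) : L2 leb2 W f -> continuous h ->
    leb2.-integrable W (EFin \o (fun x => f x * h x)) /\
    leb2.-integrable W (EFin \o (fun x => a * (f x * h x))).
  move=> fL2 ch; have fi := integrable_test oW bW ch fL2; split => //.
  by have := integrableZl mW a fi; apply: eq_integrable.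
rewrite !RintegralD ?RintegralZl//; try exact: (int _ _ _ _).1; try exact: (int _ _ _ _).2.
by rewrite sg// sg'// mulrN opprD.
Qed.

Lemma is_weak_partial_unique i s g g' :
  is_weak_partial W i s g -> is_weak_partial W i s g' ->
  {ae leb2, forall x, W x -> g x = g' x}.
Proof.
move=> [gL2 sg] [gL2' sg']; apply: L2_test_unique => // phi phiT.
by apply: oppr_inj; rewrite -sg// sg'.
Qed.

Lemma is_weak_partial_cst0 i : is_weak_partial W i (fun=> 0) (fun=> 0).
Proof.
split; first exact: L2_cst0.
move=> phi _; under eq_Rintegral do rewrite mul0r.
by under [in RHS]eq_Rintegral do rewrite mul0r; rewrite Rintegral_cst// mul0r oppr0.
Qed.

Lemma H1_lin s s' a : H1 W s -> H1 W s' -> H1 W (fun x => s x + a * s' x).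
Proof.
move=> [sL2 ds] [sL2' ds']; split; first by apply: L2D => //; exact: L2Z.
move=> i; have [g sg] := ds i; have [g' sg'] := ds' i.
by exists (fun x => g x + a * g' x); exact: is_weak_partial_lin.
Qed.

Lemma H1_cst0 : H1 W (fun=> 0).
Proof.
by split; [exact: L2_cst0|move=> i; exists (fun=> 0); exact: is_weak_partial_cst0].
Qed.

Lemma weak_partialP i s : H1 W s -> is_weak_partial W i s (weak_partial W i s).
Proof.
by move=> [_ /(_ i) ds]; exact: (xgetPex (fun=> 0) ds).
Qed.

Lemma L2_weak_partial i s : H1 W s -> L2 leb2 W (weak_partial W i s).
Proof. by move=> /(weak_partialP i)[]. Qed.

(** The three derivatives are chosen independently of each other; uniqueness up to null sets is what
    relates them. *)
Lemma weak_partial_lin i s s' a : H1 W s -> H1 W s' ->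
  {ae leb2, forall x, W x -> weak_partial W i (fun x => s x + a * s' x) x =
    weak_partial W i s x + a * weak_partial W i s' x}.
Proof.
move=> sH sH'; apply: (@is_weak_partial_unique i (fun x => s x + a * s' x)).
  by apply: weak_partialP; exact: H1_lin.
by apply: is_weak_partial_lin; try exact: weak_partialP; [case: sH|case: sH'].
Qed.

Lemma weak_partial_cst0 i :
  {ae leb2, forall x, W x -> weak_partial W i (fun=> 0) x = 0}.
Proof.
apply: is_weak_partial_unique (is_weak_partial_cst0 i).
by apply: weak_partialP; exact: H1_cst0.
Qed.

End weak_derivatives.

(** * Linearity and uniqueness of traces *)

Section traces.
Context {R : realType}.
Variable W : set (plane R).
Hypotheses (oW : open W) (bW : bounded_set W).
Implicit Types (s g : plane R -> R) (a : R) (x : plane R).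

Let mW : measurable W. Proof. exact: open_measurable_plane. Qed.
Let Woo : (leb2 W < +oo)%E. Proof. exact: bounded_measure. Qed.

Lemma measurable_frontier : measurable (frontier W).
Proof.
apply: measurableD.
  by apply: closed_measurable_plane; exact: closed_closure.
by apply: open_measurable_plane; exact: open_interior.
Qed.

Lemma open_leb2_gt0 (A : set (plane R)) : open A -> A !=set0 -> (0 < leb2 A)%E.
Proof.
move=> oA [x Ax]; have [q [_ Aq]] := open_rect_cover oA.
move: Ax; rewrite Aq => -[n _ [/=]]; rewrite !in_itv/= => /andP[h1 h2] /andP[h3 h4].
apply: (@lt_le_trans _ _ (leb2 (orect (q n).1.1.1 (q n).1.1.2 (q n).1.2 (q n).2))).
  by apply: leb2_orect_gt0; [exact: lt_trans h1 h2|exact: lt_trans h3 h4].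
apply: le_measure; rewrite ?inE.
- exact: measurable_orect.
- by rewrite -Aq; exact: open_measurable_plane.
- by move=> y; exists n.
Qed.

Let open_ball_I x (r : R) : 0 < r -> open (W `&` ball x r).
Proof. by move=> r0; apply: openI => //; exact: ball_open. Qed.

Let ball_oo x (r : R) : 0 < r -> (leb2 (W `&` ball x r) < +oo)%E.
Proof.
move=> r0; apply: le_lt_trans Woo; apply: le_measure; rewrite ?inE//.
by apply: open_measurable_plane; exact: open_ball_I.
Qed.

Let mean s (c : R) x r :=
  (\int[leb2]_(y in W `&` ball x r) `|s y - c|) / fine (leb2 (W `&` ball x r)).

(** This averaged triangle inequality gives the linearity of traces, and also their uniqueness on
    taking s' = s and a = -1. *)
Let mean_lin s s' (c c' : R) a x (r : R) : L2 leb2 W s -> L2 leb2 W s' -> 0 < r ->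
  0 <= mean (fun y => s y + a * s' y) (c + a * c') x r <= mean s c x r + `|a| * mean s' c' x r.
Proof.
move=> sL2 sL2' r0; have mB : measurable (W `&` ball x r).
  by apply: open_measurable_plane; exact: open_ball_I.
have m0 : 0 <= fine (leb2 (W `&` ball x r)) by rewrite fine_ge0.
rewrite divr_ge0//=; last by apply: Rintegral_ge0 => y _; exact: normr_ge0.
have int f (d : R) : L2 leb2 W f ->
    leb2.-integrable (W `&` ball x r) (EFin \o (fun y => `|f y - d|)).
  move=> fL2; apply: integrable_norm; apply: L2_integrable => //; first exact: ball_oo.
  apply: L2B => //; last by apply: L2_cst => //; exact: ball_oo.
  by apply: L2_sub fL2 => //; exact: subIsetl.
rewrite /mean mulrA -mulrDl ler_wpM2r ?invr_ge0//.
have int' : leb2.-integrable (W `&` ball x r) (EFin \o (fun y => `|a| * `|s' y - c'|)).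
  by have := integrableZl mB `|a| (int _ c' sL2'); apply: eq_integrable.
rewrite -RintegralZl//; last exact: int.
rewrite -RintegralD//; last exact: int.
apply: le_Rintegral => //.
- by apply: int; apply: L2D => //; exact: L2Z.
- by have := integrableD mB (int _ c sL2) int'; apply: eq_integrable.
move=> y _; rewrite -normrM (_ : _ - _ = (s y - c) + a * (s' y - c')); last by ring.
exact: ler_normD.
Qed.

Lemma is_trace_lin s g s' g' a : L2 leb2 W s -> L2 leb2 W s' ->
  is_trace W s g -> is_trace W s' g' ->
  is_trace W (fun x => s x + a * s' x) (fun x => g x + a * g' x).
Proof.
move=> sL2 sL2' [gL2 sg] [gL2' sg']; split.
  by apply: L2D; [exact: measurable_frontier|by []|apply: L2Z => //; exact: measurable_frontier].
apply: filterS2 sg sg' => x sg sg' Wx.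
have H : mean s (g x) x r + `|a| * mean s' (g' x) x r @[r --> 0^'+] --> 0 + `|a| * 0.
  by apply: cvgD; [exact: sg|apply: cvgMr; exact: sg'].
rewrite mulr0 addr0 in H.
apply: (squeeze_cvgr _ (cvg_cst 0) H); near=> r; apply: mean_lin => //.
Unshelve. all: by end_near. Qed.

(** For s - s the mean is the constant |g x - g' x|, yet it is bounded by a sum of means tending to
    0. The averages make sense because x is in the closure of W, so each [W] [&] [ball x r] is a
    nonempty open set and has positive measure. *)
Lemma is_trace_unique s g g' : L2 leb2 W s -> is_trace W s g -> is_trace W s g' ->
  {ae hausdorff1, forall x, frontier W x -> g x = g' x}.
Proof.
move=> sL2 [gL2 sg] [gL2' sg']; apply: filterS2 sg sg' => x sg sg' Wx.
have H : mean s (g x) x r + `|-1| * mean s (g' x) x r @[r --> 0^'+] --> (0 + `|-1| * 0 : R).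
  by apply: cvgD; [exact: sg|apply: cvgMr; exact: sg'].
rewrite mulr0 addr0 in H.
apply/eqP; rewrite -subr_eq0 -normr_le0.
apply: (cvgr_to_ge H); near=> r.
have r0 : 0 < r by [].
have mB : measurable (W `&` ball x r).
  by apply: open_measurable_plane; exact: open_ball_I.
have := mean_lin (g x) (g' x) (-1) x sL2 sL2 r0; move=> /andP[_]; apply: le_trans.
rewrite /mean (_ : (fun y => _) = (fun=> `|g x - g' x|)); last first.
  by apply/funext => y; rewrite !mulN1r subrr sub0r normrN.
rewrite Rintegral_cst// mulfK// gt_eqF// fine_gt0// ball_oo// andbT.
apply: open_leb2_gt0; first exact: open_ball_I.
have [cx _] := Wx; have := cx (ball x r); apply.
exact: nbhsx_ballx.
Unshelve. all: by end_near. Qed.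

Lemma is_trace_cst0 : is_trace W (fun=> 0) (fun=> 0).
Proof.
split; first exact: L2_cst0.
apply: aeW => x _; rewrite (_ : (fun r => _) = (fun=> 0)); first exact: cvg_cst.
apply/funext => r.
by under eq_Rintegral do rewrite subrr normr0; rewrite /Rintegral integral0 mul0r.
Qed.

Lemma traceP s : (exists g, is_trace W s g) -> is_trace W s (trace W s).
Proof. by move=> sg; exact: (xgetPex (fun=> 0) sg). Qed.

Lemma trace_lin s s' a : L2 leb2 W s -> L2 leb2 W s' ->
  (exists g, is_trace W s g) -> (exists g, is_trace W s' g) ->
  {ae hausdorff1, forall x, frontier W x ->
    trace W (fun x => s x + a * s' x) x = trace W s x + a * trace W s' x}.
Proof.
move=> sL2 sL2' sg sg'.
have tr : is_trace W (fun x => s x + a * s' x) (fun x => trace W s x + a * trace W s' x).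
  by apply: is_trace_lin => //; exact: traceP.
apply: (@is_trace_unique (fun x => s x + a * s' x)) => //.
  by apply: L2D => //; exact: L2Z.
by apply: traceP; eexists; exact: tr.
Qed.

End traces.

Lemma big_ord2 (R : nmodType) (F : 'I_2 -> R) :
  \sum_(i < 2) F i = F ord0 + F (lift ord0 ord0).
Proof. by rewrite !big_ord_recl big_ord0 addr0. Qed.

(* Unification must not unfold these functions, which are defined by choice. *)
#[local] Opaque weak_partial trace weak_div.

(** * The energy space *)

Section energy.
Context {R : realType} (p : problem R) (hp : valid_problem p).
Local Notation W := (Omega p).
Local Notation E := ((plane R -> R) * (plane R -> R))%type.
Implicit Types (x y v : E) (s t f g : plane R -> R) (a : R).

Lemma open_Omega : open W. Proof. by case: hp => -[]. Qed.
Lemma bounded_Omega : bounded_set W. Proof. by case: hp => -[]. Qed.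
Let oW := open_Omega.
Let bW := bounded_Omega.

Lemma measurable_Omega : measurable W. Proof. exact: open_measurable_plane. Qed.
Lemma leb2_Omega : (leb2 W < +oo)%E. Proof. exact: (bounded_measure measurable_Omega bW). Qed.
Let mW := measurable_Omega.
Let Woo := leb2_Omega.

Lemma GR_boundary : measurable (GR p) /\ GR p `<=` frontier W.
Proof.
by case: hp => _ [bd _ _ _] _ _; have := bd (lift ord0 (lift ord0 ord0)).
Qed.
Let mGR := GR_boundary.1.

Lemma Linfty_mul k f : Linfty W k -> L2 leb2 W f -> L2 leb2 W (fun z => k z * f z).
Proof. by move=> [mk [M kM]] fL2; exact: (L2_bounded_mul mW mk kM). Qed.

Lemma Linfty_h : Linfty W (coef_h p). Proof. by case: hp => _ _ _ []. Qed.
Lemma Linfty_c : Linfty W (coef_c p). Proof. by case: hp => _ _ _ [_ []]. Qed.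
Lemma Linfty_cV : Linfty W (fun z => (coef_c p z)^-1).
Proof. by case: hp => _ _ _ [_ []]. Qed.
Lemma Linfty_sigma : Linfty W (coef_sigma p). Proof. by case: hp => _ _ _ [_ _ []]. Qed.
Lemma c_gt0 : {ae leb2, forall z, W z -> 0 < coef_c p z}.
Proof. by case: hp => _ _ _ [_ []]. Qed.
Lemma sigma_gt0 : {ae leb2, forall z, W z -> 0 < coef_sigma p z}.
Proof. by case: hp => _ _ _ [_ _ []]. Qed.

Lemma Vspace_lin s s' a : Vspace p s -> Vspace p s' -> Vspace p (fun z => s z + a * s' z).
Proof.
move=> [sH [g [sg gD gper]]] [sH' [g' [sg' gD' gper']]]; split; first exact: H1_lin.
exists (fun z => g z + a * g' z); split.
- by apply: is_trace_lin => //; [case: sH|case: sH'].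
- by apply: filterS2 gD gD' => z gD gD' Dz; rewrite gD// gD'// mulr0 addr0.
- move=> j; apply: filterS2 (gper j) (gper' j) => z gz gz' Gz.
  by rewrite gz// gz'.
Qed.

Lemma Vspace0 : Vspace p (fun=> 0).
Proof.
split; first exact: H1_cst0.
by exists (fun=> 0); split; [exact: is_trace_cst0|exact: aeW|move=> j; exact: aeW].
Qed.

Lemma Vspace_H1 s : Vspace p s -> H1 W s. Proof. by case. Qed.
Lemma Vspace_L2 s : Vspace p s -> L2 leb2 W s. Proof. by case=> -[]. Qed.
Lemma Vspace_trace s : Vspace p s -> exists g, is_trace W s g.
Proof. by case=> _ [g []]; exists g. Qed.

Lemma Hspace_lin x y a : Hspace p x -> Hspace p y -> Hspace p (x + a *: y).
Proof.
move=> [x1 x2] [y1 y2]; split.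
  exact: (L2D mW x1 (L2Z mW a y1)).
exact: (Vspace_lin a x2 y2).
Qed.

Lemma Hspace0 : Hspace p 0.
Proof. by split; [exact: L2_cst0|exact: Vspace0]. Qed.

Lemma HspaceD x y : Hspace p x -> Hspace p y -> Hspace p (x + y).
Proof. by move=> xH yH; have := Hspace_lin 1 xH yH; rewrite scale1r. Qed.

Lemma HspaceZ a x : Hspace p x -> Hspace p (a *: x).
Proof. by move=> xH; have := Hspace_lin a Hspace0 xH; rewrite add0r. Qed.

Lemma HspaceB x y : Hspace p x -> Hspace p y -> Hspace p (x - y).
Proof. by move=> xH yH; have := Hspace_lin (-1) xH yH; rewrite scaleN1r. Qed.

Lemma Hspace_inlet f : L2 leb2 W f -> Hspace p (inlet f).
Proof. by move=> fL2; split => //; exact: Vspace0. Qed.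

Lemma Hspace_opP x : Hspace p x -> Hspace p (opP x).
Proof. by case=> x1 _; exact: Hspace_inlet. Qed.

Definition energy_density x y (z : plane R) : R := coef_c p z * x.1 z * y.1 z +
  \sum_(i < 2) coef_sigma p z * weak_partial W i x.2 z * weak_partial W i y.2 z.
Local Notation density := energy_density.

Definition volume_form x y : R := \int[leb2]_(z in W) density x y z.

Lemma hdotE x y : hdot p x y = volume_form x y + robin_form p x.2 y.2.
Proof. by []. Qed.

Lemma volume_formC x y : volume_form x y = volume_form y x.
Proof.
apply: eq_Rintegral => z _; rewrite /energy_density mulrAC.
by under eq_bigr do rewrite mulrAC.
Qed.

Lemma integrable_cMM f g : L2 leb2 W f -> L2 leb2 W g ->
  leb2.-integrable W (EFin \o (fun z => coef_c p z * f z * g z)).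
Proof. by move=> fL2 gL2; apply: L2M_integrable => //; exact: Linfty_mul Linfty_c _. Qed.

Lemma integrable_sigmaMM i s s' : H1 W s -> H1 W s' ->
  leb2.-integrable W (EFin \o (fun z => coef_sigma p z * weak_partial W i s z * weak_partial W i s' z)).
Proof.
move=> sH sH'; apply: L2M_integrable => //; last exact: L2_weak_partial.
by apply: Linfty_mul Linfty_sigma _; exact: L2_weak_partial.
Qed.

Let integrable_density x y : Hspace p x -> Hspace p y ->
  leb2.-integrable W (EFin \o density x y).
Proof.
move=> [x1 [x2 _]] [y1 [y2 _]].
have i1 := integrable_cMM x1 y1.
have i2 := integrable_sigmaMM ord0 x2 y2.
have i3 := integrable_sigmaMM (lift ord0 ord0) x2 y2.
have := integrableD mW i1 (integrableD mW i2 i3); apply: eq_integrable => // z _.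
by rewrite -[RHS]/((density x y z)%:E) /energy_density big_ord2.
Qed.

Lemma weak_partial_linE x y a : Hspace p x -> Hspace p y ->
  {ae leb2, forall z, W z -> forall i, weak_partial W i (x + a *: y).2 z =
    weak_partial W i x.2 z + a * weak_partial W i y.2 z}.
Proof.
move=> [_ [x2 _]] [_ [y2 _]].
apply: filterS2 (weak_partial_lin oW bW ord0 a x2 y2)
  (weak_partial_lin oW bW (lift ord0 ord0) a x2 y2) => z h0 h1 Wz i.
have := ord_enum; case: (unliftP ord0 i) => [j ->|->]; last by move=> _; exact: h0.
by rewrite (ord1 j) => _; exact: h1.
Qed.

Lemma robin_formE s t : robin_form p s t =
  coef_a p * \int[hausdorff1]_(z in GR p) (trace W s z * trace W t z).
Proof. by []. Qed.

(** Here [hausdorff1] has to be a measure on Borel sets: the linearity of the integral over [GR p]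
    rests on it, and so do the almost everywhere statements about traces. *)
Lemma robin_lin s s' t a : Vspace p s -> Vspace p s' -> Vspace p t ->
  robin_form p (fun z => s z + a * s' z) t = robin_form p s t + a * robin_form p s' t.
Proof.
move=> sV sV' tV.
have L2tr u : Vspace p u -> L2 hausdorff1 (GR p) (trace W u).
  move=> uV; apply: (@L2_sub _ _ (frontier W)) => //.
  - exact: measurable_frontier.
  - exact: GR_boundary.2.
  - by have [] := traceP (Vspace_trace uV).
rewrite !robin_formE mulrCA -mulrDr; congr (_ * _).
apply: (@RintegralM_lin _ hausdorff1 (GR p) mGR (trace W s) (trace W s') (trace W t)
  (trace W (fun z => s z + a * s' z)) a (L2tr _ sV) (L2tr _ sV') (L2tr _ tV)
  (L2tr _ (Vspace_lin a sV sV'))).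
apply: filterS (trace_lin oW bW a (Vspace_L2 sV) (Vspace_L2 sV')
  (Vspace_trace sV) (Vspace_trace sV')) => z tr Gz.
by apply: tr; exact: GR_boundary.2.
Qed.

Lemma robin_formC s t : robin_form p s t = robin_form p t s.
Proof.
exact: (congr1 ( *%R (coef_a p)) (RintegralM_C hausdorff1 (GR p) (trace W s) (trace W t))).
Qed.

Lemma robin_form_ge0 s : 0 <= robin_form p s s.
Proof.
have [_ _ _ [_ _ _ a0]] := hp.
by rewrite robin_formE mulr_ge0 ?(ltW a0)//; exact: RintegralM_sqr_ge0.
Qed.

(** The chosen trace of 0 need not be the zero function; linearity with a = -1 avoids computing
    it. *)
Lemma robin_form0 s : Vspace p s -> robin_form p (fun=> 0) s = 0.
Proof.
move=> sV; have := robin_lin (-1) Vspace0 Vspace0 sV.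
have -> : (fun z : plane R => 0 + -1 * 0) = (fun=> 0 : R).
  by apply/funext => z; rewrite mulr0 addr0.
by rewrite mulN1r subrr.
Qed.

Lemma hdotC x y : hdot p x y = hdot p y x.
Proof.
by rewrite !hdotE robin_formC volume_formC.
Qed.

Lemma volume_form_lin x y v a : Hspace p x -> Hspace p y -> Hspace p v ->
  volume_form (x + a *: y) v = volume_form x v + a * volume_form y v.
Proof.
move=> xH yH vH.
have i1 := integrable_density xH vH; have i2 := integrable_density yH vH.
have i2' : leb2.-integrable W (EFin \o (fun z => a * density y v z)).
  by have := integrableZl mW a i2; apply: eq_integrable.
have i3 := integrable_density (Hspace_lin a xH yH) vH.
rewrite /volume_form -(RintegralZl a mW i2) -(RintegralD mW i1 i2').
apply: Rintegral_ae_eq.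
- exact: mW.
- by apply/measurable_EFinP; exact: (measurable_int leb2 i3).
- apply: measurable_funD; apply/measurable_EFinP.
    exact: (measurable_int leb2 i1).
  exact: (measurable_int leb2 i2').
apply: filterS (weak_partial_linE a xH yH) => z dz Wz.
have x1 : (x + a *: y).1 z = x.1 z + a * y.1 z by [].
rewrite /energy_density !big_ord2 !dz// x1.
have ringE (k u u' w s d0 e0 f0 d1 e1 f1 : R) :
    k * (u + a * u') * w + (s * (d0 + a * e0) * f0 + s * (d1 + a * e1) * f1) =
    k * u * w + (s * d0 * f0 + s * d1 * f1) +
    a * (k * u' * w + (s * e0 * f0 + s * e1 * f1)) by ring.
exact: ringE.
Qed.

Lemma hdot_linl x y v a : Hspace p x -> Hspace p y -> Hspace p v ->
  hdot p (x + a *: y) v = hdot p x v + a * hdot p y v.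
Proof.
move=> xH yH vH; rewrite !hdotE volume_form_lin// mulrDr addrACA.
by have -> := robin_lin a xH.2 yH.2 vH.2.
Qed.

Lemma hdotDl x y v : Hspace p x -> Hspace p y -> Hspace p v ->
  hdot p (x + y) v = hdot p x v + hdot p y v.
Proof. by move=> xH yH vH; have := hdot_linl 1 xH yH vH; rewrite scale1r mul1r. Qed.

Lemma hdotBl x y v : Hspace p x -> Hspace p y -> Hspace p v ->
  hdot p (x - y) v = hdot p x v - hdot p y v.
Proof. by move=> xH yH vH; have := hdot_linl (-1) xH yH vH; rewrite scaleN1r mulN1r. Qed.

Lemma hdot0l v : Hspace p v -> hdot p 0 v = 0.
Proof. by move=> vH; have := hdotBl Hspace0 Hspace0 vH; rewrite !subrr. Qed.

Lemma hdotZl a x v : Hspace p x -> Hspace p v -> hdot p (a *: x) v = a * hdot p x v.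
Proof.
by move=> xH vH; have := hdot_linl a Hspace0 xH vH; rewrite (hdot0l vH) !add0r.
Qed.

Lemma hdot_fst_le x : Hspace p x ->
  \int[leb2]_(z in W) (coef_c p z * x.1 z * x.1 z) <= hdot p x x.
Proof.
move=> xH; rewrite hdotE; apply: ler_wpDr; first exact: robin_form_ge0.
have i1 := integrable_density xH xH; have i2 := integrable_cMM xH.1 xH.1.
apply: (le_Rintegral_ae mW i2 i1).
apply: filterS sigma_gt0 => z z0 Wz; rewrite lerDl sumr_ge0// => i _.
by rewrite -mulrA mulr_ge0 ?(ltW (z0 Wz))// -expr2 sqr_ge0.
Qed.

Lemma hdot_ge0 x : Hspace p x -> 0 <= hdot p x x.
Proof.
move=> xH; apply: le_trans (hdot_fst_le xH).
apply: Rintegral_ge0_ae => //.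
  by apply/measurable_EFinP; apply: (measurable_int leb2); apply: integrable_cMM; case: xH.
apply: filterS c_gt0 => z c0 Wz.
by rewrite -mulrA mulr_ge0 ?(ltW (c0 Wz))// -expr2 sqr_ge0.
Qed.

Lemma hdot_inlet x f : Hspace p x -> L2 leb2 W f ->
  hdot p x (inlet f) = \int[leb2]_(z in W) (coef_c p z * x.1 z * f z).
Proof.
move=> xH fL2; rewrite hdotE robin_formC (robin_form0 xH.2) addr0.
have i1 := integrable_density xH (Hspace_inlet fL2).
have i2 := integrable_cMM xH.1 fL2.
apply: Rintegral_ae_eq.
- exact: mW.
- by apply/measurable_EFinP; exact: (measurable_int leb2 i1).
- by apply/measurable_EFinP; exact: (measurable_int leb2 i2).
apply: filterS2 (weak_partial_cst0 oW bW ord0)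
  (weak_partial_cst0 oW bW (lift ord0 ord0)) => z h0 h1 Wz.
rewrite /energy_density big_ord2.
have dropE (k u w d0 d1 f0 f1 : R) : f0 = 0 -> f1 = 0 ->
    k * u * w + (d0 * f0 + d1 * f1) = k * u * w.
  by move=> -> ->; rewrite !mulr0 !addr0.
exact: (dropE _ _ _ _ _ _ _ (h0 Wz) (h1 Wz)).
Qed.

(* c^-1 is bounded. *)
Lemma L2norm_fst_le : exists2 C : R, 0 <= C & forall x, Hspace p x ->
  \int[leb2]_(z in W) (x.1 z ^+ 2) <= C * hdot p x x.
Proof.
have [mcV [M cVM]] := Linfty_cV; exists `|M|; first exact: normr_ge0.
move=> x xH; apply: le_trans (ler_wpM2l (normr_ge0 M) (hdot_fst_le xH)).
have x1 : L2 leb2 W x.1 by case: xH.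
rewrite -RintegralZl//; last exact: integrable_cMM.
apply: le_Rintegral_ae => //.
- exact: L2_sqr_integrable.
- by have := integrableZl mW `|M| (integrable_cMM x1 x1); apply: eq_integrable.
apply: filterS2 cVM c_gt0 => z cM c0 Wz.
rewrite -mulrA -expr2 mulrA ler_peMl ?sqr_ge0//.
have {}c0 := c0 Wz; rewrite -ler_pdivrMr// div1r.
by apply: le_trans (ler_norm _) (le_trans (cM Wz) (ler_norm _)).
Qed.

Lemma controlledPn : ~ controlled p -> GR p = set0 /\ GD p = set0.
Proof.
move=> nc; split; rewrite -subset0 => z Gz; apply: nc; exists z; [by right|by left].
Qed.

Lemma robin_uncontrolled s t : ~ controlled p -> robin_form p s t = 0.
Proof. by move=> /controlledPn[GR0 _]; rewrite /robin_form GR0 integral_set0 mulr0. Qed.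

Lemma L2_weak_div s : (exists g, is_weak_div W (flux p s) g) ->
  L2 leb2 W (weak_div W (flux p s)).
Proof. by move=> sg; have [] := xgetPex (fun=> 0) sg. Qed.

Lemma Hspace_opA x : domA p x -> Hspace p (opA p x).
Proof.
move=> [xH x1 xdiv _]; split => //=; apply: L2B => //.
  rewrite (_ : (fun z => _) = (fun z => (coef_c p z)^-1 * (coef_h p z * x.1 z))).
    by apply: Linfty_mul Linfty_cV _; apply: Linfty_mul Linfty_h _; case: xH.
  by apply/funext => z; rewrite mulrA.
by apply: Linfty_mul Linfty_cV _; exact: L2_weak_div.
Qed.

Lemma heq_refl x : heq p x x.
Proof.
split; first exact: aeW; case: asboolP => _; first exact: aeW.
by exists 0; apply: aeW => z _; rewrite addr0.
Qed.

Lemma heq_sym x y : heq p x y -> heq p y x.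
Proof.
move=> [h1 h2]; split; first by apply: filterS h1 => z h Wz; rewrite h.
move: h2; case: asboolP => _; first by apply: filterS => z h Wz; rewrite h.
by move=> [k h]; exists (- k); apply: filterS h => z h Wz; rewrite h// addrK.
Qed.

Lemma heq_trans x y v : heq p x y -> heq p y v -> heq p x v.
Proof.
move=> [h1 h2] [g1 g2]; split.
  by apply: filterS2 h1 g1 => z h g Wz; rewrite h// g.
move: h2 g2; case: asboolP => _; first by apply: filterS2 => z h g Wz; rewrite h// g.
move=> [k h] [k' g]; exists (k' + k); apply: filterS2 h g => z h g Wz.
by rewrite h// g// addrA.
Qed.

Lemma heq_sub0 x y : heq p (x - y) 0 <-> heq p x y.
Proof.
split=> -[h1 h2]; split.
- by apply: filterS h1 => z h Wz; apply/subr0_eq/h.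
- move: h2; case: asboolP => _; first by apply: filterS => z h Wz; apply/subr0_eq/h.
  move=> [k h]; exists k; apply: filterS h => z h Wz.
  by apply/eqP; rewrite addrC -subr_eq; apply/eqP; have := h Wz; rewrite [X in _ = X]add0r.
- by apply: filterS h1 => z h Wz; rewrite -[LHS]/(x.1 z - y.1 z) h// subrr.
- move: h2; case: asboolP => _.
    by apply: filterS => z h Wz; rewrite -[LHS]/(x.2 z - y.2 z) h// subrr.
  move=> [k h]; exists k; apply: filterS h => z h Wz.
  by rewrite -[LHS]/(x.2 z - y.2 z) h// addrAC subrr.
Qed.

Lemma heq_opP x y : heq p x y -> heq p (opP x) (opP y).
Proof.
move=> [h1 _]; split => //; case: asboolP => _; first exact: aeW.
by exists 0; apply: aeW => z _; rewrite addr0.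
Qed.

End energy.

(** * Abstract self-adjoint operators with discrete spectrum *)

Section semi_inner.
Context {R : realType} {V : lmodType R}.
Variables (H : set V) (dot : V -> V -> R).
Implicit Types (x y v w : V) (a b : R).

(** There is no definiteness, since vectors are functions and not classes. H is a subset of the
    module because the form is only meaningful on square integrable functions with traces, while
    sums are taken among all functions. *)
Record semi_inner : Prop := SemiInner {
  si_zero : H 0;
  si_lin : forall x y a, H x -> H y -> H (x + a *: y);
  si_sym : forall x y, dot x y = dot y x;
  si_dot_lin : forall x y v a, H x -> H y -> H v ->
    dot (x + a *: y) v = dot x v + a * dot y v;
  si_ge0 : forall x, H x -> 0 <= dot x x }.

Hypothesis HS : semi_inner.
Local Notation "''[' x , y ]" := (dot x y) (format "''[' x ,  y ]").
Local Notation nrm x := (Num.sqrt (dot x x)).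

Let H0 := si_zero HS.
Let dotC := si_sym HS.

Lemma siD x y : H x -> H y -> H (x + y).
Proof. by move=> xH yH; have := si_lin HS 1 xH yH; rewrite scale1r. Qed.

Lemma siB x y : H x -> H y -> H (x - y).
Proof. by move=> xH yH; have := si_lin HS (-1) xH yH; rewrite scaleN1r. Qed.

Lemma siZ a x : H x -> H (a *: x).
Proof. by move=> xH; have := si_lin HS a H0 xH; rewrite add0r. Qed.

Lemma si_sum (I : finType) (A : pred I) (u : I -> V) : (forall k, H (u k)) ->
  H (\sum_(k | A k) u k).
Proof. by move=> uH; elim/big_rec: _ => [|k y _ yH]; [exact: H0|exact: siD]. Qed.

Lemma dotDl x y v : H x -> H y -> H v -> '[x + y, v] = '[x, v] + '[y, v].
Proof. by move=> xH yH vH; have := si_dot_lin HS 1 xH yH vH; rewrite scale1r mul1r. Qed.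

Lemma dotBl x y v : H x -> H y -> H v -> '[x - y, v] = '[x, v] - '[y, v].
Proof. by move=> xH yH vH; have := si_dot_lin HS (-1) xH yH vH; rewrite scaleN1r mulN1r. Qed.

Lemma dot0l v : H v -> '[0, v] = 0.
Proof. by move=> vH; have := dotBl H0 H0 vH; rewrite !subrr. Qed.

Lemma dotZl a x v : H x -> H v -> '[a *: x, v] = a * '[x, v].
Proof. by move=> xH vH; have := si_dot_lin HS a H0 xH vH; rewrite dot0l// !add0r. Qed.

Lemma dotDr x y v : H x -> H y -> H v -> '[v, x + y] = '[v, x] + '[v, y].
Proof. by move=> *; rewrite !(dotC v) dotDl. Qed.

Lemma dotBr x y v : H x -> H y -> H v -> '[v, x - y] = '[v, x] - '[v, y].
Proof. by move=> *; rewrite !(dotC v) dotBl. Qed.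

Lemma dot0r v : H v -> '[v, 0] = 0.
Proof. by move=> vH; rewrite dotC dot0l. Qed.

Lemma dot_suml (I : finType) (A : pred I) (u : I -> V) v : (forall k, H (u k)) -> H v ->
  '[\sum_(k | A k) u k, v] = \sum_(k | A k) '[u k, v].
Proof.
move=> uH vH.
suff [] : H (\sum_(k | A k) u k) /\ '[\sum_(k | A k) u k, v] = \sum_(k | A k) '[u k, v] by [].
elim/big_rec2: _ => [|k r y _ [yH yr]]; first by rewrite dot0l.
by rewrite dotDl// yr; split => //; exact: siD.
Qed.

Lemma dot_cauchy_schwarz x y : H x -> H y -> '[x, y] ^+ 2 <= '[x, x] * '[y, y].
Proof.
move=> xH yH.
have q a : 0 <= '[x, x] + a * '[x, y] *+ 2 + a ^+ 2 * '[y, y].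
  have zH := si_lin HS a xH yH.
  have := si_ge0 HS zH; rewrite (si_dot_lin HS)// (dotC x) (dotC y) !(si_dot_lin HS)//.
  by rewrite (dotC y x); move/le_trans; apply; rewrite le_eqVlt; apply/orP; left; apply/eqP; ring.
have [y0|yn0] := eqVneq '[y, y] 0.
  rewrite y0 mulr0; have [->|xyn0] := eqVneq '[x, y] 0; first by rewrite expr0n.
  (* When '[y, y] = 0 the nonnegative quadratic in a is affine; at this point it equals - '[x, x] -
     2, a contradiction. *)
  have := q (- (('[x, x] + 1) / '[x, y])).
  rewrite y0 mulr0 addr0 mulNr mulrVK ?unitfE// mulNrn mulr2n.
  by have := si_ge0 HS xH; lra.
have yp : 0 < '[y, y] by rewrite lt_neqAle eq_sym yn0 si_ge0.
have := q (- ('[x, y] / '[y, y])).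
rewrite -(ler_pM2r yp) mul0r.
rewrite [X in 0 <= X -> _](_ : _ = '[x, x] * '[y, y] - '[x, y] ^+ 2) ?subr_ge0//.
by field.
Qed.

Lemma sqr_nrm x : H x -> nrm x ^+ 2 = '[x, x].
Proof. by move=> xH; rewrite sqr_sqrtr// si_ge0. Qed.

Lemma normr_dot x y : H x -> H y -> `|'[x, y]| <= nrm x * nrm y.
Proof.
move=> xH yH; rewrite -(@ler_pXn2r _ 2)// ?nnegrE ?mulr_ge0 ?sqrtr_ge0//.
by rewrite real_normK ?num_real// exprMn !sqr_nrm// dot_cauchy_schwarz.
Qed.

Lemma nrmD x y : H x -> H y -> nrm (x + y) <= nrm x + nrm y.
Proof.
move=> xH yH; rewrite -(@ler_pXn2r _ 2)// ?nnegrE ?addr_ge0 ?sqrtr_ge0//.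
rewrite sqrrD !sqr_nrm//; last exact: siD.
rewrite !(dotDl, dotDr)//; try exact: siD.
rewrite (dotC y x); have := ler_norm '[x, y]; have := normr_dot xH yH; lra.
Qed.

Lemma nrmBC x y : H x -> H y -> nrm (x - y) = nrm (y - x).
Proof.
move=> xH yH; have xyH := siB xH yH; have yxH := siB yH xH; congr Num.sqrt.
by rewrite !dotBl// !dotBr// (dotC x y); ring.
Qed.

Lemma nrm_triangle x y v : H x -> H y -> H v ->
  nrm (x - v) <= nrm (x - y) + nrm (y - v).
Proof.
by move=> xH yH vH; have := nrmD (siB xH yH) (siB yH vH); rewrite addrA subrK.
Qed.

Lemma nrm_cvgD (T : Type) (F : set_system T) (FF : ProperFilter F) (u u' : T -> V) x x' :
  (\forall t \near F, H (u t)) -> (\forall t \near F, H (u' t)) -> H x -> H x' ->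
  nrm (u t - x) @[t --> F] --> (0 : R) -> nrm (u' t - x') @[t --> F] --> (0 : R) ->
  nrm (u t + u' t - (x + x')) @[t --> F] --> (0 : R).
Proof.
move=> uH uH' xH xH' ux ux'.
have c : nrm (u t - x) + nrm (u' t - x') @[t --> F] --> (0 + 0 : R) by exact: cvgD.
rewrite addr0 in c; apply: (squeeze_cvgr _ (@cvg_cst _ (0 : R) _ F FF) c).
apply: filterS2 uH uH' => t uH uH'; rewrite sqrtr_ge0 opprD addrACA.
by apply: nrmD; exact: siB.
Qed.

Lemma dot_null x y : H x -> H y -> '[x, x] = 0 -> '[x, y] = 0.
Proof.
move=> xH yH x0; have := dot_cauchy_schwarz xH yH.
by rewrite x0 mul0r => h; apply/eqP; rewrite -sqrf_eq0 eq_le h sqr_ge0.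
Qed.

Lemma ler_eps_mul (a b : R) : 0 <= b -> (forall e, 0 < e -> a <= e * b) -> a <= 0.
Proof.
move=> b0 ab; apply/ler_addgt0Pr => e e0; rewrite add0r.
have b1 : 0 < b + 1 by rewrite ltr_wpDl.
apply: le_trans (ab (e / (b + 1)) _) _; first by rewrite divr_gt0.
by rewrite mulrAC ler_pdivrMr// ler_wpM2l ?(ltW e0)// lerDl.
Qed.

Variables (heq : V -> V -> Prop) (domA : set V) (opA : V -> V).
Local Notation "x =H y" := (heq x y) (at level 70).

(** [sa_graph] identifies the graph of A with that of its adjoint: read forwards it is symmetry,
    read backwards it is a criterion for belonging to the domain. No link between [heq] and the
    seminorm is assumed; one is derived below. *)
Record self_adjoint : Prop := SelfAdjoint {
  sa_refl : forall x, x =H x;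
  sa_sym : forall x y, x =H y -> y =H x;
  sa_trans : forall x y v, x =H y -> y =H v -> x =H v;
  sa_sub0 : forall x y, x - y =H 0 <-> x =H y;
  sa_domA : forall x, domA x -> H x;
  sa_opA : forall x, domA x -> H (opA x);
  sa_dense : forall x, H x -> forall e : R, 0 < e -> exists2 y, domA y & nrm (x - y) < e;
  sa_graph : forall x y, H x -> H y ->
    ((domA x /\ opA x =H y) <-> (forall v, domA v -> '[opA v, x] = '[v, y])) }.

Hypothesis SA : self_adjoint.

Lemma opA_sym x v : domA x -> domA v -> '[opA v, x] = '[v, opA x].
Proof.
move=> xA vA; have [+ _] := sa_graph SA (sa_domA SA xA) (sa_opA SA xA).
by move=> /(_ (conj xA (sa_refl SA _)))/(_ _ vA).
Qed.

Lemma opA_char x y : H x -> H y ->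
  (forall v, domA v -> '[opA v, x] = '[v, y]) -> domA x /\ opA x =H y.
Proof. by move=> xH yH; have [_] := sa_graph SA xH yH. Qed.

Lemma opA0 : domA 0 /\ opA 0 =H 0.
Proof.
apply: opA_char; try exact: H0.
by move=> v vA; rewrite !dot0r//; [exact: (sa_domA SA)|exact: (sa_opA SA)].
Qed.

(* [A 0] and [d] represent the same vector, so [d] is orthogonal to the domain. *)
Lemma eqv0_null x : H x -> x =H 0 -> '[x, x] = 0.
Proof.
move=> xH x0; have [d0 A0] := opA0.
have Ax : opA 0 =H x by apply: (sa_trans SA) A0 _; exact: (sa_sym SA).
have orth := (sa_graph SA H0 xH).1 (conj d0 Ax).
apply/eqP; rewrite eq_le si_ge0// andbT.
apply: (ler_eps_mul (sqrtr_ge0 '[x, x])) => e e0.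
have [v vA xv] := sa_dense SA xH e0; have vH := sa_domA SA vA.
have xE : '[x, x] = '[x - v, x].
  by rewrite dotBl// -(orth v vA) dot0r ?subr0//; exact: (sa_opA SA).
rewrite [leLHS]xE; apply: le_trans (ler_norm _) _.
apply: le_trans (normr_dot (siB xH vH) xH) _.
by rewrite ler_wpM2r ?sqrtr_ge0// ltW.
Qed.

(** By Cauchy-Schwarz a null vector is orthogonal to everything, so the criterion applies with y =
    0. The description of the kernel later shows that such a vector is [heq] to 0. *)
Lemma null_kerA x : H x -> '[x, x] = 0 -> domA x /\ opA x =H 0.
Proof.
move=> xH x0; apply: opA_char => //.
move=> v vA; rewrite dotC dot_null//; last exact: (sa_opA SA).
by rewrite dot0r//; exact: (sa_domA SA).
Qed.

Lemma eqv_dotl x y v : H x -> H y -> H v -> x =H y -> '[x, v] = '[y, v].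
Proof.
move=> xH yH vH xy; apply: subr0_eq; rewrite -dotBl//.
have xyH := siB xH yH; apply: dot_null => //.
by apply: eqv0_null => //; exact/(sa_sub0 SA).
Qed.

Lemma opA_eqv x y : H y -> x =H y -> domA x -> domA y /\ opA y =H opA x.
Proof.
move=> yH xy xA; have xH := sa_domA SA xA; have AxH := sa_opA SA xA.
apply: opA_char => // v vA; have AvH := sa_opA SA vA.
by rewrite -(opA_sym xA vA) !(dotC (opA v)) (eqv_dotl yH xH AvH (sa_sym SA xy)).
Qed.

Lemma opAD x y : domA x -> domA y -> domA (x + y) /\ opA (x + y) =H opA x + opA y.
Proof.
move=> xA yA; have xH := sa_domA SA xA; have yH := sa_domA SA yA.
have AxH := sa_opA SA xA; have AyH := sa_opA SA yA.
apply: opA_char; try exact: siD.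
move=> v vA; have vH := sa_domA SA vA; have AvH := sa_opA SA vA.
by rewrite !dotDr// !(opA_sym _ vA).
Qed.

End semi_inner.

(** * Square summable sequences and closed spans *)

Definition sqsummable {R : realType} (a : nat -> R) :=
  exists M, forall n, \sum_(k < n) a k ^+ 2 <= M.

Lemma sqsummable_le {R : realType} (a a' : nat -> R) :
  (forall k, `|a k| <= `|a' k|) -> sqsummable a' -> sqsummable a.
Proof.
move=> aa' [M a'M]; exists M => n; apply: le_trans (a'M n); apply: ler_sum => k _.
rewrite -[a k ^+ 2]real_normK ?num_real// -[a' k ^+ 2]real_normK ?num_real//.
by rewrite lerXn2r ?nnegrE.
Qed.

Lemma sqsummableZ {R : realType} (c : R) (a : nat -> R) :
  sqsummable a -> sqsummable (fun k => c * a k).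
Proof.
move=> [M aM]; exists (c ^+ 2 * M) => n.
under eq_bigr do rewrite exprMn.
by rewrite -mulr_sumr ler_wpM2l// sqr_ge0.
Qed.

Section span_closure.
Context {R : realType} {V : lmodType R}.
Variables (H : set V) (dot : V -> V -> R).
Implicit Types (x y v : V) (F : set V).
Local Notation "''[' x , y ]" := (dot x y) (format "''[' x ,  y ]").
Local Notation nrm x := (Num.sqrt (dot x x)).

Definition span_closure (F : set V) : set V :=
  [set x | H x /\ forall r : R, 0 < r ->
     exists (m : nat) (c : 'I_m -> R) (v : 'I_m -> V),
       (forall k, F (v k)) /\ nrm (x - \sum_(k < m) c k *: v k) < r].

Hypothesis HS : semi_inner H dot.

Lemma span_closure_ortho F x v : F `<=` H -> H v ->
  (forall y, F y -> '[y, v] = 0) -> span_closure F x -> '[x, v] = 0.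
Proof.
move=> FH vH Fv [xH xF]; apply/eqP; rewrite -normr_le0.
apply: (ler_eps_mul (sqrtr_ge0 '[v, v])) => r r0.
have [m [c [u [uF xu]]]] := xF r r0.
have cuH k : H (c k *: u k) by apply: (siZ HS); exact/FH/uF.
have sH : H (\sum_(k < m) c k *: u k) by exact: (si_sum HS).
have dH := siB HS xH sH.
have -> : '[x, v] = '[x - \sum_(k < m) c k *: u k, v].
  rewrite (dotBl HS)// (dot_suml HS)// big1 ?subr0// => k _.
  by rewrite (dotZl HS)// ?Fv ?mulr0//; exact/FH/uF.
apply: le_trans (normr_dot HS dH vH) _.
by rewrite ler_wpM2r ?sqrtr_ge0// ltW.
Qed.

End span_closure.

(** * Expansions in eigenvectors and spectral projections *)

Section spectral.
Context {R : realType} {V : lmodType R}.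
Variables (H : set V) (dot : V -> V -> R).
Variables (heq : V -> V -> Prop) (domA : set V) (opA : V -> V).
Variables (e : bool -> nat -> V) (l : bool -> nat -> R).
Implicit Types (x y v w : V) (a : nat -> R) (b : bool).

Local Notation "''[' x , y ]" := (dot x y) (format "''[' x ,  y ]").
Local Notation nrm x := (Num.sqrt (dot x x)).
Local Notation "x =H y" := (heq x y) (at level 70).

Definition span_proj (F : set V) x : V :=
  xget 0 [set y | span_closure H dot F y /\
                  forall v : V, span_closure H dot F v -> '[x - y, v] = 0].

Definition dot_lim (u : nat -> V) : V :=
  xget 0 [set x | H x /\ nrm (u k - x) @[k --> \oo] --> (0 : R)].

Definition eigs b : set V := [set e b k | k in [set: nat]].
Local Notation Rp b := (span_closure H dot (eigs b)).
Local Notation pi b := (span_proj (eigs b)).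

Definition sgb b : R := if b then 1 else -1.

(** Eigenvectors are indexed by their sign and rank, so that the two halves of the spectrum are
    treated together. [ss_gap] keeps the eigenvalues away from 0, which makes A invertible and
    definite on each half; [ss_eqvP] makes [heq] the equality modulo null vectors. *)
Record spectral_system : Prop := SpectralSystem {
  ss_inner : semi_inner H dot;
  ss_adjoint : self_adjoint H dot heq domA opA;
  ss_eqvP : forall x y, H x -> H y -> x =H y <-> '[x - y, x - y] = 0;
  ss_complete : forall u : nat -> V, (forall k, H (u k)) ->
    (forall r : R, 0 < r -> exists N, forall k m, (N <= k)%N -> (N <= m)%N ->
       nrm (u k - u m) < r) ->
    exists2 x, H x & nrm (u k - x) @[k --> \oo] --> (0 : R);
  ss_eigen : forall b k, domA (e b k) /\ opA (e b k) =H l b k *: e b k;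
  ss_orthonormal : forall b k m, '[e b k, e b m] = (k == m)%:R;
  ss_orthogonal : forall b k m, '[e b k, e (~~ b) m] = 0;
  ss_gap : exists2 g : R, 0 < g & forall b k, g <= sgb b * l b k;
  ss_total : forall x, H x -> (forall b k, '[x, e b k] = 0) ->
    (forall y, domA y -> opA y =H 0 -> '[x, y] = 0) -> x =H 0 }.

Hypothesis SS : spectral_system.
Let HS := ss_inner SS.
Let SA := ss_adjoint SS.
Let H0 := si_zero HS.
Let dotC := si_sym HS.
Let eqv_dot x y v := @eqv_dotl _ _ _ _ HS _ _ _ SA x y v.

Lemma H_eig b k : H (e b k).
Proof. by have [/(sa_domA SA)] := ss_eigen SS b k. Qed.
Local Hint Resolve H_eig : core.

Lemma dot_opA_eig b k v : domA v -> '[opA v, e b k] = l b k * '[v, e b k].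
Proof.
move=> vA; have vH := sa_domA SA vA; have [eA eE] := ss_eigen SS b k.
rewrite (opA_sym SA eA vA) dotC (eqv_dot (sa_opA SA eA) (siZ HS _ (H_eig b k)) vH eE).
by rewrite (dotZl HS)// dotC.
Qed.

Definition eig_sum b a n : V := \sum_(k < n) a k *: e b k.

Lemma H_eig_sum b a n : H (eig_sum b a n).
Proof. by apply: (si_sum HS) => k; exact: (siZ HS). Qed.
Local Hint Resolve H_eig_sum : core.

Lemma dot_eig_sum b a n v : H v -> '[eig_sum b a n, v] = \sum_(k < n) a k * '[e b k, v].
Proof.
move=> vH; rewrite /eig_sum (dot_suml HS)//.
  by apply: eq_bigr => k _; rewrite (dotZl HS).
by move=> k; exact: (siZ HS).
Qed.

Lemma dot_eig_sum_eig b a n k : '[eig_sum b a n, e b k] = if (k < n)%N then a k else 0.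
Proof.
rewrite dot_eig_sum//; under eq_bigr do rewrite (ss_orthonormal SS).
case: ifPn => kn.
  rewrite (bigD1 (Ordinal kn))//= eqxx mulr1 big1 ?addr0// => m mk.
  by rewrite (_ : (m : nat) == k = false) ?mulr0//; exact: negbTE.
rewrite big1// => m _; rewrite (_ : (m : nat) == k = false) ?mulr0//.
by apply/negbTE; apply: contraNneq kn => <-.
Qed.

Lemma dot_eig_sum2 b a n m : (n <= m)%N -> '[eig_sum b a n, eig_sum b a m] = \sum_(k < n) a k ^+ 2.
Proof.
move=> nm; rewrite dot_eig_sum//; apply: eq_bigr => k _.
by rewrite dotC dot_eig_sum_eig (leq_trans (ltn_ord k) nm).
Qed.

Lemma eig_sum_dist b a n m : (n <= m)%N ->
  '[eig_sum b a m - eig_sum b a n, eig_sum b a m - eig_sum b a n] =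
  \sum_(k < m) a k ^+ 2 - \sum_(k < n) a k ^+ 2.
Proof.
move=> nm; have dH := siB HS (H_eig_sum b a m) (H_eig_sum b a n).
rewrite (dotBl HS)// !(dotBr HS)//.
rewrite (dotC (eig_sum b a m) (eig_sum b a n)) !dot_eig_sum2//.
by rewrite subrr subr0.
Qed.

Lemma bessel b x n : H x -> \sum_(k < n) '[x, e b k] ^+ 2 <= '[x, x].
Proof.
move=> xH; pose y := eig_sum b (fun k => '[x, e b k]) n.
have yH : H y by exact: H_eig_sum.
have yx : '[y, x] = \sum_(k < n) '[x, e b k] ^+ 2.
  by rewrite dot_eig_sum//; apply: eq_bigr => k _; rewrite dotC expr2.
have dH := siB HS xH yH; have := si_ge0 HS dH.
rewrite (dotBl HS)// !(dotBr HS)// (dotC x y) yx dot_eig_sum2//; lra.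
Qed.

Lemma sqsummable_coef b x : H x -> sqsummable (fun k => '[x, e b k]).
Proof. by move=> xH; exists '[x, x] => n; exact: bessel. Qed.

(** The squared distance of two partial sums is a difference of partial sums of a bounded
    nondecreasing series, so completeness applies. *)
Lemma riesz_fischer b a : sqsummable a -> exists2 x, H x &
  nrm (eig_sum b a n - x) @[n --> \oo] --> (0 : R).
Proof.
move=> [M aM]; apply: (ss_complete SS) => [k|r r0]; first exact: H_eig_sum.
pose q n := \sum_(k < n) a k ^+ 2.
have qnd : nondecreasing_seq q.
  by apply/nondecreasing_seqP => n; rewrite /q big_ord_recr/= lerDl sqr_ge0.
have cq : cvgn q.
  by apply: nondecreasing_is_cvgn => //; exists M => _ [n _ <-]; exact: aM.
have r20 : 0 < r ^+ 2 / 2 by rewrite divr_gt0// exprn_gt0.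
have /cvgrPdist_lt/(_ _ r20)[N _ qN] := cq.
exists N => k m; wlog km : k m / (k <= m)%N => [wl Nk Nm|Nk Nm].
  have [/wl|/ltnW/wl] := leqP k m; first exact.
  by move=> /(_ Nm Nk); rewrite (nrmBC HS).
rewrite (nrmBC HS)// -(@ltr_pXn2r _ 2)// ?nnegrE ?sqrtr_ge0 ?(ltW r0)//.
rewrite (sqr_nrm HS); last exact: (siB HS).
rewrite eig_sum_dist//.
have := qN k Nk; have := qN m Nm; rewrite /= !ltr_norml /q.
by move=> /andP[h1 h2] /andP[h3 h4]; lra.
Qed.

Lemma dot_cvg (u : nat -> V) x v : (forall n, H (u n)) -> H x -> H v ->
  nrm (u n - x) @[n --> \oo] --> (0 : R) -> '[u n, v] @[n --> \oo] --> '[x, v].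
Proof.
move=> uH xH vH ux; apply/cvgrPdist_le => r r0.
have : nrm (u n - x) * nrm v @[n --> \oo] --> (0 * nrm v : R) by exact: cvgMl.
rewrite mul0r => /cvgrPdist_le/(_ _ r0); apply: filterS => n.
rewrite sub0r normrN ger0_norm ?mulr_ge0 ?sqrtr_ge0//; apply: le_trans.
have dH := siB HS xH (uH n).
rewrite -(dotBl HS)//; apply: le_trans (normr_dot HS dH vH) _.
by rewrite (nrmBC HS).
Qed.

Lemma Rpi_H b x : Rp b x -> H x. Proof. by case. Qed.

Lemma Rpi_ortho b x v : Rp b x -> H v -> (forall k, '[e b k, v] = 0) -> '[x, v] = 0.
Proof.
move=> xR vH ev; apply: (span_closure_ortho HS _ vH _ xR) => _ [k _ <-]; first exact: H_eig.
exact: ev.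
Qed.

Lemma Rpi_lim b a x : H x -> nrm (eig_sum b a n - x) @[n --> \oo] --> (0 : R) -> Rp b x.
Proof.
move=> xH ax; split => // r r0.
have /cvgrPdist_lt/(_ _ r0)[N _ /(_ N (leqnn N))] := ax.
rewrite /= sub0r normrN ger0_norm ?sqrtr_ge0// => rN.
exists N, (fun k => a k), (fun k => e b k); split; first by move=> k; exists k.
by rewrite -/(eig_sum b a N) (nrmBC HS xH (H_eig_sum b a N)).
Qed.

Lemma lim_coef b a x : H x -> nrm (eig_sum b a n - x) @[n --> \oo] --> (0 : R) ->
  forall k, '[x, e b k] = a k.
Proof.
move=> xH ax k; have := dot_cvg (fun n => H_eig_sum b a n) xH (H_eig b k) ax.
move=> /cvg_lim <-//; apply: lim_near_cst => //.
by exists k.+1 => // n /= kn; rewrite dot_eig_sum_eig kn.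
Qed.

Lemma Rpi_coef b a : sqsummable a -> exists2 x, Rp b x & forall k, '[x, e b k] = a k.
Proof.
move=> sa; have [x xH ax] := riesz_fischer b sa.
by exists x; [exact: Rpi_lim ax|exact: lim_coef ax].
Qed.

Lemma Rpi_null b x y : Rp b x -> H y -> '[x - y, x - y] = 0 -> Rp b y.
Proof.
move=> [xH xR] yH xy; split => // r r0; have [m [c [u [uF xu]]]] := xR r r0.
exists m, c, u; split => //.
have sH : H (\sum_(k < m) c k *: u k).
  by apply: (si_sum HS) => k; apply: (siZ HS); have [j _ <-] := uF k.
apply: le_lt_trans (nrm_triangle HS yH xH sH) _.
by rewrite (nrmBC HS)// xy sqrtr0 add0r.
Qed.

(** The closed span is its own double orthogonal, a form in which stability under linear
    combinations is immediate. Conversely the vector y of the span with the coefficients of x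
    differs from x by a vector orthogonal to itself. *)
Lemma RpiP b x : Rp b x <->
  H x /\ forall v, H v -> (forall k, '[e b k, v] = 0) -> '[x, v] = 0.
Proof.
split=> [xR|[xH xo]].
  by split; [exact: Rpi_H xR|move=> v; exact: Rpi_ortho].
have [y yR yx] := Rpi_coef b (sqsummable_coef b xH).
have yH := Rpi_H yR; have dH := siB HS yH xH.
have eyx k : '[e b k, y - x] = 0.
  by rewrite (dotBr HS)// !(dotC (e b k)) yx subrr.
apply: (Rpi_null yR xH); rewrite (dotBl HS)//.
by rewrite (Rpi_ortho yR)// xo// subrr.
Qed.

Lemma RpiB b x y : Rp b x -> Rp b y -> Rp b (x - y).
Proof.
move=> xR yR; have xH := Rpi_H xR; have yH := Rpi_H yR.
apply/RpiP; split; first exact: (siB HS).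
by move=> v vH ev; rewrite (dotBl HS)// (Rpi_ortho xR)// (Rpi_ortho yR)// subrr.
Qed.

Lemma Rpi_eqv b x y : Rp b x -> H y -> x =H y -> Rp b y.
Proof.
move=> xR yH; have xH := Rpi_H xR; move/(ss_eqvP SS xH yH).
exact: Rpi_null.
Qed.

Lemma Rpi_eig b k : Rp b (e b k).
Proof. by apply/RpiP; split. Qed.

Lemma Rpi_ext b x y : Rp b x -> Rp b y -> (forall k, '[x, e b k] = '[y, e b k]) -> x =H y.
Proof.
move=> xR yR xy; have xH := Rpi_H xR; have yH := Rpi_H yR; apply/(ss_eqvP SS) => //.
apply: (Rpi_ortho (RpiB xR yR) (siB HS xH yH)) => k.
by rewrite (dotBr HS)// !(dotC (e b k)) xy subrr.
Qed.

Lemma Rpi_opposite b x k : Rp b x -> '[x, e (~~ b) k] = 0.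
Proof. by move=> xR; apply: (Rpi_ortho xR) => // m; exact: (ss_orthogonal SS). Qed.

Lemma Rpi_cvg b x : Rp b x ->
  nrm (eig_sum b (fun k => '[x, e b k]) n - x) @[n --> \oo] --> (0 : R).
Proof.
move=> xR; have xH := Rpi_H xR.
have [y yH ay] := riesz_fischer b (sqsummable_coef b xH).
have yR := Rpi_lim yH ay.
have yx : y =H x by apply: (Rpi_ext yR xR) => k; rewrite (lim_coef yH ay).
apply: cvg_trans ay; apply: near_eq_cvg; apply: nearW => n.
have sH := H_eig_sum b (fun k => '[x, e b k]) n; congr Num.sqrt.
have dyH := siB HS sH yH; have dxH := siB HS sH xH.
have dd : eig_sum b (fun k => '[x, e b k]) n - y =H eig_sum b (fun k => '[x, e b k]) n - x.
  apply/(ss_eqvP SS) => //; rewrite opprB addrC addrA subrK.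
  by apply/(ss_eqvP SS) => //; exact: (sa_sym SA).
by rewrite (eqv_dot dyH dxH dyH dd) dotC (eqv_dot dyH dxH dxH dd).
Qed.

Lemma parseval b x v : Rp b x -> H v ->
  \sum_(k < n) '[x, e b k] * '[v, e b k] @[n --> \oo] --> '[x, v].
Proof.
move=> xR vH; have xH := Rpi_H xR.
have [y yH ay] := riesz_fischer b (sqsummable_coef b xH).
have yR := Rpi_lim yH ay.
have xy : x =H y by apply: (Rpi_ext xR yR) => k; rewrite (lim_coef yH ay).
rewrite (eqv_dot xH yH vH xy).
have := dot_cvg (fun n => H_eig_sum b _ n) yH vH ay.
under eq_fun do rewrite dot_eig_sum//.
by under eq_fun do under eq_bigr do rewrite (dotC (e _ _) v).
Qed.

Lemma pi_P b x : H x -> Rp b (pi b x) /\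
  forall v, Rp b v -> '[x - pi b x, v] = 0.
Proof.
move=> xH; suff ex : exists y, Rp b y /\ forall v, Rp b v -> '[x - y, v] = 0.
  exact: (xgetPex 0 ex).
have [y yR yx] := Rpi_coef b (sqsummable_coef b xH); exists y; split => // v vR.
have yH := Rpi_H yR; have dH := siB HS xH yH.
rewrite dotC; apply: (Rpi_ortho vR dH) => k.
by rewrite (dotBr HS)// !(dotC (e b k)) yx subrr.
Qed.

Lemma Rpi_pi b x : H x -> Rp b (pi b x).
Proof. by move=> /(pi_P b)[]. Qed.

Lemma H_pi b x : H x -> H (pi b x).
Proof. by move=> /(Rpi_pi b)/Rpi_H. Qed.

Lemma dot_pi b x v : H x -> Rp b v -> '[pi b x, v] = '[x, v].
Proof.
move=> xH vR; have [_ /(_ v vR)] := pi_P b xH; have vH := Rpi_H vR.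
by rewrite (dotBl HS)//; [move/subr0_eq|exact: H_pi].
Qed.

Lemma dot_pi_eig b x k : H x -> '[pi b x, e b k] = '[x, e b k].
Proof. by move=> xH; rewrite dot_pi//; exact: Rpi_eig. Qed.

Lemma pi_id b x : Rp b x -> pi b x =H x.
Proof.
move=> xR; have xH := Rpi_H xR; apply: (Rpi_ext (Rpi_pi b xH) xR) => k.
exact: dot_pi_eig.
Qed.

(** This is an equality, not just [heq]: x and y define the same set of candidates, in which [xget]
    picks the same element. Every operator starting with a projection inherits it. *)
Lemma pi_eqv b x y : H x -> H y -> x =H y -> pi b x = pi b y.
Proof.
move=> xH yH xy; rewrite /span_proj; congr xget.
by apply/seteqP; split => v [vR xv]; split => // w wR;
  have vH := Rpi_H vR; have wH := Rpi_H wR; rewrite -(xv w wR) !(dotBl HS)//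
  (eqv_dot xH yH wH xy).
Qed.

(** The gap makes a itself square summable, so w exists, and so does y with coefficients l a. By
    Parseval '[A v, w] = '[v, y] for all v in the domain, and self-adjointness puts w in the domain
    with A w = y. *)
Lemma domA_coef b a : sqsummable (fun k => l b k * a k) ->
  exists w, [/\ Rp b w, domA w, Rp b (opA w) & forall k, '[w, e b k] = a k].
Proof.
move=> sla; have [g g0 gl] := ss_gap SS.
have lg k : g <= `|l b k|.
  apply: le_trans (gl b k) _; rewrite /sgb; case: b {sla} => /=; rewrite ?mul1r ?mulN1r ?ler_norm//.
  by rewrite -normrN ler_norm.
have sa : sqsummable a.
  apply: sqsummable_le (sqsummableZ g^-1 sla) => k.
  rewrite !normrM normfV (gtr0_norm g0) mulrA ler_peMl// ler_pdivlMl// mulr1.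
  exact: lg.
have [w wR wa] := Rpi_coef b sa; have wH := Rpi_H wR.
have [y yR ya] := Rpi_coef b sla; have yH := Rpi_H yR.
have [wA wy] : domA w /\ opA w =H y.
  apply: (opA_char SA) => // v vA; have vH := sa_domA SA vA; have AvH := sa_opA SA vA.
  have c1 := parseval wR AvH; have c2 := parseval yR vH.
  rewrite (dotC _ w) (dotC v).
  apply: (cvg_unique (@norm_hausdorff _ _) c1 (_ : _ --> _)).
  under eq_fun do under eq_bigr do rewrite wa dot_opA_eig// mulrA (mulrC (a _)) -ya.
  exact: c2.
exists w; split => //; apply: Rpi_eqv yR (sa_opA SA wA) _; exact: (sa_sym SA).
Qed.

(** The numbers l k '[x, e k] are the coefficients of A x, hence square summable by Bessel. *)
Lemma domA_pi b x : domA x -> domA (pi b x) /\ Rp b (opA (pi b x)).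
Proof.
move=> xA; have xH := sa_domA SA xA.
have [|w [wR wA AwR wx]] := @domA_coef b (fun k => '[x, e b k]).
  have [M sM] := sqsummable_coef b (sa_opA SA xA); exists M => n.
  by under eq_bigr do rewrite -dot_opA_eig//.
have pR := Rpi_pi b xH; have pH := Rpi_H pR.
have wp : w =H pi b x by apply: (Rpi_ext wR pR) => k; rewrite wx dot_pi_eig.
have [pA Apw] := opA_eqv HS SA pH wp wA; split => //.
apply: Rpi_eqv AwR (sa_opA SA pA) _; exact: (sa_sym SA).
Qed.

Lemma dot_opA_pi b x k : domA x -> '[opA (pi b x), e b k] = l b k * '[x, e b k].
Proof.
move=> xA; have [pA _] := domA_pi b xA.
by rewrite dot_opA_eig// dot_pi_eig//; exact: (sa_domA SA).
Qed.

Lemma opA_inv b x : Rp b x -> exists w, [/\ Rp b w, domA w & opA w =H x].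
Proof.
move=> xR; have xH := Rpi_H xR.
have ln0 k : l b k != 0.
  have [g g0 gl] := ss_gap SS; have := lt_le_trans g0 (gl b k).
  by case: eqP => // ->; rewrite mulr0 ltxx.
have [|w [wR wA AwR wx]] := @domA_coef b (fun k => '[x, e b k] / l b k).
  have [M sM] := sqsummable_coef b xH; exists M => n.
  by under eq_bigr do rewrite mulrC divfK//.
exists w; split => //; apply: (Rpi_ext AwR xR) => k.
by rewrite dot_opA_eig// wx mulrC divfK.
Qed.

(** By Parseval the form is the sum of sgb b * l k * '[w, e k] ^+ 2, so it dominates g times the
    square of each coefficient, g being the gap. *)
Lemma opA_definite b w : Rp b w -> domA w -> sgb b * '[opA w, w] <= 0 -> w =H 0.
Proof.
move=> wR wA ww; have wH := sa_domA SA wA; have AwH := sa_opA SA wA.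
have [g g0 gl] := ss_gap SS.
have R0 : Rp b 0 by apply/RpiP; split => // v vH _; rewrite (dot0l HS).
apply: (Rpi_ext wR R0) => k; rewrite (dot0l HS)//.
have cw : sgb b * \sum_(k < n) '[w, e b k] * '[opA w, e b k] @[n --> \oo] -->
    (sgb b * '[w, opA w] : R).
  by apply: cvgMr; exact: parseval.
have gw n : \sum_(k < n) g * '[w, e b k] ^+ 2 <=
    sgb b * \sum_(k < n) '[w, e b k] * '[opA w, e b k].
  rewrite mulr_sumr; apply: ler_sum => j _; rewrite dot_opA_eig//.
  rewrite [leRHS](_ : _ = sgb b * l b j * '[w, e b j] ^+ 2); last by ring.
  by rewrite ler_wpM2r ?sqr_ge0.
have wk : g * '[w, e b k] ^+ 2 <= 0.
  rewrite dotC in ww; apply: le_trans ww; apply: (cvgr_to_ge cw); exists k.+1 => // n /= kn.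
  apply: le_trans (gw n); rewrite (bigD1 (Ordinal kn))//= lerDl sumr_ge0// => j _.
  by rewrite mulr_ge0 ?(ltW g0)// sqr_ge0.
apply/eqP; rewrite -sqrf_eq0 eq_le sqr_ge0 andbT.
by move: wk; rewrite pmulr_rle0.
Qed.

Definition ker x := domA x /\ opA x =H 0.

Lemma Rpi_ker b x y : Rp b x -> ker y -> '[x, y] = 0.
Proof.
move=> xR [yA Ay0]; have yH := sa_domA SA yA; apply: (Rpi_ortho xR yH) => k.
have [g g0 gl] := ss_gap SS; have := lt_le_trans g0 (gl b k).
have := dot_opA_eig b k yA.
rewrite (eqv_dot (sa_opA SA yA) H0 (H_eig b k) Ay0) (dot0l HS)// dotC => /esym/eqP.
by rewrite mulf_eq0 => /orP[/eqP->|/eqP//]; rewrite mulr0 ltxx.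
Qed.

(** The vector of the opposite range with the coefficients of x differs from x by a vector
    orthogonal to both halves and to the kernel, hence zero by totality. *)
Lemma opposite_Rpi b x : H x -> (forall k, '[x, e b k] = 0) ->
  (forall y, ker y -> '[x, y] = 0) -> Rp (~~ b) x.
Proof.
move=> xH xe xk; have [y yR yx] := Rpi_coef (~~ b) (sqsummable_coef (~~ b) xH).
have yH := Rpi_H yR; apply: (Rpi_eqv yR xH).
have dH := siB HS yH xH.
apply/(ss_eqvP SS) => //; apply: (eqv0_null HS SA) => //.
apply: (ss_total SS) => // [b' k|v vA Av0].
  rewrite (dotBl HS)//; have [->|b'b] := eqVneq b' b.
    by rewrite xe subr0; have := Rpi_opposite k yR; rewrite negbK.
  have -> : b' = ~~ b by move: b'b; case: (b); case: (b').
  by rewrite yx subrr.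
have vk : ker v by [].
by rewrite (dotBl HS)// ?(Rpi_ker yR vk) ?xk ?subrr//; exact: (sa_domA SA).
Qed.

(** Here y = A w with w in the opposite range, where the sign condition and definiteness give w = 0.
    This leaves a condition on '[y, w] alone, to be checked from the form of y and of the
    operator. *)
Lemma opposite_eqv0 b y : H y -> (forall k, '[y, e b k] = 0) ->
  (forall v, ker v -> '[y, v] = 0) ->
  (forall w, domA w -> opA w =H y -> sgb (~~ b) * '[y, w] <= 0) -> y =H 0.
Proof.
move=> yH ye yk yw; have [w [wR wA wy]] := opA_inv (opposite_Rpi yH ye yk).
have wH := sa_domA SA wA; have AwH := sa_opA SA wA.
have w0 : w =H 0.
  by apply: (opA_definite wR wA); rewrite (eqv_dot AwH yH wH wy) yw.
have [_ A0w] := opA_eqv HS SA H0 w0 wA.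
have [_ A00] := opA0 HS SA.
apply: (sa_trans SA) (sa_sym SA wy) _.
exact: (sa_trans SA) (sa_sym SA A0w) A00.
Qed.

Lemma eqv_ext x y : H x -> H y -> (forall v, H v -> '[x, v] = '[y, v]) -> x =H y.
Proof.
move=> xH yH xy; apply/(ss_eqvP SS) => //.
by rewrite (dotBl HS)// ?xy ?subrr//; exact: (siB HS).
Qed.

Lemma eig_neq0 b k : l b k != 0.
Proof.
have [g g0 gl] := ss_gap SS; have := lt_le_trans g0 (gl b k).
by case: eqP => // ->; rewrite mulr0 ltxx.
Qed.

(** A is inverted on each half separately and the solutions are added; each projection ignores the
    other half because the halves are orthogonal. *)
Lemma pi_solve (z : bool -> V) : (forall b, Rp b (z b)) ->
  exists x, [/\ domA x, forall v, ker v -> '[x, v] = 0 & forall b, opA (pi b x) =H z b].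
Proof.
move=> zR; have [w1 [w1R w1A w1z]] := opA_inv (zR true).
have [w2 [w2R w2A w2z]] := opA_inv (zR false).
have w1H := Rpi_H w1R; have w2H := Rpi_H w2R.
have [wA _] := opAD HS SA w1A w2A; have wH := siD HS w1H w2H.
exists (w1 + w2); split => //.
  move=> v vk; have vH := sa_domA SA vk.1.
  by rewrite (dotDl HS)// (Rpi_ker w1R vk) (Rpi_ker w2R vk) addr0.
move=> b; have [pA pR] := domA_pi b wA; apply: (Rpi_ext pR (zR b)) => k.
have Az w : domA w -> opA w =H z b -> l b k * '[w, e b k] = '[z b, e b k].
  move=> uA uz; rewrite -dot_opA_eig//.
  exact: (eqv_dot (sa_opA SA uA) (Rpi_H (zR b)) (H_eig b k) uz).
rewrite dot_opA_pi// (dotDl HS)//; case: b {pA pR} Az => Az.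
  by rewrite (Rpi_opposite k w2R) addr0 Az.
by rewrite (Rpi_opposite k w1R) add0r Az.
Qed.

(** * Compressions of P, and the vectors of the form P z *)

Variable P : V -> V.

Record orth_projector : Prop := OrthProjector {
  pr_H : forall x, H x -> H (P x);
  pr_sym : forall x y, H x -> H y -> '[P x, y] = '[x, P y];
  pr_idem : forall x, P (P x) = P x }.

Hypothesis PP : orth_projector.

Definition compression b x := pi b (P (pi b x)).

Definition compression_inv b y := xget 0 [set x | Rp b x /\ compression b x =H y].

Hypothesis compression_bij : forall b y, Rp b y -> exists2 x,
  Rp b x /\ compression b x =H y &
  forall x', Rp b x' -> compression b x' =H y -> x' =H x.

Definition invB b x := pi b (compression_inv b (pi b x)).

Lemma compression_invP b x : H x ->
  Rp b (compression_inv b (pi b x)) /\ compression b (compression_inv b (pi b x)) =H pi b x.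
Proof.
move=> xH; have [y yP _] := compression_bij (Rpi_pi b xH).
by have ex : exists y, Rp b y /\ compression b y =H pi b x;
  [exists y|exact: (xgetPex 0 ex)].
Qed.

Lemma Rpi_invB b x : H x -> Rp b (invB b x).
Proof. by move=> /(compression_invP b)[/Rpi_H zH _]; exact: Rpi_pi. Qed.

(** This weak form characterizes [invB b x] within the range (uniqueness is [invB_unique]) and
    replaces its definition from here on. *)
Lemma dot_invB b x v : H x -> Rp b v -> '[P (invB b x), v] = '[x, v].
Proof.
move=> xH vR; have vH := Rpi_H vR; have [/Rpi_H zH zx] := compression_invP b xH.
have pzH := pr_H PP (H_pi b zH).
rewrite -(dot_pi xH vR) -(eqv_dot (H_pi b pzH) (H_pi b xH) vH zx).
by rewrite (dot_pi pzH vR).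
Qed.

Lemma invB_unique b x z : H x -> Rp b z ->
  (forall v, Rp b v -> '[P z, v] = '[x, v]) -> invB b x =H z.
Proof.
move=> xH zR zx; have [y _ yu] := compression_bij (Rpi_pi b xH).
have cx w : Rp b w -> (forall v, Rp b v -> '[P w, v] = '[x, v]) -> w =H y.
  move=> wR wx; have wH := Rpi_H wR; have pwH := H_pi b wH; have PpwH := pr_H PP pwH.
  apply: (yu _ wR); apply: (Rpi_ext (Rpi_pi b PpwH) (Rpi_pi b xH)) => k.
  have eR := Rpi_eig b k.
  rewrite !dot_pi// (pr_sym PP)// -(wx _ eR) (pr_sym PP)//.
  exact: (eqv_dot pwH wH (pr_H PP (H_eig b k)) (pi_id wR)).
apply: (sa_trans SA) (cx _ (Rpi_invB b xH) _) _.
  by move=> v vR; exact: dot_invB.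
exact: (sa_sym SA (cx _ zR zx)).
Qed.

Lemma invB_P b z : Rp b z -> invB b (P z) =H z.
Proof. by move=> zR; apply: invB_unique => //; exact: (pr_H PP (Rpi_H zR)). Qed.

Lemma invB_eqv b x y : H x -> H y -> x =H y -> invB b x = invB b y.
Proof. by move=> xH yH xy; rewrite /invB (pi_eqv b xH yH xy). Qed.

Lemma P_Rpi_inj b x y : Rp b x -> Rp b y -> P x =H P y -> x =H y.
Proof.
move=> xR yR xy; apply: (sa_trans SA) (sa_sym SA (invB_P xR)) _.
by rewrite (invB_eqv b (pr_H PP (Rpi_H xR)) (pr_H PP (Rpi_H yR)) xy); exact: invB_P.
Qed.

(** P is injective on each range, having [invB] as a left inverse, so A (pi b x) is determined; its
    coefficients are those of x times nonzero eigenvalues. *)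
Lemma eqv_of_unknowns x y : domA x -> domA y ->
  (forall v, ker v -> '[x, v] = 0) -> (forall v, ker v -> '[y, v] = 0) ->
  (forall b, P (opA (pi b x)) =H P (opA (pi b y))) -> x =H y.
Proof.
move=> xA yA xk yk xy; have xH := sa_domA SA xA; have yH := sa_domA SA yA.
have dH := siB HS xH yH; apply/(sa_sub0 SA); apply: (ss_total SS) => // [b k|v vA v0].
  have [_ pxR] := domA_pi b xA; have [_ pyR] := domA_pi b yA.
  have Axy := P_Rpi_inj pxR pyR (xy b).
  have := eqv_dot (Rpi_H pxR) (Rpi_H pyR) (H_eig b k) Axy.
  rewrite !dot_opA_pi// => /(mulfI (eig_neq0 b k)) exy.
  by rewrite (dotBl HS)// exy subrr.
have vk : ker v by [].
by rewrite (dotBl HS)// ?xk ?yk ?subrr//; exact: (sa_domA SA).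
Qed.

Variable Phi : V.
Hypotheses (PhiH : H Phi) (PPhi : P Phi = Phi).

Definition defect b := Phi - P (invB b Phi).

Let PBH b : H (P (invB b Phi)).
Proof. exact: (pr_H PP (Rpi_H (Rpi_invB b PhiH))). Qed.

Lemma H_defect b : H (defect b).
Proof. exact: (siB HS PhiH (PBH b)). Qed.

(** Moving P across the product, both terms of the difference become '[z, Phi], the second one by
    the weak form of [invB b Phi]. *)
Lemma dot_defect b z : Rp b z -> '[P z, defect b] = 0.
Proof.
move=> zR; have zH := Rpi_H zR; have PzH := pr_H PP zH; have BR := Rpi_invB b PhiH.
have PBb := PBH b; rewrite (dotBr HS)// !(pr_sym PP)//.
by rewrite (pr_idem PP) PPhi (dotC z (P _)) dot_invB// (dotC Phi) subrr.
Qed.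

(** The only candidate is z = [invB b X], and Y stands for the remainder X - P z. The hypothesis
    lists what is known of it: Y is fixed by P, orthogonal to the range, and its pairing with Phi is
    prescribed. *)
Lemma P_Rpi_surj b X : H X -> P X = X ->
  (forall Y, H Y -> P Y =H Y -> (forall k, '[Y, e b k] = 0) ->
    '[Y, Phi] = '[X, defect b] -> Y =H 0) ->
  exists2 z, Rp b z & P z =H X.
Proof.
move=> XH PX XY; have BXR := Rpi_invB b XH; have BXH := Rpi_H BXR.
have PBXH := pr_H PP BXH.
exists (invB b X) => //; apply: (sa_sym SA); apply/(sa_sub0 SA).
have YH := siB HS XH PBXH; apply: XY => //.
- apply: eqv_ext => // [|v vH]; first exact: (pr_H PP).
  have PvH := pr_H PP vH.
  rewrite (pr_sym PP)// !(dotBl HS)// -!(pr_sym PP)//.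
  by rewrite (pr_idem PP) PX.
- by move=> k; rewrite (dotBl HS)// dot_invB ?subrr//; exact: Rpi_eig.
have BPR := Rpi_invB b PhiH; have BPH := Rpi_H BPR; have PBPH := PBH b.
rewrite (dotBl HS)// (dotBr HS)//; congr (_ - _).
(* Symmetry of P B: the weak forms of B Phi and of B X are tested against each other. *)
rewrite (pr_sym PP)// PPhi dotC -(dot_invB PhiH BXR) (pr_sym PP)//.
by rewrite dotC (dot_invB XH BPR) -{1}PX (pr_sym PP).
Qed.

(** * Exponentials of A and derivatives of eigenvector series *)

Variable L : R.
Hypothesis L_ge0 : 0 <= L.

Definition expf b x := dot_lim (fun m => \sum_(k < m)
  (expR ((if b then - 2 else 2) * L * l b k) * '[x, e b k]) *: e b k).

Lemma expR_mul_le1 (s : R) b k : sgb b * s <= 0 -> expR (l b k * s) <= 1.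
Proof.
move=> s0; have [g g0 gl] := ss_gap SS; have lg := lt_le_trans g0 (gl b k).
rewrite -expR0 ler_expR; move: s0 lg; rewrite /sgb; move: (l b k) => t.
case: b {gl} => /=; rewrite ?mul1r ?mulN1r ?oppr_le0 ?oppr_gt0 => s0 t0.
  by rewrite pmulr_rle0.
by rewrite nmulr_rle0.
Qed.

Lemma sgb_coef b : sgb b * ((if b then - 2 else 2) * L) <= 0.
Proof. by rewrite /sgb; case: b => /=; have := L_ge0; lra. Qed.

(** On the range of sign b the factors are at most 1, so the damped coefficients stay square
    summable and the limit chosen in [expf] exists. *)
Lemma expfP b x : H x -> Rp b (expf b x) /\ forall k,
  '[expf b x, e b k] = expR ((if b then - 2 else 2) * L * l b k) * '[x, e b k].
Proof.
move=> xH; pose a k := expR ((if b then - 2 else 2) * L * l b k) * '[x, e b k].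
have sa : sqsummable a.
  apply: (sqsummable_le _ (sqsummable_coef b xH)) => k; rewrite normrM ler_piMl//.
  by rewrite ger0_norm ?expR_ge0// mulrC expR_mul_le1// sgb_coef.
have ex : exists y, H y /\ nrm (eig_sum b a n - y) @[n --> \oo] --> (0 : R).
  by have [y yH ay] := riesz_fischer b sa; exists y.
have [yH ay] : H (expf b x) /\ nrm (eig_sum b a n - expf b x) @[n --> \oo] --> (0 : R).
  exact: (xgetPex 0 ex).
by split; [exact: Rpi_lim ay|exact: lim_coef ay].
Qed.

Lemma expf_invB_P b z : Rp b z -> Rp b (expf b (invB b (P z))) /\ forall k,
  '[expf b (invB b (P z)), e b k] = expR ((if b then - 2 else 2) * L * l b k) * '[z, e b k].
Proof.
move=> zR; have BH := Rpi_H (Rpi_invB b (pr_H PP (Rpi_H zR))).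
have [eR ek] := expfP b BH; split => // k; rewrite ek.
by rewrite (eqv_dot BH (Rpi_H zR) (H_eig b k) (invB_P zR)).
Qed.

Lemma expR_dist (u v : R) : u <= 0 -> v <= 0 -> `|expR u - expR v| <= `|u - v|.
Proof.
wlog uv : u v / u <= v => [wl u0 v0|u0 v0].
  by have [/wl|/ltW/wl] := leP u v; [exact|rewrite distrC (distrC u); exact].
rewrite !ler0_norm ?subr_le0 ?ler_expR// !opprB.
have -> : expR u = expR (u - v) * expR v by rewrite -expRD subrK.
have h := expR_ge1Dx (u - v).
have v1 : expR v <= 1 by rewrite -expR0 ler_expR.
have v2 := expR_gt0 v; have uv' : 0 <= v - u by rewrite subr_ge0.
move: (expR v) (expR (u - v)) h v1 v2 => E1 E2 h v1 v2.
have h1 : 0 <= E1 * (E2 - (1 + (u - v))) by rewrite mulr_ge0 ?subr_ge0// ltW.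
have h2 : 0 <= (1 - E1) * (v - u) by rewrite mulr_ge0 ?subr_ge0.
nra.
Qed.

(** The filter is only required to approach z0 while avoiding it, which covers the one-sided limits
    at both end points. *)
Lemma cvg_expR_quotient (F : set_system R) (FF : ProperFilter F) (z0 c d : R) :
  (forall r : R, 0 < r -> \forall z \near F, `|z - z0| < r /\ z != z0) ->
  (z - z0)^-1 * (expR (c * (z - d)) - expR (c * (z0 - d))) @[z --> F] -->
    (c * expR (c * (z0 - d)) : R).
Proof.
move=> Fz0; pose f (z : R) : R := expR (c * (z - d)).
have df : is_derive z0 (1 : R) f (expR (c * (z0 - d)) * c).
  apply: (@is_derive1_comp R expR (fun z => c * (z - d))).
  have -> : (fun z : R => c * (z - d)) = (c \*: (id - cst d)) by [].
  have := is_deriveZ c (is_deriveB (is_derive_id z0 (1 : R)) (is_derive_cst d z0 (1 : R))).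
  by move/is_derive_eq; apply; rewrite subr0 /GRing.scale/= mulr1.
have [cf fE] := df.
have sF : (z - z0) @[z --> F] --> 0^'.
  move=> A [r /= r0 rA]; apply: filterS (Fz0 r r0) => z [zr zn].
  by apply: rA; rewrite /= ?sub0r ?normrN// subr_eq0.
have := cvg_comp _ _ sF cf.
rewrite -[lim _]/('D_1 f z0) fE mulrC.
apply: cvg_trans; apply: near_eq_cvg; apply: nearW => z /=.
by rewrite /GRing.scale/= mulr1 subrK.
Qed.

Lemma sum_ord_split (f : nat -> R) N n : (N <= n)%N ->
  \sum_(k < n) f k = \sum_(k < N) f k + \sum_(k < n - N) f (N + k)%N.
Proof.
move=> Nn; have [m ->] : exists m, n = (N + m)%N by exists (n - N)%N; rewrite subnKC.
by rewrite big_split_ord addKn.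
Qed.

(* Dominated convergence: since |exp u - exp v| <= |u - v| for u, v <= 0, the
   coefficients of the difference quotients are dominated by those of A x. *)
Lemma eig_expansion_derive b x (F : set_system R) (FF : ProperFilter F) (z0 d : R) :
  domA x -> sgb b * (z0 - d) <= 0 ->
  (forall r : R, 0 < r -> \forall z \near F, `|z - z0| < r /\ z != z0) ->
  (\forall z \near F, sgb b * (z - d) <= 0) ->
  exists (S : R -> V) (D : V),
    [/\ forall z, sgb b * (z - d) <= 0 -> Rp b (S z) /\
          forall k, '[S z, e b k] = '[x, e b k] * expR (l b k * (z - d)),
        Rp b D, forall k, '[D, e b k] = expR (l b k * (z0 - d)) * '[opA (pi b x), e b k] &
        nrm ((z - z0)^-1 *: (S z - S z0) - D) @[z --> F] --> (0 : R)].
Proof.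
move=> xA z0d Fz0 Fd; have xH := sa_domA SA xA.
pose c k := '[opA (pi b x), e b k].
have cE k : c k = l b k * '[x, e b k] by exact: dot_opA_pi.
have sc : sqsummable c by apply: sqsummable_coef; exact: Rpi_H (domA_pi b xA).2.
have sS z : sgb b * (z - d) <= 0 -> sqsummable (fun k => '[x, e b k] * expR (l b k * (z - d))).
  move=> zd; apply: (sqsummable_le _ (sqsummable_coef b xH)) => k.
  by rewrite normrM ler_piMr// ger0_norm ?expR_ge0// expR_mul_le1.
(* On the wrong side of d the exponentials grow and such a v may fail to exist; the default 0 is
   harmless there, S being used only where the exponents are nonpositive. *)
pose S z := xget 0 [set v | Rp b v /\
  forall k, '[v, e b k] = '[x, e b k] * expR (l b k * (z - d))].
have SP z : sgb b * (z - d) <= 0 -> Rp b (S z) /\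
    forall k, '[S z, e b k] = '[x, e b k] * expR (l b k * (z - d)).
  move=> zd; have [v vR vk] := Rpi_coef b (sS z zd).
  have ex : exists v, Rp b v /\ forall k, '[v, e b k] = '[x, e b k] * expR (l b k * (z - d)).
    by exists v.
  exact: (xgetPex 0 ex).
have [|D DR Dk] := @Rpi_coef b (fun k => expR (l b k * (z0 - d)) * c k).
  apply: (sqsummable_le _ sc) => k.
  by rewrite normrM ler_piMl// ger0_norm ?expR_ge0// expR_mul_le1.
exists S, D; split => //.
pose q z := (z - z0)^-1 *: (S z - S z0) - D.
pose r z k := (z - z0)^-1 * ('[x, e b k] * expR (l b k * (z - d)) -
   '[x, e b k] * expR (l b k * (z0 - d))) - expR (l b k * (z0 - d)) * c k.
have [S0R S0k] := SP z0 z0d.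
have qR z : sgb b * (z - d) <= 0 -> Rp b (q z) /\ forall k, '[q z, e b k] = r z k.
  move=> zd; have [SR Sk] := SP z zd.
  have SH := Rpi_H SR; have S0H := Rpi_H S0R; have DH := Rpi_H DR.
  have dH := siB HS SH S0H; have sdH := siZ HS (z - z0)^-1 dH; split.
    apply/RpiP; split; first exact: (siB HS).
    move=> v vH vk; rewrite (dotBl HS)// (dotZl HS)// (Rpi_ortho (RpiB SR S0R))//.
    by rewrite (Rpi_ortho DR)// mulr0 subrr.
  by move=> k; rewrite (dotBl HS)// (dotZl HS)// (dotBl HS)// Sk S0k Dk.
have rb z k : z != z0 -> sgb b * (z - d) <= 0 -> `|r z k| <= 2 * `|c k|.
  move=> zz0 zd; rewrite /r -mulrBr; apply: le_trans (ler_normB _ _) _.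
  rewrite mulr2n mulrDl mul1r; apply: lerD; last first.
    by rewrite normrM ler_piMl// ger0_norm ?expR_ge0// expR_mul_le1.
  have zn0 : 0 < `|z - z0| by rewrite normr_gt0 subr_eq0.
  rewrite normrM normfV ler_pdivrMl// normrM cE normrM mulrA [leRHS]mulrC ler_wpM2l//.
  apply: le_trans (expR_dist _ _) _.
  - by have := expR_mul_le1 k zd; rewrite -expR0 ler_expR.
  - by have := expR_mul_le1 k z0d; rewrite -expR0 ler_expR.
  - by rewrite -mulrBr opprB addrA subrK normrM mulrC.
have rcvg k : r z k @[z --> F] --> (0 : R).
  have c1 : '[x, e b k] * ((z - z0)^-1 * (expR (l b k * (z - d)) - expR (l b k * (z0 - d))))
      - expR (l b k * (z0 - d)) * c k @[z --> F] -->
      ('[x, e b k] * (l b k * expR (l b k * (z0 - d))) - expR (l b k * (z0 - d)) * c k : R).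
    by apply: cvgB; [apply: cvgMr; exact: cvg_expR_quotient|exact: cvg_cst].
  have {c1} := c1; rewrite [X in _ --> X](_ : _ = 0); last by rewrite cE; ring.
  by apply: cvg_trans; apply: near_eq_cvg; apply: nearW => z; rewrite /r /=; ring.
have qcvg : '[q z, q z] @[z --> F] --> (0 : R).
  apply/cvgrPdist_le => eps eps0.
  have [M cM] := sc; pose s n := \sum_(k < n) c k ^+ 2.
  have snd : nondecreasing_seq s.
    by apply/nondecreasing_seqP => n; rewrite /s big_ord_recr/= lerDl sqr_ge0.
  have cs : cvgn s.
    by apply: nondecreasing_is_cvgn => //; exists M => _ [n _ <-]; exact: cM.
  (* Partial sums of c ^+ 2 past N differ by less than eps / 8, and r ^+ 2 <= 4 c ^+ 2, so the tail
     costs at most eps / 2; the first N terms are given the other half. *)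
  have eps16 : 0 < eps / 16 by rewrite divr_gt0.
  have /cvgrPdist_lt/(_ _ eps16)[N _ sN] := cs.
  have finN n : \sum_(k < n) r z k ^+ 2 @[z --> F] --> (0 : R).
    elim: n => [|n IH]; first by under eq_fun do rewrite big_ord0; exact: cvg_cst.
    under eq_fun do rewrite big_ord_recr/=.
    suff : \sum_(k < n) r z k ^+ 2 + r z n ^+ 2 @[z --> F] --> (0 + 0 * 0 : R).
      by rewrite mulr0 addr0.
    apply: cvgD; first exact: IH.
    by under eq_fun do rewrite expr2; apply: cvgM; exact: rcvg.
  have eps2 : 0 < eps / 2 by rewrite divr_gt0.
  near=> z.
  have zd : sgb b * (z - d) <= 0 by near: z.
  have zz0 : z != z0 by near: z; apply: filterS (Fz0 1 ltr01) => z [].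
  have rN : \sum_(k < N) r z k ^+ 2 <= eps / 2.
    have : `|0 - \sum_(k < N) r z k ^+ 2| <= eps / 2.
      by near: z; move/cvgrPdist_le : (finN N); exact.
    by rewrite sub0r normrN; exact: le_trans (ler_norm _).
  have [qzR qzk] := qR z zd; have qH := Rpi_H qzR.
  rewrite sub0r normrN ger0_norm ?(si_ge0 HS)//.
  apply: (cvgr_to_le (parseval qzR qH)); exists N => // n /= Nn.
  under eq_bigr do rewrite qzk -expr2.
  rewrite (sum_ord_split (fun k => r z k ^+ 2) Nn) (splitr eps); apply: lerD; first exact: rN.
  have tail : \sum_(k < n - N) r z (N + k)%N ^+ 2 <= 4 * (s n - s N).
    rewrite /s (sum_ord_split (fun k => c k ^+ 2) Nn) addrAC subrr add0r mulr_sumr.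
    apply: ler_sum => k _.
    have h : `|r z (N + k)%N| ^+ 2 <= (2 * `|c (N + k)%N|) ^+ 2.
      by rewrite lerXn2r ?nnegrE ?mulr_ge0// rb.
    by move: h; rewrite exprMn !real_normK ?num_real// -natrX.
  apply: (le_trans tail); have := sN n Nn; have := sN N (leqnn N).
  by rewrite /= !ltr_norml => /andP[h1 h2] /andP[h3 h4]; lra.
have := @continuous_cvg _ _ _ F FF _ Num.sqrt 0 (@sqrt_continuous R 0) qcvg.
by rewrite sqrtr0.
Unshelve. all: by end_near. Qed.

End spectral.

(** * The spectral system of A *)

Section L2_convergence.
Context {R : realType}.
Variable W : set (plane R).
Hypothesis mW : measurable W.
Implicit Types f g : plane R -> R.

Lemma L2dist2E f g : L2 leb2 W f -> L2 leb2 W g ->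
  L2dist2 W f g = (\int[leb2]_(x in W) ((f x - g x) ^+ 2))%:E.
Proof.
move=> fL2 gL2; have i := L2_sqr_integrable (L2B mW fL2 gL2).
by rewrite /L2dist2 /Rintegral fineK//; exact: (integrable_fin_num mW i).
Qed.

Lemma L2dist2_ge0 f g : (0 <= L2dist2 W f g)%E.
Proof. by apply: integral_ge0 => x _; rewrite lee_fin sqr_ge0. Qed.

Lemma L2dist2_ae_eq f f' g g' : L2 leb2 W f -> L2 leb2 W g -> L2 leb2 W f' -> L2 leb2 W g' ->
  {ae leb2, forall x, W x -> f x = f' x} -> {ae leb2, forall x, W x -> g x = g' x} ->
  L2dist2 W f g = L2dist2 W f' g'.
Proof.
move=> fL2 gL2 fL2' gL2' ff' gg'; rewrite !L2dist2E//; congr EFin.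
apply: Rintegral_ae_eq => //.
- exact: (measurable_funX 2 (L2_measurable (L2B mW fL2 gL2))).
- exact: (measurable_funX 2 (L2_measurable (L2B mW fL2' gL2'))).
by apply: filterS2 ff' gg' => x ff' gg' Wx; rewrite ff'// gg'.
Qed.

Lemma L2dist2_triangle f g h : L2 leb2 W f -> L2 leb2 W g -> L2 leb2 W h ->
  (L2dist2 W g h <= 2%:E * (L2dist2 W f g + L2dist2 W f h))%E.
Proof.
move=> fL2 gL2 hL2; rewrite !L2dist2E// -EFinD -EFinM lee_fin.
have i1 := L2_sqr_integrable (L2B mW fL2 gL2).
have i2 := L2_sqr_integrable (L2B mW fL2 hL2).
have i0 := L2_sqr_integrable (L2B mW gL2 hL2).
have i12 : leb2.-integrable W (EFin \o (fun x => (f x - g x) ^+ 2 + (f x - h x) ^+ 2)).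
  by have := integrableD mW i1 i2; apply: eq_integrable.
have i12' : leb2.-integrable W (EFin \o (fun x => 2 * ((f x - g x) ^+ 2 + (f x - h x) ^+ 2))).
  by have := integrableZl mW 2 i12; apply: eq_integrable.
rewrite -(RintegralD mW i1 i2) -(RintegralZl 2 mW i12).
apply: (le_Rintegral mW i0 i12') => x _.
(* This square is exactly the difference of the two sides. *)
move: (f x) (g x) (h x) => a b c; have := sqr_ge0 (2 * a - b - c); nra.
Qed.

Lemma L2dist2_eq0 f g : L2 leb2 W f -> L2 leb2 W g -> L2dist2 W f g = 0%E ->
  {ae leb2, forall x, W x -> f x = g x}.
Proof.
move=> fL2 gL2; rewrite L2dist2E// => -[fg0].
have := Rintegral_sqr_eq0 mW (L2B mW fL2 gL2) fg0.
by apply: filterS => x fg Wx; apply/subr0_eq/fg.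
Qed.

(** Once one limit g is known, convergence to h becomes the pointwise equation g = h. This turns a
    Neumann condition into an equation between functions. *)
Lemma L2_cvg_unique (T : Type) (F : set_system T) (FF : ProperFilter F)
    (f : T -> plane R -> R) g h :
  (\forall t \near F, L2 leb2 W (f t)) -> L2 leb2 W g -> L2 leb2 W h ->
  L2dist2 W (f t) g @[t --> F] --> 0%E ->
  (L2dist2 W (f t) h @[t --> F] --> 0%E <-> {ae leb2, forall x, W x -> g x = h x}).
Proof.
move=> fL2 gL2 hL2 fg; split=> [fh|gh].
  apply: L2dist2_eq0 => //; apply/eqP; rewrite eq_le L2dist2_ge0 andbT.
  have : (2%:E * (L2dist2 W (f t) g + L2dist2 W (f t) h))%E @[t --> F] --> (2%:E * (0 + 0))%E.
    apply: cvgeZl => //; exact: cvgeD.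
  rewrite adde0 mule0 => c2; apply: (cvge_ge _ c2).
  by apply: filterS fL2 => t fL2; exact: L2dist2_triangle.
apply: cvg_trans fg; apply: near_eq_cvg; apply: filterS fL2 => t fL2.
by apply: L2dist2_ae_eq => //; exact: aeW.
Qed.

Lemma L2sumP (u : nat -> plane R -> R) f : (forall k, L2 leb2 W (u k)) -> L2 leb2 W f ->
  L2dist2 W (fun x => \sum_(k < m) u k x) f @[m --> \oo] --> 0%E ->
  L2 leb2 W (L2sum W u) /\ {ae leb2, forall x, W x -> L2sum W u x = f x}.
Proof.
move=> uL2 fL2 uf.
have ex : exists g, L2 leb2 W g /\
    L2dist2 W (fun x => \sum_(k < m) u k x) g @[m --> \oo] --> 0%E by exists f.
have [sL2 us] : L2 leb2 W (L2sum W u) /\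
    L2dist2 W (fun x => \sum_(k < m) u k x) (L2sum W u) @[m --> \oo] --> 0%E.
  exact: (xgetPex (fun=> 0) ex).
split=> //; apply/(L2_cvg_unique _ _ sL2 fL2 us) => //.
apply: nearW => m; elim: m => [|m IH].
  by rewrite (_ : (fun x => _) = (fun=> 0)); [exact: L2_cst0|apply/funext => x; rewrite big_ord0].
rewrite (_ : (fun x => _) = (fun x => \sum_(k < m) u k x + u m x)); first exact: L2D.
by apply/funext => x; rewrite big_ord_recr.
Qed.

End L2_convergence.

Section instance.
Context {R : realType} (p : problem R) (hp : valid_problem p).
Context (lam : int -> R) (U : int -> plane R -> R) (s0 : plane R -> R).
Hypothesis hspec : spectral_facts p lam U s0.
Local Notation W := (Omega p).
Local Notation E := ((plane R -> R) * (plane R -> R))%type.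

Lemma semi_inner_hdot : semi_inner (Hspace p) (hdot p).
Proof.
split.
- exact: (Hspace0 hp).
- by move=> x y a; exact: (Hspace_lin hp).
- exact: hdotC.
- by move=> x y v a; exact: (hdot_linl hp).
- exact: (hdot_ge0 hp).
Qed.

Lemma self_adjoint_opA : self_adjoint (Hspace p) (hdot p) (heq p) (domA p) (opA p).
Proof.
split.
- exact: heq_refl.
- exact: heq_sym.
- exact: heq_trans.
- exact: heq_sub0.
- by move=> x [].
- exact: (Hspace_opA hp).
- exact: (sf_self_adjoint hspec).1.
- exact: (sf_self_adjoint hspec).2.
Qed.

Let HS := semi_inner_hdot.
Let SA := self_adjoint_opA.
Let mW := measurable_Omega hp.

Lemma leb2_Omega_gt0 : 0 < fine (leb2 W).
Proof.
rewrite fine_gt0// (leb2_Omega hp) andbT; apply: open_leb2_gt0; first exact: (open_Omega hp).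
by case: hp => -[].
Qed.

(** A null vector is in the kernel. In the balanced case it is t (1, s0); its first component has
    zero L2 norm and Omega has positive measure, so t = 0. *)
Lemma null_heq0 (x : E) : Hspace p x -> hdot p x x = 0 -> heq p x 0.
Proof.
move=> xH x0; have kx : kerA p x := null_kerA HS SA xH x0.
have [bal|unbal] := pselect (balanced p); last exact: (sf_kernel_unbalanced hspec unbal kx).
have [_ [t xt]] := (sf_kernel_balanced hspec bal x).1 kx.
suff t0 : t = 0 by rewrite t0 scale0r in xt.
have [C C0 /(_ x xH)] := L2norm_fst_le hp; rewrite x0 mulr0.
have x1 : L2 leb2 W x.1 by case: xH.
rewrite (@Rintegral_ae_eq _ _ _ mW _ (fun=> t ^+ 2)).
- rewrite Rintegral_cst// pmulr_lle0 ?leb2_Omega_gt0// => t2.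
  by apply/eqP; rewrite -sqrf_eq0 eq_le t2 sqr_ge0.
- exact: (measurable_funX 2 (L2_measurable x1)).
- exact: measurable_cst.
- have [x1t _] := xt; apply: filterS x1t => z x1t Wz.
  by rewrite x1t// [X in X ^+ 2]mulr1.
Qed.

Definition eigvec b k : E := phi lam U (eidx b k).
Definition eigval b k : R := lam (eidx b k).

(** By monotonicity the first eigenvalue of each sign is the one closest to 0. *)
Lemma eigval_gap : exists2 g : R, 0 < g & forall b k, g <= sgb b * eigval b k.
Proof.
exists (Num.min (eigval true 0) (- eigval false 0)).
  by have /andP[l1 l2] := sf_sign hspec 0; rewrite lt_min oppr_gt0 l1 l2.
case=> k; rewrite ge_min /sgb ?mul1r ?mulN1r; apply/orP; [left|right].
  elim: k => // k IH; apply: le_trans IH _; exact: (sf_monotone hspec k).1.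
elim: k => // k IH; apply: le_trans IH _; rewrite lerN2; exact: (sf_monotone hspec k).2.
Qed.

Lemma eidx_neq0 b k : eidx b k != 0. Proof. by case: b. Qed.

Lemma eidx_inj b k m : (eidx b k == eidx b m) = (k == m).
Proof. by case: b. Qed.

Lemma eidx_opp b k m : (eidx b k == eidx (~~ b) m) = false.
Proof. by case: b. Qed.

Lemma eidx_surj (i : int) : i != 0 -> exists b k, i = eidx b k.
Proof. by case: i => [[//|n]|n] _; [exists true, n|exists false, n]. Qed.

Lemma H_eigvec b k : Hspace p (eigvec b k).
Proof. by have [/(sa_domA SA)] := sf_eigen hspec (eidx_neq0 b k). Qed.

Lemma spectral_system_opA :
  spectral_system (Hspace p) (hdot p) (heq p) (domA p) (opA p) eigvec eigval.
Proof.
have eq_hnorm x y : Hspace p x -> Hspace p y -> heq p x y <-> hdot p (x - y) (x - y) = 0.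
  move=> xH yH; have xyH := siB HS xH yH; rewrite -(heq_sub0 p x y); split.
    exact: (eqv0_null HS SA).
  exact: null_heq0.
split.
- exact: HS.
- exact: SA.
- exact: eq_hnorm.
- exact: (sf_complete hspec).
- move=> b k; exact: (sf_eigen hspec (eidx_neq0 b k)).
- move=> b k m; have := sf_orthonormal hspec (eidx_neq0 b k) (eidx_neq0 b m).
  by rewrite eidx_inj.
- move=> b k m; have := sf_orthonormal hspec (eidx_neq0 b k) (eidx_neq0 (~~ b) m).
  by rewrite eidx_opp.
- exact: eigval_gap.
move=> x xH xe xk; have xT := sf_total hspec xH.
apply: null_heq0 => //.
apply: (span_closure_ortho HS _ xH _ xT) => y [[i i0 <-]|yk].
- by have [b [k ->]] := eidx_surj i0; exact: H_eigvec.
- by case: yk => /(sa_domA SA).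
- have [b [k ->]] := eidx_surj i0; have := xe b k; rewrite hdotC; exact.
by have := xk y yk.1 yk.2; rewrite hdotC; exact.
Qed.

End instance.

(** * Elements of R(P) orthogonal to one half of the spectrum *)

Section operators.
Context {R : realType} (p : problem R) (hp : valid_problem p).
Context (lam : int -> R) (U : int -> plane R -> R) (s0 : plane R -> R).
Hypothesis hspec : spectral_facts p lam U s0.
Local Notation W := (Omega p).
Local Notation E := ((plane R -> R) * (plane R -> R))%type.
Local Notation eigvec := (eigvec lam U).
Implicit Types (x y v w : E) (b : bool).

Let SS := spectral_system_opA hp hspec.
Let HS := ss_inner SS.
Let SA := ss_adjoint SS.
Let mW := measurable_Omega hp.

Lemma orth_projector_opP : orth_projector (Hspace p) (hdot p) (@opP R).
Proof.
split=> [x|x y xH yH|//]; first exact: Hspace_opP.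
have h1 := hdot_inlet hp yH xH.1; have h2 := hdot_inlet hp xH yH.1.
rewrite -[opP x]/(inlet x.1) -[opP y]/(inlet y.1) hdotC h1 h2.
by apply: eq_Rintegral => z _; rewrite mulrAC.
Qed.

Lemma Hspace_Phi : Hspace p (@Phi R).
Proof. by apply: (Hspace_inlet hp); exact: (L2_cst mW 1 (leb2_Omega hp)). Qed.

Lemma hdot_opP_fst w (Y : E) : Hspace p w -> Hspace p Y -> heq p (opP Y) Y ->
  hdot p Y w = \int[leb2]_(z in W) (coef_c p z * w.1 z * Y.1 z).
Proof.
move=> wH YH PY; have PYH := Hspace_opP hp YH.
have h1 := eqv_dotl HS SA PYH YH wH PY; have h2 := hdot_inlet hp wH YH.1.
by rewrite -h1 hdotC h2.
Qed.

(** A vector of R(P) only sees the first component of w, so a constant k behaves there like k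
    Phi. *)
Lemma hdot_cst_fst w (Y : E) (k : R) : Hspace p w -> Hspace p Y -> heq p (opP Y) Y ->
  {ae leb2, forall z, W z -> w.1 z = k} -> hdot p Y w = k * hdot p Y (@Phi R).
Proof.
move=> wH YH PY wk; rewrite (hdot_opP_fst wH YH PY) (hdot_opP_fst Hspace_Phi YH PY).
have i1 := integrable_cMM hp wH.1 YH.1; have i2 := integrable_cMM hp Hspace_Phi.1 YH.1.
rewrite -(RintegralZl k mW i2); apply: (Rintegral_ae_eq mW).
- by apply/measurable_EFinP; exact: (measurable_int leb2 i1).
- by apply: measurable_funM; [exact: measurable_cst|apply/measurable_EFinP; exact: (measurable_int leb2 i2)].
apply: filterS wk => z wk Wz; rewrite (wk Wz) -[(@Phi R).1 z]/(1 : R).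
by rewrite mulr1 mulrCA -!mulrA (mulrC k).
Qed.

(** The second component of A w is [w.1], and that of Y is zero in H, that is, zero or a constant
    depending on whether the constants are controlled. *)
Lemma inlet_cst (w Y : E) : heq p (opP Y) Y -> heq p (opA p w) Y ->
  exists2 k, {ae leb2, forall z, W z -> w.1 z = k} & controlled p -> k = 0.
Proof.
move=> [_ PY] [_ wY]; move: PY wY; case: asboolP => [c|nc].
  by move=> PY wY; exists 0 => //; apply: filterS2 PY wY => z PY wY Wz; exact: (etrans (wY Wz) (esym (PY Wz))).
move=> [k PY] [k' wY]; exists (k' - k) => //; apply: filterS2 PY wY => z PY wY Wz.
by have := PY Wz; have := wY Wz; rewrite -[(opA p w).2 z]/(w.1 z) -[(opP Y).2 z]/(0 : R); lra.
Qed.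

(** A kernel vector of the balanced case has a constant first component t, whence the pairing t (Y |
    Phi). *)
Lemma ker_orth (Y v : E) : Hspace p Y -> heq p (opP Y) Y ->
  (balanced p -> hdot p Y (@Phi R) = 0) -> kerA p v -> hdot p Y v = 0.
Proof.
move=> YH PY YPhi vk; have vH := sa_domA SA vk.1.
have [bal|unbal] := pselect (balanced p).
  have [_ [t [vt _]]] := (sf_kernel_balanced hspec bal v).1 vk.
  have vt' : {ae leb2, forall z, W z -> v.1 z = t}.
    by apply: filterS vt => z vt Wz; exact: (etrans (vt Wz) (mulr1 t)).
  by rewrite (hdot_cst_fst vH YH PY vt') (YPhi bal) mulr0.
have v0 := sf_kernel_unbalanced hspec unbal vk.
by rewrite hdotC (eqv_dotl HS SA vH (Hspace0 hp) YH v0) (hdot0l hp YH).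
Qed.

(** The sign condition of [opposite_eqv0] holds with value 0: either the constant [w.1] is 0, or (Y
    | Phi) is. *)
Lemma inlet_eqv0 b (Y : E) : Hspace p Y -> heq p (opP Y) Y ->
  (forall k, hdot p Y (eigvec b k) = 0) ->
  (~ controlled p -> hdot p Y (@Phi R) = 0) -> heq p Y 0.
Proof.
move=> YH PY Ye YPhi; apply: (opposite_eqv0 SS YH Ye).
  by move=> v; apply: ker_orth => // -[nc _]; exact: YPhi.
move=> w wA wY; have wH := sa_domA SA wA; have [k wk k0] := inlet_cst PY wY.
rewrite (hdot_cst_fst wH YH PY wk).
have [c|nc] := pselect (controlled p); first by rewrite k0// mul0r mulr0.
by rewrite YPhi// !mulr0.
Qed.

(* Green's formula kills the divergence term, the gradient of a constant being 0. *)
Lemma uncontrolled_form (w Y : E) k : ~ controlled p -> Hspace p Y ->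
  heq p (opP Y) Y -> domA p w -> heq p (opA p w) Y ->
  {ae leb2, forall z, W z -> w.1 z = k} -> hdot p Y w = k ^+ 2 * total_h p.
Proof.
move=> nc YH PY wA wY wk; have wH := sa_domA SA wA.
have [_ w1V wdiv wflux] := wA.
have dL2 := L2_weak_div wdiv; have w1L2 := Vspace_L2 w1V.
pose d := weak_div W (flux p w.2).
have id : leb2.-integrable W (EFin \o (fun z => d z * w.1 z)) by exact: L2M_integrable.
have ih : leb2.-integrable W (EFin \o coef_h p).
  have := L2_integrable mW (leb2_Omega hp) (Linfty_mul hp (Linfty_h hp) (L2_cst mW 1 (leb2_Omega hp))).
  by apply: eq_integrable => // z _; rewrite /= mulr1.
have ikh : leb2.-integrable W (EFin \o (fun z => k ^+ 2 * coef_h p z)).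
  by have := integrableZl mW (k ^+ 2) ih; apply: eq_integrable.
pose g i z := flux p w.2 i z * weak_partial W i w.1 z.
have w1H := Vspace_H1 w1V.
have ig i : leb2.-integrable W (EFin \o g i).
  exact: (integrable_sigmaMM hp i (Vspace_H1 wH.2) w1H).
have ig2 : leb2.-integrable W (EFin \o (fun z => \sum_(i < 2) g i z)).
  have := integrableD mW (ig ord0) (ig (lift ord0 ord0)); apply: eq_integrable => // z _.
  by rewrite /= big_ord2.
(* The constant [w.1] is zero in H, so (0, w.1) is a null vector and its product with w vanishes.
   This disposes of the gradient terms without computing a weak derivative. *)
have zH : Hspace p ((fun=> 0, w.1) : E) by split; [exact: L2_cst0|].
have z0 : heq p ((fun=> 0, w.1) : E) 0.
  split; first exact: aeW.
  case: asboolP => // _; exists k; apply: filterS wk => z wk Wz.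
  by rewrite -[LHS]/(w.1 z) wk// -[X in X + _]/(0 : R) add0r.
have zw := dot_null HS zH wH (eqv0_null HS SA zH z0).
have g0 : \int[leb2]_(z in W) (\sum_(i < 2) g i z) = 0.
  apply: (etrans _ zw); rewrite hdotE (robin_uncontrolled _ _ nc) addr0.
  apply: eq_Rintegral => z _; rewrite /energy_density !big_ord2 /g /flux.
  have gE (c v1 s d0 d1 e0 e1 : R) :
    s * d0 * e0 + s * d1 * e1 = c * 0 * v1 + (s * e0 * d0 + s * e1 * d1) by ring.
  exact: gE.
(* The flux condition on [w.2] is tested with v = [w.1]; there is no Robin term, and the gradient
   part is already 0. *)
have d0 : \int[leb2]_(z in W) (d z * w.1 z) = 0.
  have := wflux _ w1V; rewrite (robin_uncontrolled _ _ nc) oppr0 => <-.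
  have -> : normal_flux p w.2 w.1 = \int[leb2]_(z in W) ((\sum_(i < 2) g i z) + d z * w.1 z).
    by [].
  by rewrite (RintegralD mW ig2 id) g0 add0r.
rewrite (hdot_opP_fst wH YH PY).
have -> : k ^+ 2 * total_h p = \int[leb2]_(z in W) (k ^+ 2 * coef_h p z - d z * w.1 z).
  by rewrite (RintegralB mW ikh id) d0 subr0 (RintegralZl (k ^+ 2) mW ih).
apply: Rintegral_ae_eq => //.
- by apply/measurable_EFinP; exact: (measurable_int leb2 (integrable_cMM hp wH.1 YH.1)).
- by apply: measurable_funB; apply/measurable_EFinP;
    [exact: (measurable_int leb2 ikh)|exact: (measurable_int leb2 id)].
have [wY1 _] := wY; apply: filterS2 (filterI wk wY1) (c_gt0 hp) => z [wk' wY'] c0 Wz.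
rewrite -(wY' Wz) (wk' Wz) -[(opA p w).1 z]/(_ * _ * w.1 z - _) (wk' Wz) -/d.
have cn0 : coef_c p z != 0 by rewrite gt_eqF// c0.
have fE (c h e : R) : c != 0 -> c * k * (c^-1 * h * k - c^-1 * e) = k ^+ 2 * h - e * k.
  by move=> c0'; field.
exact: fE.
Qed.

(** Here w lies in the negative range, whereas the form equals k^2 times the integral of h, which is
    nonnegative. *)
Lemma inlet_eqv0_unbalanced (Y : E) : ~ controlled p -> 0 < total_h p ->
  Hspace p Y -> heq p (opP Y) Y ->
  (forall k, hdot p Y (eigvec true k) = 0) -> heq p Y 0.
Proof.
move=> nc h0 YH PY Ye; apply: (opposite_eqv0 SS YH Ye).
  by move=> v; apply: ker_orth => // -[_ hE]; rewrite hE ltxx in h0.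
move=> w wA wY; have wH := sa_domA SA wA; have [k wk _] := inlet_cst PY wY.
rewrite (uncontrolled_form nc YH PY wA wY wk) /sgb mulN1r oppr_le0.
by rewrite mulr_ge0 ?sqr_ge0 ?(ltW h0).
Qed.

End operators.

(** * Agreement of the concrete operators with the abstract ones *)

Section identification.
Context {R : realType} (p : problem R).
Context (lam : int -> R) (U : int -> plane R -> R).
Local Notation E := ((plane R -> R) * (plane R -> R))%type.
Local Notation eigvec := (eigvec lam U).

#[local] Opaque hdot Hspace.
(* Pairs of functions carry two convertible structures: the one inferred for
   products, and the one obtained through their module structure. *)
Lemma xget_lmod (P : set E) (V := E : lmodType R) : xget 0 P = xget (0 : V) P.
Proof. by []. Qed.

Lemma closed_spanE (F : set E) : closed_span p F = span_closure (Hspace p) (hdot p) F.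
Proof. by []. Qed.

Lemma orth_projE (F : set E) x : orth_proj p F x = span_proj (Hspace p) (hdot p) F x.
Proof. by rewrite /orth_proj closed_spanE. Qed.
Lemma pi_E b : pi_ p lam U b = span_proj (Hspace p) (hdot p) (eigs eigvec b).
Proof. by apply/funext => x; exact: orth_projE. Qed.

#[local] Opaque span_proj span_closure pi_ heq.

Lemma compressed_E b x : compressed p lam U b x =
  compression (Hspace p) (hdot p) eigvec (@opP R) b x.
Proof. rewrite /compressed pi_E. reflexivity. Qed.

Lemma compressed_inv_E b y : compressed_inv p lam U b y =
  compression_inv (Hspace p) (hdot p) (heq p) eigvec (@opP R) b y.
Proof.
apply: (etrans (xget_lmod _)).
have -> : [set x | Rpi p lam U b x /\ heq p (compressed p lam U b x) y] =
  [set x | span_closure (Hspace p) (hdot p) (eigs eigvec b) x /\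
           heq p (compression (Hspace p) (hdot p) eigvec (@opP R) b x) y].
  apply/funext => x. exact: (congr1 (fun v => Rpi p lam U b x /\ heq p v y) (compressed_E b x)).
reflexivity.
Qed.

Lemma compression_bij_opP s0 (hspec : spectral_facts p lam U s0) b y :
  span_closure (Hspace p) (hdot p) (eigs eigvec b) y -> exists2 x,
  span_closure (Hspace p) (hdot p) (eigs eigvec b) x /\
    heq p (compression (Hspace p) (hdot p) eigvec (@opP R) b x) y &
  forall x', span_closure (Hspace p) (hdot p) (eigs eigvec b) x' ->
    heq p (compression (Hspace p) (hdot p) eigvec (@opP R) b x') y -> heq p x' x.
Proof.
have [C Cb] := sf_invertible hspec b.
move=> yR; have [x [xR xy] [_ xu]] := Cb y yR; exists x.
  by split; [exact: xR|rewrite -compressed_E; exact: xy].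
move=> x' xR' xy'; apply: (xu _ xR'); rewrite compressed_E; exact: xy'.
Qed.

Lemma opB_E b x : opB p lam U b x = invB (Hspace p) (hdot p) (heq p) eigvec (@opP R) b x.
Proof.
rewrite /opB pi_E compressed_inv_E. reflexivity.
Qed.

Lemma u_E b : u_ p lam U b =
  defect (Hspace p) (hdot p) (heq p) eigvec (@opP R) (@Phi R) b.
Proof. rewrite /u_ opB_E. reflexivity. Qed.

Lemma expA_E L b x :
  expA p lam U L b x = expf (Hspace p) (hdot p) eigvec (eigval lam) L b x.
Proof. by []. Qed.

Lemma opM_E L b x : opM p lam U L b x =
  opP (expf (Hspace p) (hdot p) eigvec (eigval lam) L b
    (invB (Hspace p) (hdot p) (heq p) eigvec (@opP R) b x)).
Proof. rewrite /opM expA_E opB_E. reflexivity. Qed.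

End identification.

(** * Inlet and outlet conditions *)

Section boundary_derivative.
Context {R : realType} (p : problem R) (hp : valid_problem p).
Context (lam : int -> R) (U : int -> plane R -> R) (s0 : plane R -> R).
Variable L : R.
Hypothesis hspec : spectral_facts p lam U s0.
Local Notation W := (Omega p).
Local Notation E := ((plane R -> R) * (plane R -> R))%type.
Local Notation eigvec := (eigvec lam U).
Local Notation eigval := (eigval lam).
Local Notation Rp b := (span_closure (Hspace p) (hdot p) (eigs eigvec b)).
Local Notation pi b := (span_proj (Hspace p) (hdot p) (eigs eigvec b)).
Local Notation nrm x := (Num.sqrt (hdot p x x)).
Implicit Types (x y : E) (b : bool).

Let SS := spectral_system_opA hp hspec.
Let HS := ss_inner SS.
Let mW := measurable_Omega hp.

Lemma L2dist2_fst_cvg (T : Type) (F : set_system T) (FF : ProperFilter F) (u : T -> E) y :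
  (\forall t \near F, Hspace p (u t)) -> Hspace p y ->
  nrm (u t - y) @[t --> F] --> (0 : R) ->
  L2dist2 W (u t).1 y.1 @[t --> F] --> 0%E.
Proof.
move=> uH yH uy; have [C C0 CP] := L2norm_fst_le hp.
have uy2 : (C * nrm (u t - y) ^+ 2)%:E @[t --> F] --> 0%E.
  apply: cvg_EFin; first exact: nearW.
  suff : C * (nrm (u t - y) * nrm (u t - y)) @[t --> F] --> (C * (0 * 0) : R).
    by rewrite !mulr0; under [in X in X -> _]eq_fun do rewrite -expr2.
  by apply: cvgMr; apply: cvgM.
apply: (squeeze_cvge _ (@cvg_cst _ 0%E _ F FF) uy2).
apply: filterS uH => t uH; rewrite L2dist2_ge0 /=.
have dH := siB HS uH yH.
rewrite (L2dist2E mW uH.1 yH.1) lee_fin (sqr_nrm HS dH); exact: (CP _ dH).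
Qed.

Lemma fst_eig_sum b (a : nat -> R) n (z : plane R) :
  (eig_sum eigvec b a n).1 z = \sum_(k < n) a k * U (eidx b k) z.
Proof.
rewrite /eig_sum; elim: n => [|n IH]; first by rewrite !big_ord0.
by rewrite !big_ord_recr -[RHS]/(_ + _) -IH.
Qed.

(** The expansion of x converges in energy, hence its first components converge in L2, and the sum
    picked by [L2sum] can only be [x.1] up to a null set. *)
Lemma L2sum_Rpi b x : Rp b x ->
  L2 leb2 W (L2sum W (fun k z => hdot p x (eigvec b k) * U (eidx b k) z)) /\
  {ae leb2, forall z, W z ->
    L2sum W (fun k z => hdot p x (eigvec b k) * U (eidx b k) z) z = x.1 z}.
Proof.
move=> xR; have xH := Rpi_H xR.
apply: (L2sumP mW) => [k||].
- by apply: (L2Z mW); have := H_eig SS b k; case.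
- by case: xH.
have c1 := Rpi_cvg SS xR.
pose s n : E := eig_sum eigvec b (fun k => hdot p x (eigvec b k)) n.
have sH : \forall n \near \oo, Hspace p (s n) by apply: nearW => n; exact: (H_eig_sum SS b (fun k => hdot p x (eigvec b k)) n).
have c2 := @L2dist2_fst_cvg _ \oo _ s x sH xH c1.
have sE : (fun n => L2dist2 W (fun z => \sum_(k < n) hdot p x (eigvec b k) * U (eidx b k) z) x.1) =
    (fun n => L2dist2 W (s n).1 x.1).
  apply/funext => n; suff -> : (s n).1 =
    (fun z => \sum_(k < n) hdot p x (eigvec b k) * U (eidx b k) z) by [].
  by apply/funext => z; exact: fst_eig_sum.
by rewrite sE; apply: c2.
Qed.

(** The end point at which the half of sign b is not damped. *)
Let dd b : R := if b then L else - L.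

(** In the difference quotient c1 and the s0 term cancel, and c2 z leaves c2. What remains is,
    almost everywhere, the first component of the quotients of the two abstract series, which
    converge in energy to D. *)
Lemma Tsol_derive psi c1 c2 (F : set_system R) (FF : ProperFilter F) (z0 : R) Sf :
  domA p psi -> L2 leb2 W Sf -> - L <= z0 <= L ->
  (forall r : R, 0 < r -> \forall z \near F, `|z - z0| < r /\ z != z0) ->
  (\forall z \near F, - L <= z <= L) ->
  exists D : bool -> E, [/\ forall b, Rp b (D b),
    forall b k, hdot p (D b) (eigvec b k) =
      expR (eigval b k * (z0 - dd b)) * hdot p (opA p (pi b psi)) (eigvec b k) &
    let Tz := Tsol p lam U L s0 psi c1 c2 in
    L2dist2 W (fun w => (Tz z w - Tz z0 w) / (z - z0)) Sf @[z --> F] --> 0%E <->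
    {ae leb2, forall w, W w -> (D false).1 w + (D true).1 w + c2 = Sf w}].
Proof.
move=> psiA SfL2 z0L Fz0 FL.
have sg b z : - L <= z <= L -> sgb b * (z - dd b) <= 0.
  by rewrite /sgb /dd; case: b => /andP[]; lra.
have Fd b : \forall z \near F, sgb b * (z - dd b) <= 0 by apply: filterS FL => z; exact: sg.
have ex b := eig_expansion_derive SS (b := b) FF psiA (sg b _ z0L) Fz0 (Fd b).
have [Sf0 [Df [Pf Rf kf cf]]] := ex false.
have [St [Dt [Pt Rt kt ct]]] := ex true.
exists (fun b => if b then Dt else Df); split => [[]//|[]//|Tz].
pose ser b z := L2sum W (fun k w => hdot p psi (eigvec b k) *
   expR (eigval b k * (z - dd b)) * U (eidx b k) w).
have serP b (S : R -> E) : (forall z, sgb b * (z - dd b) <= 0 -> Rp b (S z) /\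
     forall k, hdot p (S z) (eigvec b k) = hdot p psi (eigvec b k) * expR (eigval b k * (z - dd b))) ->
   forall z, - L <= z <= L -> L2 leb2 W (ser b z) /\
     {ae leb2, forall w, W w -> ser b z w = (S z).1 w}.
  move=> SP z zL; have [SR Sk] := SP z (sg b z zL).
  have -> : ser b z = L2sum W (fun k w => hdot p (S z) (eigvec b k) * U (eidx b k) w).
    by rewrite /ser; congr L2sum; apply/funext => k; apply/funext => w; rewrite Sk.
  exact: L2sum_Rpi.
have fP := serP false _ Pf; have tP := serP true _ Pt.
have [f0L2 f0E] := fP _ z0L; have [t0L2 t0E] := tP _ z0L.
have DfH := Rpi_H Rf; have DtH := Rpi_H Rt.
pose q z : E := ((z - z0)^-1 *: (Sf0 z - Sf0 z0)) + ((z - z0)^-1 *: (St z - St z0)).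
pose G z (w : plane R) : R := (z - z0)^-1 * (ser false z w - ser false z0 w) +
   (z - z0)^-1 * (ser true z w - ser true z0 w) + c2.
have GE : \forall z \near F, (fun w => (Tz z w - Tz z0 w) / (z - z0)) = G z.
  apply: filterS (Fz0 1 ltr01) => z [_ zz0]; apply/funext => w.
  have TE u : Tz u w = ser false u w + ser true u w + c1 + c2 * (u + s0 w).
    by rewrite /Tz /Tsol /ser /dd opprK.
  rewrite !TE /G; move: (ser false z w) (ser false z0 w) (ser true z w) (ser true z0 w) => a a' b b'.
  by field; rewrite subr_eq0.
have qH b (S : R -> E) z : Rp b (S z) -> Rp b (S z0) -> Hspace p ((z - z0)^-1 *: (S z - S z0)).
  by move=> SR S0R; exact: (HspaceZ hp _ (HspaceB hp (Rpi_H SR) (Rpi_H S0R))).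
have qfH : \forall z \near F, Hspace p ((z - z0)^-1 *: (Sf0 z - Sf0 z0)).
  by apply: filterS FL => z zL; exact: (qH _ _ _ (Pf z (sg false z zL)).1 (Pf z0 (sg false z0 z0L)).1).
have qtH : \forall z \near F, Hspace p ((z - z0)^-1 *: (St z - St z0)).
  by apply: filterS FL => z zL; exact: (qH _ _ _ (Pt z (sg true z zL)).1 (Pt z0 (sg true z0 z0L)).1).
have qcvg := nrm_cvgD HS FF qfH qtH DfH DtH cf ct.
have qqH : \forall z \near F, Hspace p (q z).
  by apply: filterS2 qfH qtH => z h1 h2; exact: (HspaceD hp h1 h2).
have DH : Hspace p (Df + Dt) := HspaceD hp DfH DtH.
have q2cvg := L2dist2_fst_cvg FF qqH DH qcvg.
have cL2 : L2 leb2 W (fun=> c2) := L2_cst mW c2 (leb2_Omega hp).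
pose g w : R := Df.1 w + Dt.1 w + c2.
have gL2 : L2 leb2 W g by exact: (L2D mW (L2D mW DfH.1 DtH.1) cL2).
have GL2 : \forall z \near F, L2 leb2 W (G z).
  apply: filterS FL => z zL; have [f1 _] := fP z zL; have [t1 _] := tP z zL.
  have af := L2Z mW (z - z0)^-1 (L2B mW f1 f0L2).
  have at' := L2Z mW (z - z0)^-1 (L2B mW t1 t0L2).
  exact: (L2D mW (L2D mW af at') cL2).
have Gcvg : L2dist2 W (G z) g @[z --> F] --> 0%E.
  apply: cvg_trans q2cvg; apply: near_eq_cvg.
  apply: filterS3 FL GL2 qqH => z zL GL2 qzH.
  have [f1 f1E] := fP z zL; have [t1 t1E] := tP z zL.
  rewrite (L2dist2E mW qzH.1 DH.1) (L2dist2E mW GL2 gL2); congr EFin.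
  apply: (Rintegral_ae_eq mW).
  - exact: (measurable_funX 2 (L2_measurable (L2B mW qzH.1 DH.1))).
  - exact: (measurable_funX 2 (L2_measurable (L2B mW GL2 gL2))).
  apply: filterS2 (filterI f0E t0E) (filterI f1E t1E) => w [e1 e2] [e3 e4] Ww.
  rewrite /G /g (e1 Ww) (e2 Ww) (e3 Ww) (e4 Ww).
  rewrite -[(q z).1 w]/((z - z0)^-1 * ((Sf0 z).1 w - (Sf0 z0).1 w) +
     (z - z0)^-1 * ((St z).1 w - (St z0).1 w)) -[(Df + Dt).1 w]/(Df.1 w + Dt.1 w).
  have addE (a d : R) : (a - d) ^+ 2 = (a + c2 - (d + c2)) ^+ 2.
    by rewrite opprD addrACA subrr addr0.
  exact: addE.
have := L2_cvg_unique mW FF GL2 gL2 SfL2 Gcvg => <-.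
split; apply: cvg_trans; apply: near_eq_cvg; apply: filterS GE => z ->//.
Qed.

End boundary_derivative.

Section inlet_outlet.
Context {R : realType} (p : problem R) (hp : valid_problem p).
Context (lam : int -> R) (U : int -> plane R -> R) (s0 : plane R -> R) (L : R).
Hypothesis hspec : spectral_facts p lam U s0.
Hypothesis L_gt0 : 0 < L.
Local Notation W := (Omega p).
Local Notation E := ((plane R -> R) * (plane R -> R))%type.
Local Notation eigvec := (eigvec lam U).
Local Notation eigval := (eigval lam).
Local Notation Rp b := (span_closure (Hspace p) (hdot p) (eigs eigvec b)).
Local Notation pi b := (span_proj (Hspace p) (hdot p) (eigs eigvec b)).
Local Notation B := (invB (Hspace p) (hdot p) (heq p) eigvec (@opP R)).
Local Notation ex := (expf (Hspace p) (hdot p) eigvec eigval L).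
Local Notation u b := (defect (Hspace p) (hdot p) (heq p) eigvec (@opP R) (@Phi R) b).
Implicit Types (x y : E) (b : bool) (S : bool -> plane R -> R) (Y : bool -> E).

Let SS := spectral_system_opA hp hspec.
Let HS := ss_inner SS.
Let SA := ss_adjoint SS.
Let PP := orth_projector_opP hp.
Let CB := compression_bij_opP hspec.
Let L_ge0 := ltW L_gt0.
Let PhiH := Hspace_Phi hp.

(** A common form of the first two rows of the three systems, indexed by the end point ([false] for
    - L), with c = 0 when there is no c2. *)
Definition inlet_system Y (c : R) S := forall b, {ae leb2, forall w, W w ->
  (Y b).1 w + (opM p lam U L (~~ b) (Y (~~ b))).1 w + c = S b w}.

Definition unknown psi b : E := opP (opA p (pi b psi)).

(** [opM] takes equal values on [heq] arguments because [opB] begins with a projection. *)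
Lemma inlet_system_eqv Y Y' c S : (forall b, Hspace p (Y b)) -> (forall b, Hspace p (Y' b)) ->
  (forall b, heq p (Y b) (Y' b)) -> inlet_system Y c S -> inlet_system Y' c S.
Proof.
move=> YH YH' YY sys b; have [Y1 _] := YY b.
have ME : opM p lam U L (~~ b) (Y (~~ b)) = opM p lam U L (~~ b) (Y' (~~ b)).
  have BE := invB_eqv SS (@opP R) (~~ b) (YH (~~ b)) (YH' (~~ b)) (YY (~~ b)).
  exact: (etrans (opM_E _ _ _ _ _ _) (etrans (congr1 (fun x => opP (ex (~~ b) x)) BE)
    (esym (opM_E _ _ _ _ _ _)))).
have := sys b; rewrite ME; apply: filterS2 Y1 => w Y1 h Ww.
by rewrite -(Y1 Ww); exact: h.
Qed.

Lemma endpoint_near b : let d : R := if b then L else - L in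
  let F : set_system R := if b then L^'- else (- L)^'+ in
  [/\ ProperFilter F, - L <= d <= L,
    forall r : R, 0 < r -> \forall z \near F, `|z - d| < r /\ z != d &
    \forall z \near F, - L <= z <= L].
Proof.
have L0 := L_gt0; case: b => d F; split.
- exact: at_left_proper_filter.
- by rewrite /d lexx andbT; lra.
- move=> r r0; near=> z; split; last by near: z; exact: nbhs_left_neq.
  have zd : z < d by near: z; exact: nbhs_left_lt.
  by rewrite distrC gtr0_norm ?subr_gt0//; near: z; exact: nbhs_left_ltBl.
- near=> z; apply/andP; split; last by near: z; exact: nbhs_left_le.
  by near: z; apply: nbhs_left_ge; lra.
- exact: at_right_proper_filter.
- by rewrite /d lexx; lra.
- move=> r r0; near=> z; split; last by near: z; exact: nbhs_right_neq.
  have zd : d < z by near: z; exact: nbhs_right_gt.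
  by rewrite gtr0_norm ?subr_gt0//; near: z; exact: nbhs_right_ltDr.
- near=> z; apply/andP; split; first by near: z; exact: nbhs_right_ge.
  by near: z; apply: nbhs_right_le; lra.
Unshelve. all: by end_near. Qed.

(* Each end point sees its own half of the expansion undamped and the other half
   damped by exp (-2 L |lambda|). *)
Lemma endpoint_derive psi c1 c2 Sf b : domA p psi -> L2 leb2 W Sf ->
  let d : R := if b then L else - L in
  let F : set_system R := if b then L^'- else (- L)^'+ in
  let Tz := Tsol p lam U L s0 psi c1 c2 in
  L2dist2 W (fun w => (Tz z w - Tz d w) / (z - d)) Sf @[z --> F] --> 0%E <->
  {ae leb2, forall w, W w ->
    (unknown psi b).1 w + (opM p lam U L (~~ b) (unknown psi (~~ b))).1 w + c2 = Sf w}.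
Proof.
move=> psiA SfL2 d F Tz; have [FF dL Fd FL] := endpoint_near b.
have [D [DR Dk DE]] := Tsol_derive hp hspec c1 c2 FF psiA SfL2 dL Fd FL.
apply: (iff_trans DE).
have own : heq p (D b) (opA p (pi b psi)).
  apply: (Rpi_ext SS (DR b) (domA_pi SS b psiA).2) => k; rewrite Dk.
  by rewrite /d; case: (b); rewrite subrr mulr0 expR0 mul1r.
have zR := (domA_pi SS (~~ b) psiA).2.
have [eR ek] := expf_invB_P SS PP CB L_ge0 zR.
have other : heq p (D (~~ b)) (ex (~~ b) (B (~~ b) (unknown psi (~~ b)))).
  apply: (Rpi_ext SS (DR (~~ b)) eR) => k; rewrite Dk ek; congr (expR _ * _).
  by rewrite /d; case: (b) => /=; ring.
have [h1 _] := own; have [h2 _] := other; rewrite opM_E.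
have DDE w : (D false).1 w + (D true).1 w = (D b).1 w + (D (~~ b)).1 w.
  by case: (b) => //=; rewrite addrC.
by split; apply: filterS3 h1 h2 => w h1 h2 + Ww => /(_ Ww); rewrite DDE h1// h2.
Qed.

Lemma neumannP psi c1 c2 S : domA p psi -> (forall b, L2 leb2 W (S b)) ->
  neumann_conditions p lam U L s0 (S false) (S true) psi c1 c2 <->
  inlet_system (unknown psi) c2 S.
Proof.
move=> psiA SL2; have := endpoint_derive c1 c2 false psiA (SL2 false).
have := endpoint_derive c1 c2 true psiA (SL2 true).
rewrite /= opprK => et ef; split=> [[/ef hf /et ht] [//|//]|sys].
by split; [apply/ef; exact: (sys false)|apply/et; exact: (sys true)].
Qed.

Lemma RP_P x : RP p x -> Hspace p x /\ opP x = x.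
Proof. by move=> [y yH <-]; split; [exact: Hspace_opP|exact: erefl]. Qed.

Lemma RP_unknown psi b : domA p psi -> RP p (unknown psi b).
Proof.
move=> psiA; have zH := Hspace_opA hp (domA_pi SS b psiA).1.
exact: (ex_intro2 _ _ _ zH (erefl _)).
Qed.

Lemma RP_opM b x : Hspace p x -> RP p (opM p lam U L b x).
Proof.
move=> xH; rewrite opM_E.
have yH := Rpi_H (expfP SS L_ge0 b (Rpi_H (Rpi_invB SS CB b xH))).1.
exact: (ex_intro2 _ _ _ yH (erefl _)).
Qed.

Lemma heq_inletP x f : (forall z, x.2 z = 0) ->
  heq p x (inlet f) <-> {ae leb2, forall z, W z -> x.1 z = f z}.
Proof.
move=> x0; split=> [[]//|xf]; split; first exact: xf.
have x0' : {ae leb2, forall z, W z -> x.2 z = 0 + 0} by apply: aeW => z _; rewrite x0 addr0.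
by case: asboolP => _; [apply: aeW => z _; exact: x0|exists 0; exact: x0'].
Qed.

Lemma heq_inlet2 x y f : RP p x -> RP p y -> heq p (x + y) (inlet f) <->
  {ae leb2, forall z, W z -> x.1 z + y.1 z = f z}.
Proof.
by move=> [x' _ <-] [y' _ <-]; apply: heq_inletP => z; exact: (addr0 (0 : R)).
Qed.

Lemma heq_inlet3 x y c f : RP p x -> RP p y -> heq p (x + y + c *: @Phi R) (inlet f) <->
  {ae leb2, forall z, W z -> x.1 z + y.1 z + c = f z}.
Proof.
move=> [x' _ <-] [y' _ <-]; apply: iff_trans.
  apply: heq_inletP => z; have z0 : (0 : R) + 0 + c * 0 = 0 by rewrite mulr0 !addr0.
  exact: z0.
split; apply: filterS => z + Wz => /(_ Wz) <-.
  have cE (a d : R) : a + d + c = a + d + c * 1 by rewrite mulr1.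
  exact: cE.
have cE (a d : R) : a + d + c * 1 = a + d + c by rewrite mulr1.
exact: cE.
Qed.

(** * The block systems and their additional rows *)

Definition both x y b : E := if b then y else x.

Lemma inlet_system2 x y S : RP p x -> RP p y ->
  heq p (x + opM p lam U L true y) (inlet (S false)) /\
  heq p (opM p lam U L false x + y) (inlet (S true)) <-> inlet_system (both x y) 0 S.
Proof.
move=> xR yR; have [xH _] := RP_P xR; have [yH _] := RP_P yR.
have e1 := heq_inlet2 (S false) xR (RP_opM true yH).
have e2 := heq_inlet2 (S true) (RP_opM false xH) yR.
split=> [[/e1 h1 /e2 h2] b|sys].
  case: b; [move: h2|move: h1]; apply: filterS => w + Ww => /(_ Ww) <- /=; last by rewrite addr0.
  by rewrite addr0 addrC.
split; [apply/e1|apply/e2].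
  by apply: filterS (sys false) => w + Ww => /(_ Ww) <- /=; rewrite addr0.
by apply: filterS (sys true) => w + Ww => /(_ Ww) <- /=; rewrite addr0 addrC.
Qed.

Lemma inlet_system3 x y c S : RP p x -> RP p y ->
  heq p (x + opM p lam U L true y + c *: @Phi R) (inlet (S false)) /\
  heq p (opM p lam U L false x + y + c *: @Phi R) (inlet (S true)) <->
  inlet_system (both x y) c S.
Proof.
move=> xR yR; have [xH _] := RP_P xR; have [yH _] := RP_P yR.
have e1 := heq_inlet3 c (S false) xR (RP_opM true yH).
have e2 := heq_inlet3 c (S true) (RP_opM false xH) yR.
split=> [[/e1 h1 /e2 h2] b|sys].
  case: b; [move: h2|move: h1]; apply: filterS => w + Ww => /(_ Ww) <- //=.
  by rewrite (addrC (y.1 w)).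
split; [apply/e1|apply/e2].
  by apply: filterS (sys false) => w + Ww => /(_ Ww) <-.
by apply: filterS (sys true) => w + Ww => /(_ Ww) <- /=; rewrite (addrC (y.1 w)).
Qed.

(** With v = u_b this shows that, given the first two rows, the additional row of sign b amounts to
    (Y b | u_b) = 0. *)
Lemma inlet_system_dot Y c S v b : (forall b, RP p (Y b)) -> L2 leb2 W (S b) ->
  Hspace p v -> inlet_system Y c S ->
  hdot p (Y b) v + (hdot p (opM p lam U L (~~ b) (Y (~~ b))) v + c * hdot p (@Phi R) v) =
  hdot p (inlet (S b)) v.
Proof.
move=> YR SL2 vH sys; have [YH _] := RP_P (YR b).
have MR := RP_opM (~~ b) (RP_P (YR (~~ b))).1; have [MH _] := RP_P MR.
have cPH := HspaceZ hp c PhiH; have YMH := HspaceD hp YH MH.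
have e := (heq_inlet3 c (S b) (YR b) MR).2 (sys b).
have lin (r1 r2 r3 r4 r5 r : R) : r5 = r4 + r3 -> r4 = r1 + r2 -> r5 = r -> r1 + (r2 + r3) = r.
  by move=> -> -> <-; rewrite addrA.
rewrite -(hdotZl hp c PhiH vH).
exact: (lin _ _ _ _ _ _ (hdotDl hp YMH cPH vH) (hdotDl hp YH MH vH)
  (eqv_dotl HS SA (HspaceD hp YMH cPH) (Hspace_inlet hp SL2) vH e)).
Qed.

Lemma H_u b : Hspace p (u b). Proof. exact: (H_defect SS PP CB PhiH). Qed.

Lemma dot_unknown_u psi b : domA p psi -> hdot p (unknown psi b) (u b) = 0.
Proof.
by move=> psiA; exact: (dot_defect SS PP CB PhiH (erefl _) (domA_pi SS b psiA).2).
Qed.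

Lemma unknown_eqv psi psi' : RA p psi -> RA p psi' -> domA p psi -> domA p psi' ->
  heq p psi psi' <-> forall b, heq p (unknown psi b) (unknown psi' b).
Proof.
move=> [psiH psik] [psiH' psik'] psiA psiA'; split=> [e b|e].
  have pE := pi_eqv SS b psiH psiH' e.
  by rewrite /unknown pE; exact: heq_refl.
exact: (eqv_of_unknowns SS PP CB psiA psiA' psik psik' e).
Qed.

(** The two components are independent: each one is written P z b, after which A is inverted on both
    ranges at once. *)
Lemma unknown_surj Y : (forall b, RP p (Y b)) ->
  (forall b x, Hspace p x -> heq p (opP x) x -> (forall k, hdot p x (eigvec b k) = 0) ->
    hdot p x (@Phi R) = hdot p (Y b) (u b) -> heq p x 0) ->
  exists2 psi, RA p psi /\ domA p psi & forall b, heq p (unknown psi b) (Y b).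
Proof.
move=> YR Y0.
have surj b : exists2 z, Rp b z & heq p (opP z) (Y b).
  have [YH PY] := RP_P (YR b).
  exact: (P_Rpi_surj SS PP CB PhiH (erefl _) YH PY (Y0 b)).
have [zf zfR zfY] := surj false; have [zt ztR ztY] := surj true.
have bR b : Rp b (both zf zt b) by case: b; [exact: ztR|exact: zfR].
have [psi [psiA psik psiz]] := pi_solve SS bR.
exists psi; first exact: (conj (conj (sa_domA SA psiA) psik) psiA).
move=> b; apply: (heq_trans (heq_opP (psiz b))).
by case: b; [exact: ztY|exact: zfY].
Qed.

End inlet_outlet.

Theorem proposition10 (R : realType) (p : problem R)
  (lam : int -> R) (U : int -> plane R -> R) (s0 : plane R -> R)
  (L : R) (Sm Sp : plane R -> R)
  (hp : valid_problem p)
  (hs0 : balanced p -> is_inv_div_h p s0)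
  (hspec : spectral_facts p lam U s0)
  (hL : 0 < L)
  (hSm : L2 leb2 (Omega p) Sm) (hSp : L2 leb2 (Omega p) Sp) :
  let admissible psi := RA p psi /\ domA p psi in
  let neumann := neumann_conditions p lam U L s0 Sm Sp in
  let X := unknowns p lam U in
  [/\ controlled p ->
        let solves Y := heq2 p (Z_controlled p lam U L Y)
                               (b_controlled Sm Sp) in
        (forall psi, admissible psi -> (neumann psi 0 0 <-> solves (X psi))) /\
        bijective_mod (heq p) (heq2 p)
          [set psi | admissible psi /\ neumann psi 0 0]
          [set Y | RP p Y.1 /\ RP p Y.2 /\ solves Y]
          X,
      ~ controlled p -> 0 < total_h p ->
        let solves Y := eq_and (heq2 p) (Z_unbalanced p lam U L Y)
                               (b_unbalanced p lam U Sm Sp) in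
        forall c1 : R,
        (forall psi, admissible psi -> (neumann psi c1 0 <-> solves (X psi))) /\
        bijective_mod (heq p) (heq2 p)
          [set psi | admissible psi /\ neumann psi c1 0]
          [set Y | RP p Y.1 /\ RP p Y.2 /\ solves Y]
          X &
      balanced p ->
        let solves Y := eq_and (eq_and (heq2 p)) (Z_balanced p lam U L Y)
                               (b_balanced p lam U Sm Sp) in
        forall c1 : R,
        (forall psi c2, admissible psi ->
           (neumann psi c1 c2 <-> solves (X psi, c2))) /\
        bijective_mod (eq_and (heq p)) (eq_and (heq2 p))
          [set d | admissible d.1 /\ neumann d.1 c1 d.2]
          [set Y | RP p Y.1.1 /\ RP p Y.1.2 /\ solves Y]
          (fun d => (X d.1, d.2))].
Proof.
move=> admissible neumann X.
pose S b := if b then Sp else Sm.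
have SL2 b : L2 leb2 (Omega p) (S b) by case: b.
pose unk := unknown p lam U; pose sys := inlet_system p lam U L.
have bothE psi : both (unk psi false) (unk psi true) = unk psi by apply/funext; case.
have XE psi : X psi = (unk psi false, unk psi true) by rewrite /X /unknowns !pi_E.
have XR psi : admissible psi -> RP p (X psi).1 /\ RP p (X psi).2.
  by move=> [_ psiA]; rewrite XE; split; exact: (RP_unknown hp hspec).
have neuP psi c1 c2 : admissible psi -> neumann psi c1 c2 <-> sys (unk psi) c2 S.
  by move=> [_ psiA]; exact: (neumannP hp hspec hL c1 c2 psiA SL2).
have inj psi psi' : admissible psi -> admissible psi' ->
    heq p psi psi' <-> heq2 p (X psi) (X psi').
  move=> [k1 d1] [k2 d2]; rewrite !XE; apply: iff_trans.
    exact: (unknown_eqv hp hspec k1 k2 d1 d2).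
  split=> [h|[h1 h2] b]; first exact: (conj (h false) (h true)).
  by case: b; [exact: h2|exact: h1].
have Hu b : Hspace p (u_ p lam U b) by rewrite u_E; exact: (H_u hp hspec).
(* Necessity of the additional rows: the unknown of sign b is orthogonal to u_b. *)
have extra psi c b : admissible psi -> sys (unk psi) c S ->
    hdot p (opM p lam U L (~~ b) (unk psi (~~ b))) (u_ p lam U b) +
      c * hdot p (@Phi R) (u_ p lam U b) = hdot p (inlet (S b)) (u_ p lam U b).
  move=> [_ d] s; have YR b' := RP_unknown hp hspec b' d.
  have := inlet_system_dot hp hspec hL YR (SL2 b) (Hu b) s.
  by rewrite {1}u_E (dot_unknown_u hp hspec b d) add0r.
(* The converse reading, which recovers orthogonality to u_b from an additional row. *)
have orth Y c b : (forall b', RP p (Y b')) -> sys Y c S ->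
    hdot p (opM p lam U L (~~ b) (Y (~~ b))) (u_ p lam U b) +
      c * hdot p (@Phi R) (u_ p lam U b) = hdot p (inlet (S b)) (u_ p lam U b) ->
    hdot p (Y b) (u_ p lam U b) = 0.
  move=> YR s e; have cancel (r1 r2 r3 : R) : r2 = r3 -> r1 + r2 = r3 -> r1 = 0 by lra.
  exact: (cancel _ _ _ e (inlet_system_dot hp hspec hL YR (SL2 b) (Hu b) s)).
(* The disjunction lists, for each sign, why Y b is some P z: controlled constants, orthogonality to
   u_b, or, for b = + only, the sign of the integral of h. *)
have surj Y c1 c : (forall b, RP p (Y b)) -> sys Y c S ->
    (forall b, [\/ controlled p, hdot p (Y b) (u_ p lam U b) = 0 |
       [/\ b, ~ controlled p & 0 < total_h p]]) ->
    exists psi, [/\ admissible psi, neumann psi c1 c & forall b, heq p (unk psi b) (Y b)].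
  move=> YR s Y0; have [|psi adm e] := unknown_surj hp hspec YR.
    move=> b x xH Px xe xu; have [ctr|u0|[bt nc h0]] := Y0 b.
    - exact: (inlet_eqv0 hp hspec xH Px xe (fun nc => False_ind _ (nc ctr))).
    - apply: (inlet_eqv0 hp hspec xH Px xe) => _.
      by rewrite xu -u_E.
    - by apply: (inlet_eqv0_unbalanced hp hspec nc h0 xH Px) => k; have := xe k; rewrite bt.
  exists psi; split; [exact: adm| |exact: e].
  apply/(neuP psi c1 c adm).
  have UH b := (RP_P hp (RP_unknown hp hspec b adm.2)).1.
  have YH b := (RP_P hp (YR b)).1.
  exact: (inlet_system_eqv hp hspec YH UH (fun b => heq_sym (e b)) s).
split.
- move=> ctr solves.
  have sP Y : RP p Y.1 -> RP p Y.2 -> solves Y <-> sys (both Y.1 Y.2) 0 S.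
    by move=> Y1 Y2; exact: (inlet_system2 hp hspec hL S Y1 Y2).
  have nP psi : admissible psi -> neumann psi 0 0 <-> solves (X psi).
    move=> adm; have [x1 x2] := XR psi adm; apply: (iff_trans (neuP psi 0 0 adm)).
    by apply: iff_sym; apply: (iff_trans (sP _ x1 x2)); rewrite XE bothE.
  split; first exact: nP.
  split=> [psi [adm n]|psi psi' [a _] [a' _]|Y [Y1 [Y2 s]]].
  - by have [x1 x2] := XR psi adm; exact: (conj x1 (conj x2 ((nP psi adm).1 n))).
  - exact: (inj _ _ a a').
  have YR b : RP p (both Y.1 Y.2 b) by case: b.
  have [|psi [adm n e]] := surj _ 0 0 YR ((sP _ Y1 Y2).1 s); first by move=> b; constructor 1.
  exists psi; first exact: (conj adm n).
  by rewrite XE; exact: (conj (e false) (e true)).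
- move=> nc h0 solves c1.
  have sP Y : RP p Y.1 -> RP p Y.2 -> solves Y <-> sys (both Y.1 Y.2) 0 S /\
      hdot p (opM p lam U L true Y.2) (u_ p lam U false) = hdot p (inlet Sm) (u_ p lam U false).
    move=> Y1 Y2; have e := inlet_system2 hp hspec hL S Y1 Y2.
    by split=> -[h1 h2]; [exact: (conj (e.1 h1) h2)|exact: (conj (e.2 h1) h2)].
  have nP psi : admissible psi -> neumann psi c1 0 <-> solves (X psi).
    move=> adm; have [x1 x2] := XR psi adm; apply: (iff_trans (neuP psi c1 0 adm)).
    apply: iff_sym; apply: (iff_trans (sP _ x1 x2)); rewrite XE bothE.
    split=> [[h _]|s]; first exact: h.
    split; first exact: s.
    by have := extra psi 0 false adm s; rewrite mul0r addr0.
  split; first exact: nP.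
  split=> [psi [adm n]|psi psi' [a _] [a' _]|Y [Y1 [Y2 s]]].
  - by have [x1 x2] := XR psi adm; exact: (conj x1 (conj x2 ((nP psi adm).1 n))).
  - exact: (inj _ _ a a').
  have YR b : RP p (both Y.1 Y.2 b) by case: b.
  have [sy e3] := (sP _ Y1 Y2).1 s.
  have [|psi [adm n e]] := surj _ c1 0 YR sy.
    (* For b = + the sign of the integral of h is enough; for b = - the third row, with c = 0, is
       used. *)
    case; first by constructor 3.
    by constructor 2; apply: (orth _ 0 false YR sy); rewrite mul0r addr0.
  exists psi; first exact: (conj adm n).
  by rewrite XE; exact: (conj (e false) (e true)).
move=> bal solves c1.
have sP (Y : _ * R) : RP p Y.1.1 -> RP p Y.1.2 -> solves Y <-> sys (both Y.1.1 Y.1.2) Y.2 S /\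
    forall b, hdot p (opM p lam U L (~~ b) (both Y.1.1 Y.1.2 (~~ b))) (u_ p lam U b) +
      Y.2 * hdot p (@Phi R) (u_ p lam U b) = hdot p (inlet (S b)) (u_ p lam U b).
  move=> Y1 Y2; have e := inlet_system3 hp hspec hL Y.2 S Y1 Y2.
  split=> [[[h1 h2] h3]|[h1 h]].
    by split; [exact: (e.1 h1)|case; [exact: h3|exact: h2]].
  exact: (conj (conj (e.2 h1) (h false)) (h true)).
have nP psi c2 : admissible psi -> neumann psi c1 c2 <-> solves (X psi, c2).
  move=> adm; have [x1 x2] := XR psi adm; apply: (iff_trans (neuP psi c1 c2 adm)).
  apply: iff_sym; apply: (iff_trans (sP (X psi, c2) x1 x2)); rewrite XE bothE.
  split=> [[h _]|s]; first exact: h.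
  exact: (conj s (fun b => extra psi c2 b adm s)).
split; first by move=> psi c2; exact: nP.
split=> [[psi c2] [adm n]|[psi c] [psi' c'] [a _] [a' _]|[Y c] [Y1 [Y2 s]]].
- by have [x1 x2] := XR psi adm; exact: (conj x1 (conj x2 ((nP psi c2 adm).1 n))).
- have := inj psi psi' a a' => i.
  by split=> -[h1 h2]; [exact: (conj (i.1 h1) h2)|exact: (conj (i.2 h1) h2)].
have YR b : RP p (both Y.1 Y.2 b) by case: b.
have [sy e3] := (sP (Y, c) Y1 Y2).1 s.
have [|psi [adm n e]] := surj _ c1 c YR sy.
  by move=> b; constructor 2; exact: (orth _ c b YR sy (e3 b)).
exists (psi, c); first exact: (conj adm n).
by rewrite XE; exact: (conj (conj (e false) (e true)) (erefl c)).
Qed.
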